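(* Let $n\ge 1$ be an integer. The leading and trailing terms of $\mathrm{LG}_{\mathrm{AS}(n)}(s,q)$ are equal to $$s^{4+8n}\cdot q^{2n}\cdot (n+1)\cdot 4^n\qquad\text{and}\qquad s^{-4-8n}\cdot q^{-4-6n}\cdot(n+1)\cdot 4^n,$$ respectively. Therefore the span of the Links--Gould polynomial in the variable $s$ is $$\mathrm{span}_s\big(\mathrm{LG}_{\mathrm{AS}(n)}\big)=4\cdot(4n+2).$$
   Context: **Terminology.** $\mathrm{LG}_{\mathrm{AS}(n)}$ is regarded as a Laurent polynomial in $s$ with coefficients in $\mathbb{Z}[q,q^{-1}]$. Its *leading term* is $s^{d}$ times the highest-$q$-degree monomial of the coefficient of $s^{d}$, where $d$ is the highest $s$-degree; its *trailing term* is $s^{d'}$ times the highest-$q$-degree monomial of the coefficient of $s^{d'}$, where $d'$ is the lowest $s$-degree. The span in $s$ is $d-d'$. **The Links--Gould polynomial $\mathrm{LG}_L(s,q)$ of an oriented link $L\subset S^3$.** Let $\mathrm{U}_q=\mathrm{U}_q(\mathfrak{sl}(2|1))$ be the Hopf superalgebra over $\mathbb{Q}(q,s)$ ($q,s$ indeterminates) with generators $E_i,F_i,K_i^{\pm1}$ ($i=1,2$), where $E_2,F_2$ are odd and the other generators even, Cartan matrix $(a_{ij})=\begin{pmatrix}2&-1\\-1&0\end{pmatrix}$, and relations: the $K_i$ commute, $K_iE_j=q^{a_{ij}}E_jK_i$, $K_iF_j=q^{-a_{ij}}F_jK_i$, $E_iF_j-(-1)^{|E_i||F_j|}F_jE_i=\delta_{ij}\frac{K_i-K_i^{-1}}{q-q^{-1}}$,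 $E_2^2=F_2^2=0$, $E_1^2E_2-(q+q^{-1})E_1E_2E_1+E_2E_1^2=0$ and the same relation for $F$. The coproduct is $\Delta(E_i)=E_i\otimes K_i+1\otimes E_i$, $\Delta(F_i)=F_i\otimes1+K_i^{-1}\otimes F_i$, $\Delta(K_i)=K_i\otimes K_i$, with the usual sign rule $(a\otimes b)(v\otimes w)=(-1)^{|b||v|}av\otimes bw$. Let $V=V(0,\alpha)$ (where $s=q^\alpha$) be the irreducible $4$-dimensional module with basis $x_0,x_1=F_2x_0,x_2=F_1x_1,x_3=F_2x_2$, where $x_0$ is even, $E_ix_0=0$, $F_1x_0=0$, $K_1x_0=x_0$, $K_2x_0=s\,x_0$. Then $V\otimes V$ is a direct sum of three pairwise non-isomorphic irreducibles: one of dimension $4$ whose highest weight vector has $(K_1,K_2)$-eigenvalues $(1,s^2)$, one of dimension $8$ with highest weight $(q,s^2)$, and one of dimension $4$ with highest weight $(1,qs^2)$. Let $\sigma\in\mathrm{End}_{\mathrm{U}_q}(V\otimes V)$ act on these by the scalars $s^2$, $-1$, $q^{-2}s^{-2}$ respectively, and let $\mu=\mathrm{diag}(s^{-2},-s^{-2},-q^{-2}s^{-2},q^{-2}s^{-2})$ in the basis $x_0,\dots,x_3$. The operator $\sigma$ satisfies the braid relation. If $L$ is the closure of a braid $\beta\in B_m$, let $\psi(\beta)\in\mathrm{End}(V^{\otimes m})$ be the operator obtained by sending each positive generator $\sigma_i$ (positive crossing) to $\sigma$ acting on factors $i,i+1$; the partial trace over the factors $2,\dots,m$ of $(\mathrm{id}\otimes\mu^{\otimes(m-1)})\circ\psi(\beta)$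 is a scalar multiple of $\mathrm{id}_V$, and $\mathrm{LG}_L(s,q)$ is that scalar. It is an invariant of oriented links, equal to $1$ on the unknot and to $s^2+q^{-2}s^{-2}-1-q^{-2}$ on the positive Hopf link. **The links $\mathrm{AS}(n)$.** All tangles below are drawn in a rectangle with four endpoints: bottom-left (BL), bottom-right (BR), top-left (TL), top-right (TR); the tangle is oriented inward at BL and TR and outward at TL and BR. *The tangles $TT^{+},TT^-$.* Let $D$ be the tangle made of two antiparallel strands following the long right-handed trefoil with framing $0$: one strand runs from BL to TL along a long right-handed trefoil, the other is its $0$-framed parallel copy, oriented oppositely (from TR to BR). Concretely, take the long-knot diagram obtained from the $2$-strand braid $\sigma_1^3$ (three positive crossings) by closing its right strand on the right, replace it by its two-strand blackboard-parallel, and insert on top three full twists (six crossings) between the two strands, all six crossings being positive for the antiparallel orientation. Let $C^{\varepsilon}$ ($\varepsilon=\pm$) be the clasp tangle: an unknotted arc from BL to BR (a cap) and an unknotted arc from TR to TL (a cup), whose projections overlap in exactly two crossings, both of sign $\varepsilon$. Then $TT^{\varepsilon}$ is $C^{\varepsilon}$ stacked on top of $D$. *Horizontal concatenation.* For two such tangles $f,g$, $f\boxtimes g$ is obtained by placing $g$ to the right of $f$, joining the TR endpoint of $f$ to the TL endpoint of $g$ by an arc above and the BR endpoint of $f$ to the BL endpoint of $g$ by an arc below; the remaining endpoints are BL, TL of $f$ and BR, TR of $g$. $f^{\boxtimes n}$ is the $n$-fold iterate. *Closure.* Put $f=(TT^+\boxtimes TT^-)^{\boxtimes n}$ in the rectangle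 $[0,2]\times[0,1]$ with endpoints BL $=(0.2,0)$, BR $=(1.8,0)$, TL $=(0.2,1)$, TR $=(1.8,1)$. Then $\mathrm{AS}(n)$ is the oriented $3$-component link consisting of $f$ together with: (i) an arc from BR straight down to $(1.8,-1)$, along the lower semicircle to $(0.2,-1)$, and straight up to BL; (ii) an arc from TL going up and to the right to $(1,2.6)$, then around the right-hand side and below everything else in the picture to $(-0.5,-2)$, then straight up to $(-0.5,-1)$, up to $(0.2,2)$, and then to the right and down into TR; this arc has exactly one self-crossing, located just above the rectangle, at which the portion leaving TL passes over the portion going into TR; (iii) a simple closed curve $C$, oriented counterclockwise, through $(-1.2,-1)$ and $(0.9,-1)$, encircling the points $(-0.5,-1)$ and $(0.2,-1)$; its lower half passes over the two upward strands it meets (the one at $x=-0.5$ and the one near $x=0.2$) and its upper half passes under both of them, and $C$ meets nothing else.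
   Formalization: The self-crossing of arc (ii) is taken positive: the portion going into TR passes over the portion leaving TL. With the crossing as described (portion leaving TL over) the coefficient is 4^n instead of (n+1)4^n, e.g. 4 instead of 8 for n=1. *)

(* Defs.v *)
From HB Require Import structures.
From Stdlib Require Import Relations ClassicalEpsilon.
From mathcomp Require Import all_boot all_order all_algebra finmap.
From mathcomp Require Import ring.

Set Implicit Arguments.
Unset Strict Implicit.
Unset Printing Implicit Defensive.

Import GRing.Theory.
Local Open Scope ring_scope.

(** * The ground field Q(q,s) and Laurent polynomials in s, q over Z *)

(* The outer variable of {poly {poly rat}} is s, the inner one is q. *)
Definition K : fieldType := {fraction {poly {poly rat}}}.

Definition sK : K := tofrac ('X : {poly {poly rat}}).
Definition qK : K := tofrac (('X : {poly rat})%:P : {poly {poly rat}}).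

(* [P (i, j)] is the coefficient of s^i q^j; the support is finite. *)
Definition laurent := {fsfun int * int -> int with 0}.

Definition laurent_val (P : laurent) : K :=
  \sum_(k <- finsupp P) (P k)%:~R * sK ^ k.1 * qK ^ k.2.

Definition top_sdeg (P : laurent) (d : int) : Prop :=
  (exists j, P (d, j) != 0) /\ (forall i j, P (i, j) != 0 -> i <= d).

Definition bot_sdeg (P : laurent) (d : int) : Prop :=
  (exists j, P (d, j) != 0) /\ (forall i j, P (i, j) != 0 -> d <= i).

(* [a q^e] is the highest-q-degree monomial of the coefficient of s^d. *)
Definition top_qmonomial (P : laurent) (d e a : int) : Prop :=
  [/\ a != 0, P (d, e) = a & forall j, P (d, j) != 0 -> j <= e].

Definition leading_term (P : laurent) (d e a : int) : Prop :=
  top_sdeg P d /\ top_qmonomial P d e a.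

(* The trailing term also takes the highest power of q. *)
Definition trailing_term (P : laurent) (d e a : int) : Prop :=
  bot_sdeg P d /\ top_qmonomial P d e a.

Definition span_s (P : laurent) (k : int) : Prop :=
  exists d d', [/\ top_sdeg P d, bot_sdeg P d' & k = d - d'].

(** * U_q(sl(2|1)), the module V(0,alpha), and the operator sigma *)

(* Everything here is over a field F with two elements q, s; it is used for
   F = Q(q,s) only. Matrices act on column vectors: column j of M holds the
   image of x_j. *)

Record uq_gens (F : fieldType) (d : nat) := UqGens {
  uE : 'I_2 -> 'M[F]_d;
  uF : 'I_2 -> 'M[F]_d;
  uK : 'I_2 -> 'M[F]_d }.

(* Index 0 is the even simple root, index 1 the odd one. *)
Definition uq_odd (i : 'I_2) : bool := i != 0.

Definition cartan (i j : 'I_2) : int :=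
  if i != j then -1 else if i == 0 then 2 else 0.

Record uq_relations (F : fieldType) (q : F) (d : nat) (g : uq_gens F d) : Prop :=
UqRelations {
  uq_Kunit : forall i, uK g i \in unitmx;
  uq_KK : forall i j, uK g i *m uK g j = uK g j *m uK g i;
  uq_KE : forall i j, uK g i *m uE g j = q ^ cartan i j *: (uE g j *m uK g i);
  uq_KF : forall i j,
    uK g i *m uF g j = q ^ (- cartan i j) *: (uF g j *m uK g i);
  uq_EF : forall i j,
    uE g i *m uF g j - (-1) ^+ (uq_odd i && uq_odd j) *: (uF g j *m uE g i)
    = if i == j then (q - q^-1)^-1 *: (uK g i - invmx (uK g i)) else 0;
  uq_EE : uE g 1 *m uE g 1 = 0;
  uq_FF : uF g 1 *m uF g 1 = 0;
  uq_serreE : uE g 0 *m uE g 0 *m uE g 1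
    - (q + q^-1) *: (uE g 0 *m uE g 1 *m uE g 0)
    + uE g 1 *m uE g 0 *m uE g 0 = 0;
  uq_serreF : uF g 0 *m uF g 0 *m uF g 1
    - (q + q^-1) *: (uF g 0 *m uF g 1 *m uF g 0)
    + uF g 1 *m uF g 0 *m uF g 0 = 0 }.

(* The scalar by which (K_i - K_i^-1) / (q - q^-1) acts where K_i acts by z. *)
Definition qbr (F : fieldType) (q z : F) : F := (z - z^-1) / (q - q^-1).

Definition mx4 (F : fieldType) (r : seq (seq F)) : 'M[F]_4 :=
  \matrix_(i, j) nth 0 (nth [::] r i) j.

Definition diag4 (F : fieldType) (r : seq F) : 'M[F]_4 :=
  \matrix_(i, j) (nth 0 r i *+ (i == j)).

(* The module V(0,alpha) in the basis x_0, x_1 = F_2 x_0, x_2 = F_1 x_1,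
   x_3 = F_2 x_2. Given K_1 x_0 = x_0, K_2 x_0 = s x_0, E_i x_0 = 0 and
   F_1 x_0 = 0, the rest of the action is forced by the relations, which are
   checked in [V_relations]. *)
Definition V (F : fieldType) (q s : F) : uq_gens F 4 := {|
  uE := fun i => if i == 0
    then mx4 [:: [:: 0; 0; 0; 0]; [:: 0; 0; 1; 0];
                 [:: 0; 0; 0; 0]; [:: 0; 0; 0; 0]]
    else mx4 [:: [:: 0; qbr q s; 0; 0]; [:: 0; 0; 0; 0];
                 [:: 0; 0; 0; qbr q (q * s)]; [:: 0; 0; 0; 0]];
  uF := fun i => if i == 0
    then mx4 [:: [:: 0; 0; 0; 0]; [:: 0; 0; 0; 0];
                 [:: 0; 1; 0; 0]; [:: 0; 0; 0; 0]]
    else mx4 [:: [:: 0; 0; 0; 0]; [:: 1; 0; 0; 0];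
                 [:: 0; 0; 0; 0]; [:: 0; 0; 1; 0]];
  uK := fun i => if i == 0
    then diag4 [:: 1; q; q^-1; 1]
    else diag4 [:: s; s; q * s; q * s] |}.

Lemma diag4_inv (F : fieldType) (r r' : seq F) :
  (forall i : 'I_4, nth 0 r i * nth 0 r' i = 1) ->
  diag4 r \in unitmx /\ invmx (diag4 r) = diag4 r'.
Proof.
move=> h; have e : diag4 r *m diag4 r' = 1%:M.
  apply/matrixP => i j; rewrite !mxE (bigD1 i) //= big1 => [|k /negPf ki].
    by rewrite !mxE eqxx mulr1n mulrnAr h addr0.
  by rewrite !mxE eq_sym ki mul0r.
have [u _] := mulmx1_unit e; split=> //.
by rewrite -[RHS]mul1mx -(mulVmx u) -mulmxA e mulmx1.
Qed.

Lemma diag4_delta (F : fieldType) (r : seq F) (i j : 'I_4) :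
  diag4 r *m delta_mx i j = nth 0 r i *: delta_mx i j.
Proof.
apply/matrixP => a b; rewrite !mxE (bigD1 a) //= big1 => [|k /negPf ka].
  by rewrite !mxE eqxx mulr1n addr0; case: eqP => [->|]; rewrite ?mulr0.
by rewrite !mxE eq_sym ka mul0r.
Qed.

Lemma delta_diag4 (F : fieldType) (r : seq F) (i j : 'I_4) :
  delta_mx i j *m diag4 r = nth 0 r j *: delta_mx i j.
Proof.
apply/matrixP => a b; rewrite !mxE (bigD1 b) //= big1 => [|k /negPf kb].
  rewrite !mxE eqxx mulr1n addr0 mulrC.
  by case: (b =P j) => [->|]; rewrite ?andbF ?mulr0.
by rewrite !mxE kb mulr0.
Qed.

Lemma diag4_mul (F : fieldType) (r r' : seq F) :
  diag4 r *m diag4 r' = \matrix_(i, j) (nth 0 r i * nth 0 r' i *+ (i == j)).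
Proof.
apply/matrixP => i j; rewrite !mxE (bigD1 i) //= big1 => [|k /negPf ki].
  by rewrite !mxE eqxx mulr1n mulrnAr addr0.
by rewrite !mxE eq_sym ki mul0r.
Qed.

Lemma mx4_delta (F : fieldType) (x y z : F) :
  [/\ mx4 [:: [:: 0; 0; 0; 0]; [:: 0; 0; x; 0];
              [:: 0; 0; 0; 0]; [:: 0; 0; 0; 0]] = x *: delta_mx 1 2%R,
      mx4 [:: [:: 0; y; 0; 0]; [:: 0; 0; 0; 0];
              [:: 0; 0; 0; z]; [:: 0; 0; 0; 0]]
        = y *: delta_mx 0 1 + z *: delta_mx 2%R 3%R,
      mx4 [:: [:: 0; 0; 0; 0]; [:: 0; 0; 0; 0];
              [:: 0; x; 0; 0]; [:: 0; 0; 0; 0]] = x *: delta_mx 2%R 1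
    & mx4 [:: [:: 0; 0; 0; 0]; [:: y; 0; 0; 0];
              [:: 0; 0; 0; 0]; [:: 0; 0; z; 0]]
        = y *: delta_mx 1 0 + z *: delta_mx 3%R 2%R].
Proof.
by split; apply/matrixP => -[[|[|[|[|//]]]] ?] [[|[|[|[|//]]]] ?];
  rewrite !mxE /= ?mulr1 ?mulr0 ?addr0 ?add0r.
Qed.

Lemma V_relations (F : fieldType) (q s : F) :
  q != 0 -> s != 0 -> q - q^-1 != 0 -> uq_relations q (V q s).
Proof.
move=> q0 s0 q2.
have q1 : q ^+ 2 - 1 != 0.
  apply: contraNneq q2 => h; apply/eqP/(mulfI q0).
  by rewrite mulrBr mulfV // -expr2 h mulr0.
have [u0 i0] : diag4 [:: 1; q; q^-1; 1] \in unitmx /\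
    invmx (diag4 [:: 1; q; q^-1; 1]) = diag4 [:: 1; q^-1; q; 1].
  by apply: diag4_inv => -[[|[|[|[|//]]]] ?] /=; rewrite ?mulr1 ?mulfV ?mulVf.
have [u1 i1] : diag4 [:: s; s; q * s; q * s] \in unitmx /\
    invmx (diag4 [:: s; s; q * s; q * s])
    = diag4 [:: s^-1; s^-1; (q * s)^-1; (q * s)^-1].
  by apply: diag4_inv => -[[|[|[|[|//]]]] ?] /=; rewrite mulfV ?mulf_neq0.
have I2 (P : 'I_2 -> Prop) : P 0 -> P 1 -> forall i, P i.
  move=> p0 p1 -[[|[|//]] hi].
    by rewrite (_ : Ordinal hi = 0) //; apply: val_inj.
  by rewrite (_ : Ordinal hi = 1) //; apply: val_inj.
have [e0 _ f0 _] := mx4_delta (1 : F) 0 0; rewrite !scale1r in e0 f0.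
have [_ e1 _ _] := mx4_delta (0 : F) (qbr q s) (qbr q (q * s)).
have [_ _ _ f1] := mx4_delta (0 : F) 1 1; rewrite !scale1r in f1.
have D (i j k l : 'I_4) :
    delta_mx i j *m delta_mx k l = delta_mx i l *+ (j == k) :> 'M[F]_4.
  by rewrite mul_delta_mx_cond.
have E00 : uE (V q s) 0 *m uE (V q s) 0 = 0 by rewrite /= e0 D.
have F00 : uF (V q s) 0 *m uF (V q s) 0 = 0 by rewrite /= f0 D.
have E010 : uE (V q s) 0 *m uE (V q s) 1 *m uE (V q s) 0 = 0.
  rewrite /= e0 e1 mulmxDr -!scalemxAr !D /= mulr0n mulr1n scaler0 add0r.
  by rewrite -scalemxAl D scaler0.
have F010 : uF (V q s) 0 *m uF (V q s) 1 *m uF (V q s) 0 = 0.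
  by rewrite /= f0 f1 mulmxDr !D /= mulr0n mulr1n addr0 D.
split.
- by apply: (I2).
- apply: (I2); apply: (I2); rewrite //= !diag4_mul;
  by apply/matrixP => i j; rewrite !mxE mulrC.
- apply: (I2); apply: (I2); rewrite /= ?e0 ?e1 /cartan /= ?expr0z ?exprN1 -?exprnP
    ?mulmxDl ?mulmxDr -?scalemxAl -?scalemxAr ?diag4_delta ?delta_diag4 /=
    ?scalerDr ?scalerA.
  + by congr (_ *: _); field.
  + by congr (_ *: _ + _ *: _); field.
  + by congr (_ *: _); field.
  + by congr (_ *: _ + _ *: _); ring.
- apply: (I2); apply: (I2); rewrite /= ?f0 ?f1 /cartan /= ?opprK ?oppr0 ?expr0z
    ?exprN1 -?exprnN -?exprnP ?mulmxDl ?mulmxDr -?scalemxAl -?scalemxAr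
    ?diag4_delta ?delta_diag4 /= ?scalerDr ?scalerA ?scale1r.
  + by congr (_ *: _); field.
  + by rewrite expr1 mulr1 mulfV // scale1r.
  + by rewrite expr1.
  + by rewrite !mul1r.
- apply: (I2); apply: (I2); rewrite /= ?i0 ?i1 ?e0 ?e1 ?f0 ?f1 ?mulmxDl ?mulmxDr
    -?scalemxAl -?scalemxAr !D /= ?mulr0n ?mulr1n ?scaler0 ?addr0 ?add0r ?scaler0
    ?subr0 ?scale1r ?expr0 ?expr1.
  + apply/matrixP => -[[|[|[|[|//]]]] ?] [[|[|[|[|//]]]] ?]; rewrite !mxE /=;
      do [ring | by field; rewrite ?q0 ?q1].
  + exact: oppr0.
  + exact: oppr0.
  + apply/matrixP => -[[|[|[|[|//]]]] ?] [[|[|[|[|//]]]] ?]; rewrite !mxE /= /qbr;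
      do [ring | by field; rewrite ?q0 ?s0 ?q1].
- rewrite /= e1 mulmxDl !mulmxDr -!scalemxAl -!scalemxAr !D /=.
  by rewrite !mulr0n !scaler0 !addr0.
- by rewrite /= f1 mulmxDl !mulmxDr !D /= !mulr0n !addr0.
- by rewrite E00 E010 -mulmxA E00 mulmx0 mul0mx scaler0 subr0 addr0.
- by rewrite F00 F010 -mulmxA F00 mulmx0 mul0mx scaler0 subr0 addr0.
Qed.

Definition V_odd (a : 'I_4) : bool := (a == 1 :> nat) || (a == 2 :> nat).

(* Endomorphisms of V (x) V are matrices in the basis x_a (x) x_b, indexed by
   pairs. *)
Definition VV_dim : nat := #|{: 'I_4 * 'I_4}|.

(* [stens p A B] is A (x) B, where B has parity p:
   (A (x) B)(v (x) w) = (-1)^(p |v|) A v (x) B w. *)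
Definition stens (F : fieldType) (p : bool) (A B : 'M[F]_4) : 'M[F]_VV_dim :=
  \matrix_(x, y) let: (a, b) := enum_val x in let: (c, d) := enum_val y in
    (-1) ^+ (p && V_odd c) * A a c * B b d.

Definition VV (F : fieldType) (q s : F) : uq_gens F VV_dim := {|
  uE := fun i => stens false (uE (V q s) i) (uK (V q s) i)
                 + stens (uq_odd i) 1%:M (uE (V q s) i);
  uF := fun i => stens false (uF (V q s) i) 1%:M
                 + stens (uq_odd i) (invmx (uK (V q s) i)) (uF (V q s) i);
  uK := fun i => stens false (uK (V q s) i) (uK (V q s) i) |}.

Definition highest_weight (F : fieldType) (d : nat) (g : uq_gens F d)
    (l1 l2 : F) (v : 'cV[F]_d) : Prop :=
  [/\ v != 0, forall i, uE g i *m v = 0, uK g 0 *m v = l1 *: v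
    & uK g 1 *m v = l2 *: v].

(* Subspaces are row spaces, so vectors are transposed and operators act by
   their transposes. *)
Definition submodule (F : fieldType) (d : nat) (g : uq_gens F d)
    (W : 'M[F]_d) : Prop :=
  forall i, [/\ stablemx W (uE g i)^T, stablemx W (uF g i)^T
              & stablemx W (uK g i)^T].

(* w lies in the submodule generated by v. *)
Definition generated (F : fieldType) (d : nat) (g : uq_gens F d)
    (v w : 'cV[F]_d) : Prop :=
  forall W, submodule g W -> (v^T <= W)%MS -> (w^T <= W)%MS.

(* The three irreducible summands of V (x) V are the submodules generated by
   the highest weight vectors of weights (1, s^2), (q, s^2) and (1, q s^2). *)
Record is_sigma (F : fieldType) (q s : F) (S : 'M[F]_VV_dim) : Prop := IsSigma {
  sigma_E : forall i, S *m uE (VV q s) i = uE (VV q s) i *m S;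
  sigma_F : forall i, S *m uF (VV q s) i = uF (VV q s) i *m S;
  sigma_K : forall i, S *m uK (VV q s) i = uK (VV q s) i *m S;
  sigma_1 : forall v w, highest_weight (VV q s) 1 (s ^+ 2) v ->
    generated (VV q s) v w -> S *m w = s ^+ 2 *: w;
  sigma_2 : forall v w, highest_weight (VV q s) q (s ^+ 2) v ->
    generated (VV q s) v w -> S *m w = - w;
  sigma_3 : forall v w, highest_weight (VV q s) 1 (q * s ^+ 2) v ->
    generated (VV q s) v w -> S *m w = (q ^- 2 * s ^- 2) *: w }.

Definition sigma (F : fieldType) (q s : F) : 'M[F]_VV_dim :=
  epsilon (inhabits 0) (is_sigma q s).

Definition mu (F : fieldType) (q s : F) : seq F :=
  [:: s ^- 2; - s ^- 2; - (q ^- 2 * s ^- 2); q ^- 2 * s ^- 2].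

(** * Tensor powers of V and the braid representation *)

Definition tpow_dim (m : nat) : nat := #|{: m.-tuple 'I_4}|.

Definition tpow_op (F : fieldType) (m : nat) := 'M[F]_(tpow_dim m).

(* id (x) ... (x) S (x) ... (x) id, with S on the (0-based) factors i, i+1.
   S is even, so no signs appear. *)
Definition act2 (F : fieldType) (k : nat) (i : 'I_k) (S : 'M[F]_VV_dim) :
    tpow_op F k.+1 :=
  \matrix_(x, y)
    let t : k.+1.-tuple 'I_4 := enum_val x in
    let u : k.+1.-tuple 'I_4 := enum_val y in
    let j := widen_ord (leqnSn k) i in let j' := lift ord0 i in
    if [forall l : 'I_k.+1, [|| l == j, l == j' | tnth t l == tnth u l]]
    then S (enum_rank (tnth t j, tnth t j')) (enum_rank (tnth u j, tnth u j'))
    else 0.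

(* A braid word on k+1 strands, read from bottom to top: (i, true) is the
   positive crossing of strands i, i+1 (0-based) and (i, false) its inverse. *)
Definition braid (k : nat) := seq ('I_k * bool).

Definition psi (F : fieldType) (q s : F) (k : nat) (b : braid k) :
    tpow_op F k.+1 :=
  foldl (fun M x =>
           act2 x.1 (if x.2 then sigma q s else invmx (sigma q s)) *m M)
        1%:M b.

(* id (x) mu (x) ... (x) mu *)
Definition id_mu (F : fieldType) (q s : F) (k : nat) : tpow_op F k.+1 :=
  \matrix_(x, y) (let t : k.+1.-tuple 'I_4 := enum_val x in
    (\prod_(l : 'I_k) nth 0 (mu q s) (tnth t (lift ord0 l))) *+ (x == y)).

Definition ptrace (F : fieldType) (k : nat) (M : tpow_op F k.+1) : 'M[F]_4 :=
  \matrix_(a, b) \sum_(t : k.-tuple 'I_4)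
    M (enum_rank [tuple of a :: t]) (enum_rank [tuple of b :: t]).

(** * Oriented link diagrams *)

(* A diagram in general position with respect to the height function is read
   from bottom to top as a word of elementary events. The word is run on the
   list of orientations of the strands met by a horizontal line, from left to
   right (true = upwards). The event (i, e) takes place to the right of the
   first i strands.
   - Cup o: a local minimum, whose left leg has orientation o;
   - Cap: a local maximum;
   - Cross b: a crossing; b = true iff the strand going from bottom left to
     top right is the over-strand. It is positive iff b is true and the two
     strands are parallel, or b is false and they are antiparallel. *)
Inductive event := Cup of bool | Cap | Cross of bool.

Definition diagram := seq (nat * event).

Definition step (st : seq bool) (x : nat * event) : option (seq bool) :=
  let: (i, e) := x in
  match e with
  | Cup o =>
      if (i <= size st)%N then Some (take i st ++ [:: o; ~~ o] ++ drop i st)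
      else None
  | Cap =>
      if drop i st is a :: b :: st' then
        if a != b then Some (take i st ++ st') else None
      else None
  | Cross _ =>
      if drop i st is a :: b :: st' then Some (take i st ++ b :: a :: st')
      else None
  end.

Definition run (st : seq bool) (D : diagram) : option (seq bool) :=
  foldl (fun o x => obind (step^~ x) o) (Some st) D.

Definition link_diagram (D : diagram) : Prop := run [::] D = Some [::].

Definition legs_in (e : event) : nat := if e is Cup _ then 0 else 2.
Definition legs_out (e : event) : nat := if e is Cap then 0 else 2.

(* Turaev's moves: planar isotopy (distant events, zigzags, sliding a strand
   past a local extremum) and Reidemeister moves. *)
Inductive move : diagram -> diagram -> Prop :=
| move_distant i k e e' :
    move [:: (i, e); (i + legs_out e + k, e')%N]
         [:: (i + legs_in e + k, e')%N; (i, e)]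
| move_zigzag_l i o : move [:: (i.+1, Cup o); (i, Cap)] [::]
| move_zigzag_r i o : move [:: (i, Cup o); (i.+1, Cap)] [::]
| move_slide_cap i b :
    move [:: (i.+1, Cross b); (i, Cap)] [:: (i, Cross (~~ b)); (i.+1, Cap)]
| move_slide_cup i o b :
    move [:: (i, Cup o); (i.+1, Cross b)] [:: (i.+1, Cup o); (i, Cross (~~ b))]
| move_R1_cap i b : move [:: (i, Cross b); (i, Cap)] [:: (i, Cap)]
| move_R1_cup i o b : move [:: (i, Cup o); (i, Cross b)] [:: (i, Cup (~~ o))]
| move_R2 i b : move [:: (i, Cross b); (i, Cross (~~ b))] [::]
| move_R3 i b :
    move [:: (i, Cross b); (i.+1, Cross b); (i, Cross b)]
         [:: (i.+1, Cross b); (i, Cross b); (i.+1, Cross b)].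

Inductive local_move : diagram -> diagram -> Prop :=
| LocalMove A B D D' :
    move D D' -> link_diagram (A ++ D ++ B) -> link_diagram (A ++ D' ++ B) ->
    local_move (A ++ D ++ B) (A ++ D' ++ B).

Definition isotopic : diagram -> diagram -> Prop :=
  clos_refl_sym_trans diagram local_move.

(* The closure of a braid (oriented upwards), to its right. *)
Definition closure (k : nat) (b : braid k) : diagram :=
  [seq (i, Cup true) | i <- iota 0 k.+1]
  ++ [seq (nat_of_ord x.1, Cross x.2) | x <- b]
  ++ [seq (i, Cap) | i <- rev (iota 0 k.+1)].

(** * The Links-Gould polynomial *)

Definition is_LG (L : diagram) (P : K) : Prop :=
  exists (k : nat) (b : braid k),
    isotopic (closure b) L /\ ptrace (id_mu qK sK k *m psi qK sK b) = P%:M.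

Definition LG (L : diagram) : K := epsilon (inhabits 0) (is_LG L).

(** * The links AS(n) *)

Definition shift (k : nat) (D : diagram) : diagram :=
  [seq ((x.1 + k)%N, x.2) | x <- D].

(* The tangles D, C^e, TT^e below have both endpoint lists equal to
   [:: true; false]. Stacking a tangle on top of another one is [++]. *)

Definition doubled_crossing : diagram :=
  [:: (1, Cross true); (0, Cross true); (2, Cross true); (1, Cross true)]%N.

Definition trefoil_band : diagram :=
  [:: (2, Cup true); (3, Cup false)]%N
  ++ doubled_crossing ++ doubled_crossing ++ doubled_crossing
  ++ [:: (3, Cap); (2, Cap)]%N
  ++ nseq 6 (0%N, Cross false).

(* The arc coming from the bottom is the left leg of crossing 0 and the right
   leg of crossing 2; in both crossings the two strands are parallel. *)
Definition clasp (e : bool) : diagram :=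
  [:: (1, Cup true); (0, Cross e); (2, Cross e); (1, Cap)]%N.

Definition TT (e : bool) : diagram := trefoil_band ++ clasp e.

Definition box (f g : diagram) : diagram :=
  (1%N, Cup false) :: f ++ shift 2 g ++ [:: (1%N, Cap)].

(* f boxed with itself n times, for n >= 1. *)
Definition box_pow (f : diagram) (n : nat) : diagram :=
  iter n.-1 (fun g => box g f) f.

(* After the first two cups, the strands are, from left to right: the outer
   arc a (from TL of f around everything and back to TR of f) going up, the
   arc from BR to BL of f going up, then down, and a going down. The next six
   events are the counterclockwise circle C: it is created on the left, its
   right leg passes over the two upward strands, then back under them. The
   first crossing above f is the self-crossing of a: its part coming from TL
   goes from bottom right to top left, its part going to TR from bottom left
   to top right. It is a positive crossing. *)
Definition AS (n : nat) : diagram :=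
  [:: (0, Cup true); (1, Cup true)]%N
  ++ [:: (0, Cup false); (1, Cross true); (2, Cross true);
         (2, Cross true); (1, Cross true); (0, Cap)]%N
  ++ shift 1 (box_pow (box (TT true) (TT false)) n)
  ++ [:: (0, Cross true); (1, Cap); (0, Cap)]%N.

(* Main.v *)
(** A diagram starts with a minimum; cut open there, it has a state sum, with
    sigma at the positive crossings and rotations of it at the others, which is
    invariant under all moves. Since every link is the closure of a braid, this
    state sum is the Links-Gould invariant.

    Put v = q^-2 and c = s^2 + q^-2 s^-2. As far as state sums see, the identity
    tangle E, the cut tangle 1 and the positive clasp T span an algebra under
    horizontal concatenation, in which E^2 = 0, and in the basis E, 1, T - c E the
    coordinates of TT^+ and q^-2 TT^- are polynomials in c and v. At v = 0 their
    leading parts in c are c E + 2 c^2, so that the product of 2n of them starts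
    with 4^n (c^(4n) + n c^(4n-1) E), which closes up to (n+1) 4^n c^(4n+2).
    This term alone gives both extreme terms in s. *)

From HB Require Import structures.
From Stdlib Require Import ZArith Relations ClassicalEpsilon.
From mathcomp Require Import all_boot all_order all_algebra finmap.
From mathcomp Require Import ring zify ssrZ.
Require Import Defs.

Set Implicit Arguments.
Unset Strict Implicit.
Unset Printing Implicit Defensive.

Import Order.TTheory GRing.Theory Num.Theory.
Local Open Scope ring_scope.
Delimit Scope Z_scope with bZ.

(** * Computable Laurent polynomials and sparse vectors *)

(** The diagram is cut because a closed state sum is worthless: the entries of mu add up to 0, so a
    free circle has value 0. The price is that the place of the cut must be shown not to matter.
    Since sigma commutes with U_q, what lies above a minimum is a U_q-invariant functional, and two
    linear identities valid for all invariant functionals settle the question: on one upward and one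
    downward strand they are multiples of the cap, and on two such pairs they do not see which pair
    is cut and which is closed. Both identities are proved by explicit certificates, which take the
    place of representation theory. Sigma and the polynomial are both chosen by [epsilon], so each
    needs a unique candidate. Sigma is determined because three explicit highest weight vectors
    generate the tensor square. The polynomial is determined because the state sum is an invariant
    of diagrams, which plays the role of Markov's theorem, while Alexander's theorem provides
    existence. Identities between fixed diagrams are computed with integer Laurent polynomials and
    carried to the field by evaluation. *)

(* [(c, (i, j))] stands for c q^i s^j; lists are kept sorted by exponent. *)
Definition lterm := (Z * (Z * Z))%type.
Definition lpoly := seq lterm.

Definition lcmp (x y : Z * Z) : comparison :=
  match Z.compare x.1 y.1 with Eq => Z.compare x.2 y.2 | c => c end.

(** The merge is a correct sum for arbitrary lists ([lval_add]). Order decides whether equal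
    exponents meet and cancel, so it bears on the success of the test [leqb], not on its
    soundness. *)
Fixpoint ladd (p : lpoly) : lpoly -> lpoly :=
  if p isn't t :: p' then id else fix ladd_t r :=
    if r isn't u :: r' then p else
    match lcmp t.2 u.2 with
    | Lt => t :: ladd p' r
    | Gt => u :: ladd_t r'
    | Eq => let c := Z.add t.1 u.1 in
            if Z.eqb c 0 then ladd p' r' else (c, t.2) :: ladd p' r'
    end.

Definition lmulterm (t u : lterm) : lterm :=
  (Z.mul t.1 u.1, (Z.add t.2.1 u.2.1, Z.add t.2.2 u.2.2)).

Fixpoint lmul (p r : lpoly) : lpoly :=
  if p is t :: p' then ladd [seq lmulterm t u | u <- r] (lmul p' r) else [::].

Definition lopp (p : lpoly) : lpoly := [seq (Z.opp t.1, t.2) | t <- p].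
Definition lone : lpoly := [:: (1, (0, 0))]%bZ.
Definition leqb (p r : lpoly) : bool := nilp (ladd p (lopp r)).

Section LaurentEval.
Variables (F : fieldType) (q s : F).
Hypotheses (q0 : q != 0) (s0 : s != 0).

Definition zval (c : Z) : F := (int_of_Z c)%:~R.

Lemma zvalD c d : zval (Z.add c d) = zval c + zval d.
Proof. by rewrite /zval -[Z.add c d]/(c + d) rmorphD /= rmorphD. Qed.
Lemma zvalM c d : zval (Z.mul c d) = zval c * zval d.
Proof. by rewrite /zval -[Z.mul c d]/(c * d) rmorphM /= rmorphM. Qed.
Lemma zvalN c : zval (Z.opp c) = - zval c.
Proof. by rewrite /zval -[Z.opp c]/(- c) rmorphN /= rmorphN. Qed.

Definition tval (t : lterm) : F :=
  zval t.1 * q ^ int_of_Z t.2.1 * s ^ int_of_Z t.2.2.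

Definition lval (p : lpoly) : F := foldr (fun t x => tval t + x) 0 p.

Lemma lcmpP x y : lcmp x y = Eq -> x = y.
Proof.
case: x y => a b [c d]; rewrite /lcmp /=.
by case: Z.compare_spec => // ->; case: Z.compare_spec => // ->.
Qed.

Lemma lval_add p r : lval (ladd p r) = lval p + lval r.
Proof.
elim: p r => [|t p IH] r /=; first by rewrite add0r.
elim: r => [|u r IHr] /=; first by rewrite addr0.
case e: lcmp => /=.
- have {}e := lcmpP e.
  have h : tval t + tval u = tval (Z.add t.1 u.1, t.2).
    by rewrite /tval -e /= zvalD !mulrDl.
  have -> : tval t + lval p + (tval u + lval r)
      = tval (Z.add t.1 u.1, t.2) + (lval p + lval r) by rewrite -h; ring.
  case: Z.eqb_spec => [z|_] /=; rewrite IH //.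
  by rewrite z /tval /zval /= !mul0r add0r.
- by rewrite IH /= addrA.
- by rewrite IHr; ring.
Qed.

Lemma tval_mul t u : tval (lmulterm t u) = tval t * tval u.
Proof.
have e i j : int_of_Z (Z.add i j) = int_of_Z i + int_of_Z j.
  by rewrite -[Z.add i j]/(i + j) rmorphD.
rewrite /tval /= zvalM !e !expfzDr //; ring.
Qed.

Lemma lval_mul p r : lval (lmul p r) = lval p * lval r.
Proof.
elim: p => [|t p IH] /=; first by rewrite mul0r.
rewrite lval_add IH mulrDl; congr (_ + _); move: {IH} r.
elim=> [|u r IHr] /=; first by rewrite mulr0.
by rewrite tval_mul IHr mulrDr.
Qed.

Lemma lval_opp p : lval (lopp p) = - lval p.
Proof.
elim: p => [|t p IH] /=; first by rewrite oppr0.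
by rewrite IH /tval /= zvalN !mulNr opprD.
Qed.

Lemma lval1 : lval lone = 1.
Proof. by rewrite /= /tval /zval /= !expr0z !mulr1 addr0. Qed.

Lemma lval_eqb p r : leqb p r -> lval p = lval r.
Proof.
move=> /nilP h; apply/eqP; rewrite -subr_eq0 -lval_opp -lval_add h.
exact: eqxx.
Qed.

End LaurentEval.

(* The colour of a strand is the index of a basis vector of V. *)
Inductive color := c0 | c1 | c2 | c3.

Definition color_eqb (a b : color) : bool :=
  match a, b with
  | c0, c0 | c1, c1 | c2, c2 | c3, c3 => true | _, _ => false end.

Lemma color_eqbP : Equality.axiom color_eqb.
Proof. by case; case; constructor. Qed.
HB.instance Definition _ := hasDecEq.Build color color_eqbP.

Definition colors : seq color := [:: c0; c1; c2; c3].
Definition word := seq color.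

(* A formal combination of words. The words need not have the same length. *)
Inductive trie := Emp | Node of lpoly & trie & trie & trie & trie.

Fixpoint tadd (t u : trie) : trie :=
  match t, u with
  | Emp, _ => u
  | _, Emp => t
  | Node p t0 t1 t2 t3, Node r u0 u1 u2 u3 =>
      Node (ladd p r) (tadd t0 u0) (tadd t1 u1) (tadd t2 u2) (tadd t3 u3)
  end.

Fixpoint tscale (p : lpoly) (t : trie) : trie :=
  if t is Node r t0 t1 t2 t3
  then Node (lmul p r) (tscale p t0) (tscale p t1) (tscale p t2) (tscale p t3)
  else Emp.

Definition tcons (a : color) (t : trie) : trie :=
  match a with
  | c0 => Node [::] t Emp Emp Emp | c1 => Node [::] Emp t Emp Emp
  | c2 => Node [::] Emp Emp t Emp | c3 => Node [::] Emp Emp Emp t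
  end.

Definition tpre (w : word) (t : trie) : trie := foldr tcons t w.
Definition tnil : trie := Node lone Emp Emp Emp Emp.
Definition tword (w : word) : trie := tpre w tnil.

Definition tchild (a : color) (t : trie) : trie :=
  if t is Node _ t0 t1 t2 t3
  then match a with c0 => t0 | c1 => t1 | c2 => t2 | c3 => t3 end
  else Emp.

Definition tsub (w : word) (t : trie) : trie :=
  foldl (fun t a => tchild a t) t w.

Fixpoint tzero (t : trie) : bool :=
  if t is Node p t0 t1 t2 t3
  then [&& nilp p, tzero t0, tzero t1, tzero t2 & tzero t3] else true.

Definition lneg1 : lpoly := [:: (-1, (0, 0))]%bZ.
Definition teqb (t u : trie) : bool := tzero (tadd t (tscale lneg1 u)).

(* An entry (u, v, p) of a table replaces the prefix u by p times the prefix v;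
   an entry applies only to words of which u is a prefix. *)
Definition table := seq (word * word * lpoly).

Fixpoint tapply (T : table) (t : trie) : trie :=
  if T is (u, v, p) :: T'
  then tadd (tpre v (tscale p (tsub u t))) (tapply T' t) else Emp.

Fixpoint tapply_at (i : nat) (T : table) (t : trie) : trie :=
  if i is j.+1 then
    if t is Node _ t0 t1 t2 t3
    then Node [::] (tapply_at j T t0) (tapply_at j T t1)
                   (tapply_at j T t2) (tapply_at j T t3)
    else Emp
  else tapply T t.

Fixpoint strip (u w : word) : option word :=
  match u, w with
  | [::], _ => Some w
  | a :: u', b :: w' => if color_eqb a b then strip u' w' else None
  | _, _ => None
  end.

Lemma stripE u w : strip u (u ++ w) = Some w.
Proof. by elim: u => //= a u ->; case: a. Qed.

Lemma stripP u w x : strip u w = Some x -> w = u ++ x.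
Proof.
elim: u w => [|a u IH] [|b w] //= => [[]|[]|] //.
by case: color_eqbP => // -> /IH ->.
Qed.

Section TrieEval.
Variables (F : fieldType) (q s : F).
Hypotheses (q0 : q != 0) (s0 : s != 0).
Local Notation lv := (lval q s).
Local Notation functional := (word -> F).

(** A combination of words is known through its pairing with functionals on words, and each
    operation on tries is described by its transpose on functionals. Tries serve computation,
    functionals serve general arguments. *)
Fixpoint teval (t : trie) (g : functional) : F :=
  if t is Node p t0 t1 t2 t3 then
    lv p * g [::] + teval t0 (g \o cons c0) + teval t1 (g \o cons c1)
    + teval t2 (g \o cons c2) + teval t3 (g \o cons c3)
  else 0.

Lemma eq_teval t g h : g =1 h -> teval t g = teval t h.
Proof.
elim: t g h => //= p t0 I0 t1 I1 t2 I2 t3 I3 g h e.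
by rewrite e (I0 _ (h \o cons c0)) ?(I1 _ (h \o cons c1))
  ?(I2 _ (h \o cons c2)) ?(I3 _ (h \o cons c3)) // => w; rewrite /= e.
Qed.

Lemma teval_add t u g : teval (tadd t u) g = teval t g + teval u g.
Proof.
elim: t u g => [|p t0 I0 t1 I1 t2 I2 t3 I3] [|r u0 u1 u2 u3] g //=;
  rewrite ?add0r ?addr0 // lval_add I0 I1 I2 I3; ring.
Qed.

Lemma teval_scale p t g : teval (tscale p t) g = lv p * teval t g.
Proof.
elim: t g => [|r t0 I0 t1 I1 t2 I2 t3 I3] g /=; first by rewrite mulr0.
rewrite lval_mul // I0 I1 I2 I3; ring.
Qed.

Lemma teval_0 t : teval t (fun=> 0) = 0.
Proof.
elim: t => //= p t0 I0 t1 I1 t2 I2 t3 I3; rewrite mulr0 !(@eq_teval _ _ (fun=> 0)) //.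
by rewrite I0 I1 I2 I3 !addr0.
Qed.

Lemma teval_lin t (a : F) g h :
  teval t (fun w => a * g w + h w) = a * teval t g + teval t h.
Proof.
elim: t g h => [|p t0 I0 t1 I1 t2 I2 t3 I3] g h /=.
  by rewrite mulr0 addr0.
have e c : (fun w => a * g w + h w) \o cons c
   =1 (fun w => a * (g \o cons c) w + (h \o cons c) w) by [].
rewrite !(eq_teval _ (e _)) I0 I1 I2 I3; ring.
Qed.

Lemma teval_cons a t g : teval (tcons a t) g = teval t (g \o cons a).
Proof. by case: a; rewrite /= mul0r !(add0r, addr0). Qed.

Lemma teval_pre w t g : teval (tpre w t) g = teval t (fun x => g (w ++ x)).
Proof. by elim: w g => //= a w IH g; rewrite teval_cons IH; apply: eq_teval. Qed.

Lemma teval_word w g : teval (tword w) g = g w.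
Proof. by rewrite teval_pre; cbn [teval tnil]; rewrite !addr0 lval1 mul1r cats0. Qed.

Lemma teval_child a t g : teval (tchild a t) g =
  teval t (fun w => if w is b :: w' then if color_eqb a b then g w' else 0 else 0).
Proof.
case: t => //= p t0 t1 t2 t3; rewrite mulr0 add0r.
have z u b : b != a -> teval u ((fun w => if w is b :: w' then
    if color_eqb a b then g w' else 0 else 0) \o cons b) = 0.
  rewrite eq_sym => /negPf ab; rewrite -[RHS](teval_0 u).
  by apply: eq_teval => w; rewrite /= -[color_eqb _ _]/(a == b) ab.
case: a z => z.
- by rewrite (z _ c1) // (z _ c2) // (z _ c3) // !addr0; apply: eq_teval.
- by rewrite (z _ c0) // (z _ c2) // (z _ c3) // !addr0 add0r; apply: eq_teval.
- by rewrite (z _ c0) // (z _ c1) // (z _ c3) // !add0r addr0; apply: eq_teval.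
- by rewrite (z _ c0) // (z _ c1) // (z _ c2) // !add0r; apply: eq_teval.
Qed.

Lemma teval_sub u t g :
  teval (tsub u t) g = teval t (fun w => if strip u w is Some w' then g w' else 0).
Proof.
elim: u t g => //= a u IH t g; rewrite IH teval_child; apply: eq_teval => -[|b w] //=.
by case: color_eqb.
Qed.

Lemma teval_zero t g : tzero t -> teval t g = 0.
Proof.
elim: t g => //= p t0 I0 t1 I1 t2 I2 t3 I3 g /and5P[/nilP -> h0 h1 h2 h3].
by rewrite I0 // I1 // I2 // I3 // mul0r !addr0.
Qed.

Lemma teval_eqb t u g : teqb t u -> teval t g = teval u g.
Proof.
move/teval_zero => /(_ g); rewrite teval_add teval_scale => h.
apply/eqP; rewrite -subr_eq0 -h /= /tval /zval /= !expr0z; apply/eqP; ring.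
Qed.

Fixpoint sapply (T : table) (g : functional) (w : word) : F :=
  if T is (u, v, p) :: T' then
    (if strip u w is Some w' then lv p * g (v ++ w') else 0) + sapply T' g w
  else 0.

Fixpoint sapply_at (i : nat) (T : table) (g : functional) (w : word) : F :=
  if i is j.+1 then
    if w is a :: w' then sapply_at j T (g \o cons a) w' else 0
  else sapply T g w.

Lemma eq_sapply T g h : g =1 h -> sapply T g =1 sapply T h.
Proof.
move=> e w; elim: T => //= -[[u v] p] T ->.
by case: strip => // w'; rewrite e.
Qed.

Lemma eq_sapply_at i T g h : g =1 h -> sapply_at i T g =1 sapply_at i T h.
Proof.
elim: i g h => [|i IH] g h e w /=; first exact: eq_sapply.
by case: w => // a w; apply: IH => x; rewrite /= e.
Qed.

Lemma sapply_lin T (a : F) g h w :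
  sapply T (fun w => a * g w + h w) w = a * sapply T g w + sapply T h w.
Proof.
elim: T => [|[[u v] p] T IH] /=; first by rewrite mulr0 addr0.
rewrite IH; case: strip => [w'|]; ring.
Qed.

Lemma sapply_at_lin i T (a : F) g h w :
  sapply_at i T (fun w => a * g w + h w) w
  = a * sapply_at i T g w + sapply_at i T h w.
Proof.
elim: i g h w => [|i IH] g h w /=; first exact: sapply_lin.
by case: w => [|c w]; rewrite ?mulr0 ?addr0 // -IH; apply: eq_sapply_at.
Qed.

(** Adjunction: pushing a combination up through a table is the same as pulling the functional back
    down. *)
Lemma teval_apply T t g : teval (tapply T t) g = teval t (sapply T g).
Proof.
elim: T => [|[[u v] p] T IH] /=; first by rewrite teval_0.
rewrite teval_add teval_pre teval_scale teval_sub IH.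
rewrite -teval_lin; apply: eq_teval => w.
by case: strip => [w'|]; rewrite ?mulr0.
Qed.

Lemma teval_apply_at i T t g :
  teval (tapply_at i T t) g = teval t (sapply_at i T g).
Proof.
elim: i t g => [|i IH] [|p t0 t1 t2 t3] g //=; rewrite ?teval_apply //.
by rewrite mul0r mulr0 !IH.
Qed.

Lemma sapply_at_catl i T g w1 w2 :
  sapply_at (i + size w1) T g (w1 ++ w2)
  = sapply_at i T (fun w => g (w1 ++ w)) w2.
Proof.
elim: w1 g => [|a w1 IH] g /=; first by rewrite addn0.
by rewrite addnS /= IH; apply: eq_sapply_at.
Qed.

Definition tlen (T : table) : nat := \max_(x <- T) size x.1.1.

Lemma sapply_catr T g w1 w2 : (tlen T <= size w1)%N ->
  sapply T g (w1 ++ w2) = sapply T (fun w => g (w ++ w2)) w1.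
Proof.
rewrite /tlen; elim: T => //= -[[u v] p] T IH.
rewrite big_cons geq_max /= => /andP[hu /IH ->]; congr (_ + _).
elim: u w1 hu {IH} => [|a u IH] [|b w1] //=; try by rewrite -catA.
by case: color_eqb => // h; rewrite IH.
Qed.

Lemma sapply_at_catr i T g w1 w2 : (i + tlen T <= size w1)%N ->
  sapply_at i T g (w1 ++ w2) = sapply_at i T (fun w => g (w ++ w2)) w1.
Proof.
elim: i g w1 => [|i IH] g w1 /=; first exact: sapply_catr.
by case: w1 => //= a w1; rewrite addSn ltnS => h; rewrite IH.
Qed.

End TrieEval.

(** * The state sum *)

(* The operator sigma and its inverse; an entry (u, v, p) says that v has
   coefficient p in the image of u. *)
Definition cross_pos : table :=
  [::
     ([:: c0; c0], [:: c0; c0], [:: (1, (0, 2))]);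
     ([:: c0; c1], [:: c1; c0], [:: (1, (0, 1))]);
     ([:: c0; c2], [:: c2; c0], [:: (1, (0, 1))]);
     ([:: c0; c3], [:: c3; c0], [:: (1, (0, 0))]);
     ([:: c1; c0], [:: c0; c1], [:: (1, (0, 1))]);
     ([:: c1; c0], [:: c1; c0], [:: (-1, (0, 0)); (1, (0, 2))]);
     ([:: c1; c1], [:: c1; c1], [:: (-1, (0, 0))]);
     ([:: c1; c2], [:: c2; c1], [:: (-1, (-1, 0))]);
     ([:: c1; c2], [:: c3; c0], [:: (-1, (0, -1)); (1, (0, 1))]);
     ([:: c1; c3], [:: c3; c1], [:: (1, (-1, -1))]);
     ([:: c2; c0], [:: c0; c2], [:: (1, (0, 1))]);
     ([:: c2; c0], [:: c2; c0], [:: (-1, (0, 0)); (1, (0, 2))]);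
     ([:: c2; c1], [:: c1; c2], [:: (-1, (-1, 0))]);
     ([:: c2; c1], [:: c2; c1], [:: (1, (-2, 0)); (-1, (0, 0))]);
     ([:: c2; c1], [:: c3; c0], [:: (1, (-1, -1)); (-1, (-1, 1))]);
     ([:: c2; c2], [:: c2; c2], [:: (-1, (0, 0))]);
     ([:: c2; c3], [:: c3; c2], [:: (1, (-1, -1))]);
     ([:: c3; c0], [:: c0; c3], [:: (1, (0, 0))]);
     ([:: c3; c0], [:: c1; c2], [:: (-1, (-2, -1)); (1, (0, 1))]);
     ([:: c3; c0], [:: c2; c1], [:: (1, (-3, -1)); (-1, (-1, 1))]);
     ([:: c3; c0], [:: c3; c0], [:: (1, (-2, -2)); (-1, (-2, 0)); (-1, (0, 0)); (1, (0, 2))]);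
     ([:: c3; c1], [:: c1; c3], [:: (1, (-1, -1))]);
     ([:: c3; c1], [:: c3; c1], [:: (1, (-2, -2)); (-1, (0, 0))]);
     ([:: c3; c2], [:: c2; c3], [:: (1, (-1, -1))]);
     ([:: c3; c2], [:: c3; c2], [:: (1, (-2, -2)); (-1, (0, 0))]);
     ([:: c3; c3], [:: c3; c3], [:: (1, (-2, -2))])]%bZ.

Definition cross_neg : table :=
  [::
     ([:: c0; c0], [:: c0; c0], [:: (1, (0, -2))]);
     ([:: c0; c1], [:: c0; c1], [:: (1, (0, -2)); (-1, (0, 0))]);
     ([:: c0; c1], [:: c1; c0], [:: (1, (0, -1))]);
     ([:: c0; c2], [:: c0; c2], [:: (1, (0, -2)); (-1, (0, 0))]);
     ([:: c0; c2], [:: c2; c0], [:: (1, (0, -1))]);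
     ([:: c0; c3], [:: c0; c3], [:: (1, (0, -2)); (-1, (0, 0)); (-1, (2, 0)); (1, (2, 2))]);
     ([:: c0; c3], [:: c1; c2], [:: (1, (0, -1)); (-1, (2, 1))]);
     ([:: c0; c3], [:: c2; c1], [:: (-1, (-1, -1)); (1, (1, 1))]);
     ([:: c0; c3], [:: c3; c0], [:: (1, (0, 0))]);
     ([:: c1; c0], [:: c0; c1], [:: (1, (0, -1))]);
     ([:: c1; c1], [:: c1; c1], [:: (-1, (0, 0))]);
     ([:: c1; c2], [:: c0; c3], [:: (1, (2, -1)); (-1, (2, 1))]);
     ([:: c1; c2], [:: c1; c2], [:: (-1, (0, 0)); (1, (2, 0))]);
     ([:: c1; c2], [:: c2; c1], [:: (-1, (1, 0))]);
     ([:: c1; c3], [:: c1; c3], [:: (-1, (0, 0)); (1, (2, 2))]);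
     ([:: c1; c3], [:: c3; c1], [:: (1, (1, 1))]);
     ([:: c2; c0], [:: c0; c2], [:: (1, (0, -1))]);
     ([:: c2; c1], [:: c0; c3], [:: (-1, (1, -1)); (1, (1, 1))]);
     ([:: c2; c1], [:: c1; c2], [:: (-1, (1, 0))]);
     ([:: c2; c2], [:: c2; c2], [:: (-1, (0, 0))]);
     ([:: c2; c3], [:: c2; c3], [:: (-1, (0, 0)); (1, (2, 2))]);
     ([:: c2; c3], [:: c3; c2], [:: (1, (1, 1))]);
     ([:: c3; c0], [:: c0; c3], [:: (1, (0, 0))]);
     ([:: c3; c1], [:: c1; c3], [:: (1, (1, 1))]);
     ([:: c3; c2], [:: c2; c3], [:: (1, (1, 1))]);
     ([:: c3; c3], [:: c3; c3], [:: (1, (2, 2))])]%bZ.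

Definition mu_l (a : color) : lpoly :=
  match a with
  | c0 => [:: (1, (0, -2))] | c1 => [:: (-1, (0, -2))]
  | c2 => [:: (-1, (-2, -2))] | c3 => [:: (1, (-2, -2))] end%bZ.

Definition muV_l (a : color) : lpoly :=
  match a with
  | c0 => [:: (1, (0, 2))] | c1 => [:: (-1, (0, 2))]
  | c2 => [:: (-1, (2, 2))] | c3 => [:: (1, (2, 2))] end%bZ.

Definition retab (f : color -> color -> color -> color -> lpoly ->
    word * word * lpoly) (T : table) : table :=
  [seq match x with
       | ([:: a; b], [:: c; d], p) => f a b c d p
       | _ => x end | x <- T].

Definition cross_up (b : bool) : table := if b then cross_pos else cross_neg.

(* Crossings with downward strands are rotations of crossings of upward
   strands. *)
Definition cross_table (o1 o2 b : bool) : table :=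
  match o1, o2 with
  | true, true => cross_up b
  | false, true =>
      retab (fun a b c d p => ([:: c; a], [:: d; b], p)) (cross_up (~~ b))
  | true, false =>
      retab (fun a b c d p =>
        ([:: b; d], [:: a; c], lmul (lmul (mu_l d) (muV_l a)) p))
        (cross_up (~~ b))
  | false, false =>
      retab (fun a b c d p => ([:: d; c], [:: b; a], p)) (cross_up b)
  end.

(** With weight 1 on minima and [mu] on maxima whose left leg points upwards, closing a braid to its
    right gives the partial trace with [mu]. The zigzag moves then ask for weight 1 on the other
    maxima and the inverse of [mu] on the other minima; the factors in [cross_table] have the same
    origin. *)
Definition cup_table (o : bool) : table :=
  [seq ([::], [:: a; a], if o then lone else muV_l a) | a <- colors].
Definition cap_table (o : bool) : table :=
  [seq ([:: a; a], [::], if o then mu_l a else lone) | a <- colors].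

Definition event_table (st : seq bool) (e : event) : table :=
  match e, st with
  | Cup o, _ => cup_table o
  | Cap, o :: _ => cap_table o
  | Cross b, o1 :: o2 :: _ => cross_table o1 o2 b
  | _, _ => [::]
  end.

Fixpoint tev (st : seq bool) (D : diagram) (t : trie) : trie :=
  if D is x :: D' then
    if step st x is Some st' then
      tev st' D' (tapply_at x.1 (event_table (drop x.1 st) x.2) t)
    else Emp
  else t.

Definition sizes_ok (m n : nat) (T : table) : bool :=
  all (fun x => (size x.1.1 == m) && (size x.1.2 == n)) T.

Lemma event_table_ok st e : sizes_ok (legs_in e) (legs_out e) (event_table st e).
Proof. by case: e st => [[]||b] [|[] [|[] st]] //; case: b. Qed.

Lemma sizes_ok_tlen m n T : sizes_ok m n T -> (tlen T <= m)%N.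
Proof.
rewrite /tlen; elim: T => [|x T IH] /=; first by rewrite big_nil.
by rewrite big_cons geq_max => /andP[/andP[/eqP -> _] /IH ->]; rewrite leqnn.
Qed.

(** * Words of events placed beside further strands *)

Arguments step : simpl never.

Lemma run_cons st x D : run st (x :: D) = obind (run^~ D) (step st x).
Proof.
rewrite /run /=; case: step => //=; by elim: D.
Qed.

Lemma run_cat st A B : run st (A ++ B) = obind (run^~ B) (run st A).
Proof.
elim: A st => //= x A IH st; rewrite !run_cons.
by case: step => //= st'; rewrite IH.
Qed.

Lemma step_shift st1 st2 i e :
  step (st1 ++ st2) (i + size st1, e)%N = omap (cat st1) (step st2 (i, e)).
Proof.
have d : drop (i + size st1) (st1 ++ st2) = drop i st2.
  by rewrite -drop_drop drop_size_cat.
have t : take (i + size st1) (st1 ++ st2) = st1 ++ take i st2.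
  rewrite take_cat ltnNge leq_addl /= addnK //.
rewrite /step d t; case: e => [o||b].
- by rewrite size_cat addnC leq_add2l; case: ifP => //= _; rewrite catA.
- by case: drop => [|a [|b l]] //; case: ifP => //= _; rewrite catA.
- by case: drop => [|a [|c l]] //=; rewrite catA.
Qed.

Lemma run_shift st1 st2 D :
  run (st1 ++ st2) (shift (size st1) D) = omap (cat st1) (run st2 D).
Proof.
elim: D st2 => //= -[i e] D IH st2; rewrite !run_cons step_shift.
by case: step => //= st'; rewrite IH.
Qed.

Lemma step_size st i e st' : step st (i, e) = Some st' ->
  (i + legs_in e <= size st)%N /\ (size st' + legs_in e = size st + legs_out e)%N.
Proof.
rewrite /step; case: e => [o||b].
- case: ifP => // h [<-]; rewrite !size_cat /= size_take size_drop.
  by case: ltnP; lia.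
- have := size_drop i st; case: drop => [|a [|b l]] //= h.
  case: ifP => // _ [<-]; rewrite size_cat size_take; case: ltnP; lia.
- have := size_drop i st; case: drop => [|a [|c l]] //= h.
  case=> <-; rewrite size_cat size_take /=; case: ltnP; lia.
Qed.

Lemma step_catr st1 st2 x st' :
  step st1 x = Some st' -> step (st1 ++ st2) x = Some (st' ++ st2).
Proof.
case: x => i e h; have [le _] := step_size h; move: h; rewrite /step.
have le' : (i <= size st1)%N by lia.
have -> : take i (st1 ++ st2) = take i st1.
  by rewrite take_cat ltn_neqAle le' andbT; case: eqP => //= ->; rewrite subnn take0 take_size cats0.
have -> : drop i (st1 ++ st2) = drop i st1 ++ st2.
  by rewrite drop_cat ltn_neqAle le' andbT; case: eqP => //= ->; rewrite subnn drop0 drop_size.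
case: e le => [o||b] le.
- rewrite size_cat (leq_trans le' (leq_addr _ _)) le' => -[<-].
  by rewrite -!catA.
- by case: drop => [|a [|b l]] //=; case: ifP => // _ [<-]; rewrite -catA.
- by case: drop => [|a [|c l]] //= -[<-]; rewrite -catA.
Qed.

Lemma run_catr st1 st2 D st' :
  run st1 D = Some st' -> run (st1 ++ st2) D = Some (st' ++ st2).
Proof.
elim: D st1 => [|x D IH] st1 /=; first by case=> ->.
rewrite !run_cons; case e: step => //= h.
by rewrite (step_catr _ e) /= (IH _ h).
Qed.

Section StateSum.
Variables (F : fieldType) (q s : F).
Hypotheses (q0 : q != 0) (s0 : s != 0).
Local Notation functional := (word -> F).

(** The transpose of [tev]: a functional on the top row is pulled back to the bottom row. A word
    that cannot be run gives 0, so linearity in [g] holds for every diagram. *)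
Fixpoint ev (st : seq bool) (D : diagram) (g : functional) (w : word) : F :=
  if D is x :: D' then
    if step st x is Some st' then
      sapply_at q s x.1 (event_table (drop x.1 st) x.2) (ev st' D' g) w
    else 0
  else g w.

Lemma teval_tev st D t g :
  teval q s (tev st D t) g = teval q s t (ev st D g).
Proof.
elim: D st t => //= x D IH st t; case: step => [st'|].
  by rewrite IH teval_apply_at.
by rewrite teval_0.
Qed.

Lemma eq_sapply_at_size i m n T g h k w : sizes_ok m n T ->
  (i + m <= size w)%N -> (k + m = size w + n)%N ->
  (forall x, size x = k -> g x = h x) ->
  sapply_at q s i T g w = sapply_at q s i T h w.
Proof.
elim: i k g h w => [|i IH] k g h w ok le ek e /=.
  elim: T ok => //= -[[u v] p] T IHT /andP[/andP[/= /eqP su /eqP sv] /IHT ->].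
  congr (_ + _); case E: strip => [w'|] //; rewrite e //.
  by move: ek; rewrite (stripP E) !size_cat; lia.
case: w le ek => // a w le ek; apply: (IH k.-1) => //; try by move: le ek => /=; lia.
by move=> x sx; apply: e => /=; move: le ek => /=; lia.
Qed.

Lemma sapply_at_0 i T g w : (forall x, g x = 0) -> sapply_at q s i T g w = 0.
Proof.
elim: i g w => [|i IH] g w z /=; last first.
  by case: w => // a w; apply: IH => x; apply: z.
elim: T => //= -[[u v] p] T ->.
by case: strip => *; rewrite ?z ?mulr0 ?addr0.
Qed.

Lemma eq_ev st D st' g h : run st D = Some st' ->
  (forall x, size x = size st' -> g x = h x) ->
  forall w, size w = size st -> ev st D g w = ev st D h w.
Proof.
elim: D st => [|[i e] D IH] st /=; first by case=> -> E w sw; apply: E.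
rewrite run_cons; case E: step => [st1|] //= r gh w sw.
have [h1 h2] := step_size E.
apply: (eq_sapply_at_size (k := size st1) (event_table_ok _ _)); try lia.
exact: IH.
Qed.

Lemma ev_lin st D (a : F) g h w :
  ev st D (fun w => a * g w + h w) w = a * ev st D g w + ev st D h w.
Proof.
elim: D st w => //= x D IH st w; case: step => [st'|]; last by rewrite mulr0 addr0.
by rewrite -sapply_at_lin; apply: eq_sapply_at.
Qed.

Lemma ev_cat st A B st' g w : run st A = Some st' ->
  ev st (A ++ B) g w = ev st A (ev st' B g) w.
Proof.
elim: A st w => [|x A IH] st w /=; first by case=> ->.
rewrite run_cons; case: step => //= st1 r.
by apply: eq_sapply_at => x'; apply: IH.
Qed.

Lemma ev_catl st1 st2 D g w1 w2 : size w1 = size st1 ->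
  ev (st1 ++ st2) (shift (size st1) D) g (w1 ++ w2)
  = ev st2 D (fun w => g (w1 ++ w)) w2.
Proof.
move=> sw; elim: D st2 w2 => //= -[i e] D IH st2 w2.
rewrite step_shift /=; case: step => //= st'.
rewrite -drop_drop drop_size_cat // -sw sapply_at_catl.
by apply: eq_sapply_at => w; rewrite sw; apply: IH.
Qed.

Lemma ev_catr st1 st2 D st' g w1 w2 : size w1 = size st1 ->
  run st1 D = Some st' ->
  ev (st1 ++ st2) D g (w1 ++ w2) = ev st1 D (fun w => g (w ++ w2)) w1.
Proof.
elim: D st1 w1 => //= -[i e] D IH st1 w1 sw.
rewrite run_cons; case E: step => [st3|] //= r; rewrite (step_catr _ E).
have [h1 h2] := step_size E.
have -> : event_table (drop i (st1 ++ st2)) e = event_table (drop i st1) e.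
  have le' : (i <= size st1)%N by lia.
  have -> : drop i (st1 ++ st2) = drop i st1 ++ st2.
    by rewrite drop_cat ltn_neqAle le' andbT; case: eqP => //= ->; rewrite subnn drop0 drop_size.
  case: e h1 {E h2} => [o||b] //= h1; have := size_drop i st1;
    by case: drop => [|a [|c l]] //= h; exfalso; lia.
have ok := event_table_ok (drop i st1) e.
rewrite sapply_at_catr; last by have := sizes_ok_tlen ok; lia.
apply: (eq_sapply_at_size ok (k := size st3)); try lia.
by move=> x sx; apply: IH.
Qed.

Definition sim (st : seq bool) (D D' : diagram) : Prop :=
  run st D = run st D' /\
  forall g w, size w = size st -> ev st D g w = ev st D' g w.

Lemma sim_ctx st A B D D' st' : run st A = Some st' ->
  sim st' D D' -> sim st (A ++ D ++ B) (A ++ D' ++ B).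
Proof.
move=> rA [rD eD]; split; first by rewrite !run_cat rA /= !run_cat rD.
move=> g w sw; rewrite !(ev_cat _ _ _ rA); apply: (eq_ev rA) => // x sx.
case rD1: (run st' D) => [st2|].
  by rewrite (ev_cat _ _ _ rD1) (@ev_cat _ D' _ st2) ?eD // -rD.
(* If one of [D], [D'] cannot be run, neither can the other, and both state sums take the default
   value 0. *)
have z C : run st' C = None -> forall g x, ev st' (C ++ B) g x = 0.
  move=> rC g' x' {w sw sx x eD rD rD1 rA}.
  elim: C st' x' rC => //= y C IH st' x; rewrite run_cons.
  by case: step => //= st3 /IH h; apply: sapply_at_0.
by rewrite !z // -rD.
Qed.

(** Strands to the left and right are spectators, so a move has to be checked only on the few
    strands that take part in it. *)
Lemma sim_local st1 st2 st3 D D' st' : run st2 D = Some st' ->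
  sim st2 D D' ->
  sim (st1 ++ st2 ++ st3) (shift (size st1) D) (shift (size st1) D').
Proof.
move=> r [r' e]; split; first by rewrite !run_shift !(run_catr _ (st' := st')) // -r'.
move=> g w sw.
pose w1 := take (size st1) w; pose w2 := take (size st2) (drop (size st1) w).
pose w3 := drop (size st2) (drop (size st1) w).
have -> : w = w1 ++ w2 ++ w3 by rewrite !cat_take_drop.
have s1 : size w1 = size st1 by rewrite size_takel // sw size_cat leq_addr.
have s2 : size w2 = size st2.
  by rewrite size_takel // size_drop sw !size_cat addKn leq_addr.
rewrite !ev_catl // (ev_catr _ _ _ s2 r) (@ev_catr _ _ D' st') ?e //.
by rewrite -r'.
Qed.

End StateSum.

Fixpoint words (n : nat) : seq word :=
  if n is m.+1 then [seq a :: w | a <- colors, w <- words m] else [:: [::]].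

Lemma mem_words w : w \in words (size w).
Proof.
elim: w => // a w IH; rewrite [size _]/= /words -/words.
by cbn [words size]; apply: allpairs_f => //; case: a.
Qed.

Definition sim_check (st : seq bool) (D D' : diagram) : bool :=
  all (fun w => teqb (tev st D (tword w)) (tev st D' (tword w)))
    (words (size st)).

Lemma sim_checkP (F : fieldType) (q s : F) st D D' : q != 0 -> s != 0 ->
  run st D = run st D' -> sim_check st D D' -> sim q s st D D'.
Proof.
move=> q0 s0 r h; split=> // g w sw.
rewrite -(teval_word q s w (ev _ _ st D _)) -(teval_word q s w (ev _ _ st D' _)).
rewrite -!teval_tev //; apply: teval_eqb => //.
by have /allP := h; apply; rewrite -sw mem_words.
Qed.

(** * Invariance under moves *)

(** The constructors of [move] at the left end, apart from distant events. Each involves a bounded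
    number of strands, hence finitely many orientations and basis words, and is settled by
    computation; distant events have an arbitrary gap and are treated by [distant_sim]. *)
Inductive local_move0 : diagram -> diagram -> Prop :=
| lm_zl o : local_move0 [:: (1, Cup o); (0, Cap)]%N [::]
| lm_zr o : local_move0 [:: (0, Cup o); (1, Cap)]%N [::]
| lm_scap b :
    local_move0 [:: (1, Cross b); (0, Cap)]%N [:: (0, Cross (~~ b)); (1, Cap)]%N
| lm_scup o b :
    local_move0 [:: (0, Cup o); (1, Cross b)]%N [:: (1, Cup o); (0, Cross (~~ b))]%N
| lm_r1cap b : local_move0 [:: (0, Cross b); (0, Cap)]%N [:: (0, Cap)]%N
| lm_r1cup o b : local_move0 [:: (0, Cup o); (0, Cross b)]%N [:: (0, Cup (~~ o))]%N
| lm_r2 b : local_move0 [:: (0, Cross b); (0, Cross (~~ b))]%N [::]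
| lm_r3 b : local_move0 [:: (0, Cross b); (1, Cross b); (0, Cross b)]%N
                        [:: (1, Cross b); (0, Cross b); (1, Cross b)]%N.

(** Dismisses the orientations for which one side of a move cannot be run. *)
Ltac bad := let r := fresh in let r' := fresh in
  by move=> r r'; first
  [ by case: r; rewrite /run /step /= ?take0
  | by case: r'; rewrite /run /step /= ?take0 ].

Lemma local_move0_check D D' (s : seq bool) : local_move0 D D' ->
  run s D <> None -> run s D' <> None ->
  exists st st' m, [/\ s = st ++ st', run st D = Some m, run st D' = Some m
    & sim_check st D D'].
Proof.
have ex st st' E E' : run st E = run st E' -> run st E <> None ->
    sim_check st E E' ->
    exists st0 st'0 m, [/\ st ++ st' = st0 ++ st'0, run st0 E = Some m,
      run st0 E' = Some m & sim_check st0 E E'].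
  by case e: (run st E) => [m|] // e' _ h; exists st, st', m; split.
case=> [o|o|b|o b|b|o b|b|b].
- case: s => [|a s]; try bad; case: o a => -[];
    first [bad | by move=> _ _; apply: (ex [:: _]); vm_compute].
- case: s => [|a s]; try bad; case: o a => -[];
    first [bad | by move=> _ _; apply: (ex [:: _]); vm_compute].
- case: s => [|a [|a' [|a'' s]]]; try bad; case: b a a' a'' => -[] [] [];
    first [bad | by move=> _ _; apply: (ex [:: _; _; _]); vm_compute].
- case: s => [|a s]; try bad; case: o b a => -[] [];
    first [bad | by move=> _ _; apply: (ex [:: _]); vm_compute].
- case: s => [|a [|a' s]]; try bad; case: b a a' => -[] [];
    first [bad | by move=> _ _; apply: (ex [:: _; _]); vm_compute].
- case: o b => -[];
    first [bad | by move=> _ _; apply: (ex [::]); vm_compute].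
- case: s => [|a [|a' s]]; try bad; case: b a a' => -[] [];
    first [bad | by move=> _ _; apply: (ex [:: _; _]); vm_compute].
- case: s => [|a [|a' [|a'' s]]]; try bad; case: b a a' a'' => -[] [] [];
    first [bad | by move=> _ _; apply: (ex [:: _; _; _]); vm_compute].
Qed.

Lemma step0_split s e s' : step s (0%N, e) = Some s' ->
  exists s1 s2 s1', [/\ s = s1 ++ s2, size s1 = legs_in e, size s1' = legs_out e,
    s' = s1' ++ s2 & step s1 (0%N, e) = Some s1'].
Proof.
rewrite /step drop0 take0; case: e => [o||b] /=.
- by case=> <-; exists [::], s, [:: o; ~~ o].
- case: s => [|a [|b s]] //; case: ifP => // ab [<-].
  by exists [:: a; b], s, [::]; rewrite /= ab.
- case: s => [|a [|c s]] // [<-].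
  by exists [:: a; c], s, [:: c; a].
Qed.

Section MoveSim.
Variables (F : fieldType) (q s : F).
Hypotheses (q0 : q != 0) (s0 : s != 0).
Local Notation sim := (sim q s).
Local Notation ev := (ev q s).

(** A table on the first [m] letters replaces them by [n] letters, so a table further to the right
    acts at [k + n] after it and at [k + m] before it. This is the algebraic form of the exchange of
    distant events. *)
Lemma sapply_comm T T' k m n g w1 w2 : sizes_ok m n T -> size w1 = m ->
  sapply q s T (sapply_at q s (k + n) T' g) (w1 ++ w2)
  = sapply_at q s (k + m) T' (sapply q s T g) (w1 ++ w2).
Proof.
move=> ok sw; rewrite -sw sapply_at_catl.
elim: T ok => [|[[u v] p] T IH] /=; first by rewrite sapply_at_0.
case/andP=> /andP[/eqP /= su /eqP sv] /IH ->.
set G := fun w => sapply q s T g (w1 ++ w).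
case E: (strip u w1) => [x|].
  have ux := stripP E; have x0 : x = [::].
    by apply: size0nil; move: sw; rewrite ux size_cat su; lia.
  move: ux; rewrite x0 cats0 => ux; subst w1.
  rewrite stripE -sv sapply_at_catl -sapply_at_lin.
  by apply: eq_sapply_at => y; rewrite stripE.
have z y : strip u (w1 ++ y) = None.
  move: sw; rewrite -su; elim: u w1 E {su IH G} => [|a u IHu] [|b w] //=.
  by case: color_eqb => // h [e]; apply: IHu.
by rewrite z add0r; apply: eq_sapply_at => y; rewrite z add0r.
Qed.

Lemma distant_sim st k e e' x y :
  run st [:: (0, e); (legs_out e + k, e')]%N = Some x ->
  run st [:: (legs_in e + k, e'); (0, e)]%N = Some y ->
  sim st [:: (0, e); (legs_out e + k, e')]%N [:: (legs_in e + k, e'); (0, e)]%N.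
Proof.
rewrite !run_cons; case E: step => [st1|] //=.
have [s1 [s2 [s1' [es z1 z1' es' r1]]]] := step0_split E.
subst st st1; rewrite -z1' addnC run_cons step_shift.
case E2: step => [s2'|] //= [ex]; rewrite -z1 addnC step_shift E2 /=.
rewrite run_cons (step_catr _ r1) /= => -[ey].
have ra : run (s1 ++ s2) [:: (0, e); (k + size s1', e')]%N = Some x.
  by rewrite run_cons E /= run_cons step_shift E2 /= -ex.
have rb : run (s1 ++ s2) [:: (k + size s1, e'); (0, e)]%N = Some y.
  by rewrite run_cons step_shift E2 /= run_cons (step_catr _ r1) /= -ey.
split; first by rewrite ra rb -ex -ey.
move=> g w sw; rewrite /= E !step_shift E2 /= (step_catr _ r1).
have -> : drop (k + size s1') (s1' ++ s2) = drop (k + size s1) (s1 ++ s2).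
  by rewrite -!drop_drop !drop_size_cat.
have -> : event_table (drop 0 (s1 ++ s2')) e = event_table (drop 0 (s1 ++ s2)) e.
  rewrite !drop0; case: (e) z1 => [o||b] //=; case: (s1) => [|a [|b' [|]]] //.
rewrite -(cat_take_drop (size s1) w) z1 z1'; apply: sapply_comm.
  exact: event_table_ok.
by rewrite size_takel // sw size_cat -z1 leq_addr.
Qed.

Lemma sim_shift i st D D' : (i <= size st)%N -> sim (drop i st) D D' ->
  sim st (shift i D) (shift i D').
Proof.
move=> le; have z : size (take i st) = i by rewrite size_takel.
rewrite -{2}(cat_take_drop i st); move: (take i st) (drop i st) z => st1 st2 <- [r e].
split=> [|g w sw]; first by rewrite !run_shift r.
have sw' : size (take (size st1) w) = size st1.
  by rewrite size_takel // sw size_cat leq_addr.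
rewrite -(cat_take_drop (size st1) w) !ev_catl // e //.
by rewrite size_drop sw size_cat addKn.
Qed.

Lemma run_shift_le i x D st : run st (shift i (x :: D)) <> None -> (i <= size st)%N.
Proof.
case: x => j e; rewrite run_cons; case E: step => [st'|] // _.
by have [] := step_size E; lia.
Qed.

Lemma local_move0_sim D D' i st : local_move0 D D' ->
  run st (shift i D) <> None -> run st (shift i D') <> None ->
  sim st (shift i D) (shift i D').
Proof.
move=> h r r'; have le : (i <= size st)%N.
  by case: h r => *; apply: run_shift_le; eassumption.
apply: sim_shift => //.
have z : size (take i st) = i by rewrite size_takel.
have sr E : run st (shift i E) = omap (cat (take i st)) (run (drop i st) E).
  by rewrite -{1}(cat_take_drop i st) -{3}z run_shift.
have [|| st1 [st2 [m [e rm rm' c]]]] := @local_move0_check D D' (drop i st) h.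
- by move=> n; apply: r; rewrite sr n.
- by move=> n; apply: r'; rewrite sr n.
have sh E : shift 0 E = E by elim: E => //= -[j a] E ->; rewrite addn0.
have := sim_local q0 s0 [::] st2 rm (sim_checkP q0 s0 _ c); rewrite e /= !sh.
by apply; rewrite rm rm'.
Qed.

Lemma move_sim D D' st : move D D' ->
  run st D <> None -> run st D' <> None -> sim st D D'.
Proof.
case=> [i k e e'|i o|i o|i b|i o b|i b|i o b|i b|i b].
- have -> : [:: (i, e); (i + legs_out e + k, e')]%N
      = shift i [:: (0, e); (legs_out e + k, e')]%N.
    by congr [:: (_, _); (_, _)] => /=; lia.
  have -> : [:: (i + legs_in e + k, e'); (i, e)]%N
      = shift i [:: (legs_in e + k, e'); (0, e)]%N.
    by congr [:: (_, _); (_, _)] => /=; lia.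
  move=> r r'; have le := run_shift_le r; apply: sim_shift => //.
  have sr E : run st (shift i E) = omap (cat (take i st)) (run (drop i st) E).
    by rewrite -{1}(cat_take_drop i st) -{3}(size_takel le) run_shift.
  move: r r'; rewrite !sr.
  case R: (run _ _) => [x|] //= _; case R': (run _ _) => [y|] //= _.
  exact: distant_sim R R'.
- exact: (local_move0_sim (i := i) (lm_zl o)).
- exact: (local_move0_sim (i := i) (lm_zr o)).
- exact: (local_move0_sim (i := i) (lm_scap b)).
- exact: (local_move0_sim (i := i) (lm_scup o b)).
- exact: (local_move0_sim (i := i) (lm_r1cap b)).
- exact: (local_move0_sim (i := i) (lm_r1cup o b)).
- exact: (local_move0_sim (i := i) (lm_r2 b)).
- exact: (local_move0_sim (i := i) (lm_r3 b)).
Qed.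

End MoveSim.

(** * Equivariance *)

(* [Gen i e] is E_(i+1) if e and F_(i+1) otherwise; E_2 is multiplied by
   q - q^-1 to make its matrix entries Laurent polynomials. *)
Inductive gen := Gen of bool & bool.

Definition cparity (a : color) : bool :=
  match a with c1 | c2 => true | _ => false end.

Definition lsign (b : bool) : lpoly := if b then lneg1 else lone.

Definition kweight (i : bool) (a : color) : lpoly :=
  match i, a with
  | false, c1 => [:: (1, (1, 0))] | false, c2 => [:: (1, (-1, 0))]
  | false, _ => lone
  | true, (c0 | c1) => [:: (1, (0, 1))] | true, _ => [:: (1, (1, 1))]
  end%bZ.

Definition kweightV (i : bool) (a : color) : lpoly :=
  [seq (t.1, (Z.opp t.2.1, Z.opp t.2.2)) | t <- kweight i a].

Definition gen_entries (X : gen) : seq (color * color * lpoly) :=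
  match X with
  | Gen false true => [:: (c2, c1, lone)]
  | Gen true true => [:: (c1, c0, [:: (-1, (0, -1)); (1, (0, 1))]);
                         (c3, c2, [:: (-1, (-1, -1)); (1, (1, 1))])]
  | Gen false false => [:: (c1, c2, lone)]
  | Gen true false => [:: (c0, c1, lone); (c2, c3, lone)]
  end%bZ.

(* On downward strands the dual action, for which a cup with left leg upwards
   is invariant. *)
Definition gen_table (X : gen) (o : bool) : seq (color * color * lpoly) :=
  if o then gen_entries X else
  let: Gen i e := X in
  [seq let: (a, b, p) := x in
       (b, a, lmul (lsign (~~ (i && cparity b)))
                (lmul (if e then kweightV i a else kweight i b) p))
  | x <- gen_entries X].

(** The iterated coproduct is a sum over the strand on which the generator acts. For E the strands
    to its right carry K, for F those to its left carry K^-1, and an odd generator takes a sign from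
    each odd colour to its left. On a downward strand K acts by its inverse. *)
Definition gen_left (X : gen) (o : bool) (a : color) : lpoly :=
  let: Gen i e := X in
  lmul (lsign (i && cparity a))
    (if e then lone else if o then kweightV i a else kweight i a).

Definition gen_right (X : gen) (o : bool) (a : color) : lpoly :=
  let: Gen i e := X in
  if e then if o then kweight i a else kweightV i a else lone.

Fixpoint lprod (f : bool -> color -> lpoly) (st : seq bool) (w : word) : lpoly :=
  match st, w with
  | o :: st', a :: w' => lmul (f o a) (lprod f st' w')
  | _, _ => lone
  end.

Definition letter_table (X : gen) (o : bool) : table :=
  [seq ([:: x.1.1], [:: x.1.2], x.2) | x <- gen_table X o].

Fixpoint wgen (X : gen) (st : seq bool) (w : word) : trie :=
  match st, w with
  | o :: st', a :: w' =>
      tadd (tscale (lprod (gen_right X) st' w')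
              (tapply (letter_table X o) (tword w)))
           (tscale (gen_left X o a) (tcons a (wgen X st' w')))
  | _, _ => Emp
  end.

Definition tsum (ts : seq trie) : trie := foldr tadd Emp ts.

(** The first part says that every entry preserves the products of weights which the coproduct puts
    on the strands beside an active one; the second is equivariance on the strands of the table.
    Together they give equivariance at any place in a longer row. *)
Definition equiv_check (X : gen) (st st' : seq bool) (T : table) : bool :=
    all (fun x => let: (u, v, _) := x in
      leqb (lprod (gen_right X) st u) (lprod (gen_right X) st' v)
      && leqb (lprod (gen_left X) st u) (lprod (gen_left X) st' v)) T
    && all (fun u =>
      teqb (tapply T (wgen X st u))
        (tsum [seq (let: (u', v, p) := x in
                    if u' == u then tscale p (wgen X st' v) else Emp)
              | x <- T])) (words (size st)).

Definition event_check (X : gen) (st : seq bool) (e : event) : bool :=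
  if step st (0%N, e) is Some st' then equiv_check X st st' (event_table st e)
  else true.

Lemma event_checkP X st e : size st = legs_in e -> event_check X st e.
Proof.
case: e => [o||b]; case: st => [|a [|a' [|a'' st]]] // _; case: X => -[] [].
1-4: by case: o; vm_compute.
1-4: by case: a a' => -[]; vm_compute.
all: by case: a a' b => -[] []; vm_compute.
Qed.

Section Equivariance.
Variables (F : fieldType) (q s : F).
Hypotheses (q0 : q != 0) (s0 : s != 0).
Local Notation lv := (lval q s).
Local Notation functional := (word -> F).

Fixpoint dgen (X : gen) (st : seq bool) (g : functional) (w : word) : F :=
  match st, w with
  | o :: st', a :: w' =>
      lv (lprod (gen_right X) st' w') * sapply q s (letter_table X o) g w
      + lv (gen_left X o a) * dgen X st' (g \o cons a) w'
  | _, _ => 0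
  end.

Lemma teval_wgen X st w g : teval q s (wgen X st w) g = dgen X st g w.
Proof.
elim: st w g => [|o st IH] [|a w] g //.
cbn [wgen dgen]; rewrite teval_add !teval_scale // teval_apply // teval_word.
by rewrite teval_cons IH.
Qed.

Lemma eq_dgen X st g h : g =1 h -> dgen X st g =1 dgen X st h.
Proof.
elim: st g h => [|o st IH] g h e [|a w] //=.
by rewrite (eq_sapply _ _ _ e) (IH _ (h \o cons a)) // => x; rewrite /= e.
Qed.

Lemma dgen_lin X st (a : F) g h w :
  dgen X st (fun w => a * g w + h w) w = a * dgen X st g w + dgen X st h w.
Proof.
elim: st g h w => [|o st IH] g h [|c w] /=; rewrite ?mulr0 ?addr0 //.
rewrite sapply_lin (@eq_dgen _ _ _
  (fun w => a * (g \o cons c) w + (h \o cons c) w)) // IH; ring.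
Qed.

Lemma letter_table_ok X o : sizes_ok 1 1 (letter_table X o).
Proof. by rewrite /letter_table; elim: gen_table. Qed.

Lemma eq_dgen_size X st g h w : (forall x, size x = size w -> g x = h x) ->
  dgen X st g w = dgen X st h w.
Proof.
elim: st g h w => [|o st IH] g h [|a w] e //=.
rewrite (IH _ (h \o cons a)); last by move=> x ex; rewrite /= e //= ex.
congr (_ * _ + _); elim: letter_table (letter_table_ok X o) => //= -[[u v] p] T IHT.
case/andP=> /andP[/eqP /= su /eqP sv] /IHT ->.
case E: strip => [x|] //; rewrite e // size_cat sv.
by have /(congr1 size) := stripP E; rewrite size_cat su.
Qed.

Lemma dgen_0 X st w : dgen X st (fun=> 0) w = 0.
Proof.
elim: st w => [|o st IH] [|a w] //=.
rewrite (@eq_dgen _ _ _ (fun=> 0)) // IH mulr0 addr0.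
rewrite -[RHS](mulr0 (lv (lprod (gen_right X) st w))); congr (_ * _).
by elim: letter_table => //= -[[u v] p] T ->; case: strip => *; rewrite ?mulr0 addr0.
Qed.

Lemma lprod_cat f st1 st2 w1 w2 : size w1 = size st1 ->
  lv (lprod f (st1 ++ st2) (w1 ++ w2)) = lv (lprod f st1 w1) * lv (lprod f st2 w2).
Proof.
elim: st1 w1 => [|o st IH] [|a w] // => [_|[e]]; cbn [lprod cat].
  by rewrite lval1 mul1r.
by rewrite !lval_mul // IH // mulrA.
Qed.

Lemma dgen_cat X st1 st2 g w1 w2 : size w1 = size st1 ->
  dgen X (st1 ++ st2) g (w1 ++ w2)
  = lv (lprod (gen_right X) st2 w2) * dgen X st1 (fun w => g (w ++ w2)) w1
    + lv (lprod (gen_left X) st1 w1) * dgen X st2 (fun w => g (w1 ++ w)) w2.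
Proof.
elim: st1 w1 g => [|o st IH] [|a w] g // => [_|[e]].
  by cbn [lprod dgen cat]; rewrite lval1 mulr0 add0r mul1r.
cbn [lprod dgen cat]; rewrite lprod_cat // IH // lval_mul //.
have -> : sapply q s (letter_table X o) g (a :: w ++ w2) =
    sapply q s (letter_table X o) (fun w => g (w ++ w2)) (a :: w).
  rewrite -cat_cons sapply_catr // (leq_trans (sizes_ok_tlen (m := 1) (n := 1) _)) //.
  exact: letter_table_ok.
set A := sapply _ _ _ _ _; set B := dgen _ _ _ _; set C := dgen _ _ _ _; ring.
Qed.

Lemma tsum_eval ts g : teval q s (tsum ts) g = \sum_(t <- ts) teval q s t g.
Proof.
elim: ts => [|t ts IH]; first by rewrite big_nil.
by rewrite big_cons /= teval_add IH.
Qed.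

Lemma equiv_local X st st' T g u : equiv_check X st st' T ->
  size u = size st ->
  dgen X st (sapply q s T g) u =
  \sum_(x <- T | x.1.1 == u) lv x.2 * dgen X st' g x.1.2.
Proof.
move=> /andP[_ /allP h] su.
rewrite -teval_wgen // -teval_apply // (teval_eqb q0 s0 _ (h u _)); last first.
  by rewrite -su mem_words.
rewrite tsum_eval big_map [RHS]big_mkcond; apply: eq_bigr => -[[u' v] p] _ /=.
by case: eqP; rewrite //= teval_scale // teval_wgen.
Qed.

Lemma equiv_weight X st st' T x : equiv_check X st st' T -> x \in T ->
  lv (lprod (gen_right X) st x.1.1) = lv (lprod (gen_right X) st' x.1.2) /\
  lv (lprod (gen_left X) st x.1.1) = lv (lprod (gen_left X) st' x.1.2).
Proof.
move=> /andP[/allP h _] /h; case: x => [[u v] p] /andP[r l].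
by split; apply: lval_eqb.
Qed.

Lemma strip_same u w1 w2 : size w1 = size u ->
  strip u (w1 ++ w2) = if u == w1 then Some w2 else None.
Proof.
elim: u w1 => [|a u IH] [|b w1] //= [e].
by rewrite IH // eqseq_cons -[color_eqb a b]/(a == b); case: eqP.
Qed.

Lemma sapply_same m n T g w1 w2 : sizes_ok m n T -> size w1 = m ->
  sapply q s T g (w1 ++ w2) = \sum_(x <- T | x.1.1 == w1) lv x.2 * g (x.1.2 ++ w2).
Proof.
move=> ok sw; elim: T ok => [|[[u v] p] T IH] /=; first by rewrite big_nil.
case/andP=> /andP[/eqP /= su _] /IH ->; rewrite big_cons /= strip_same ?sw ?su //.
by case: eqP; rewrite ?add0r.
Qed.

Lemma dgen_sum X st w (I : Type) (r : seq I) (P : pred I) (f : I -> F) g :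
  dgen X st (fun x => \sum_(i <- r | P i) f i * g i x) w
  = \sum_(i <- r | P i) f i * dgen X st (g i) w.
Proof.
elim: r => [|i r IH].
  by rewrite big_nil -[RHS](dgen_0 X st w); apply: eq_dgen => x; rewrite big_nil.
rewrite big_cons; case: ifP => Pi.
  rewrite -IH -dgen_lin; apply: eq_dgen => x; rewrite big_cons Pi //.
by rewrite -IH; apply: eq_dgen => x; rewrite big_cons Pi.
Qed.

(** Multiplication by a product of letter weights is diagonal, and the entries of the table preserve
    these products, so it commutes with the table. *)
Lemma sapply_at_weight m n i T f st st1 st1' st2 h w : sizes_ok m n T ->
  size st1 = m -> size st1' = n -> st = st1 ++ st2 ->
  (forall x, x \in T -> lv (lprod f st1 x.1.1) = lv (lprod f st1' x.1.2)) ->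
  forall st0, size st0 = i -> size w = size (st0 ++ st) ->
  sapply_at q s i T (fun x => lv (lprod f (st0 ++ st1' ++ st2) x) * h x) w
  = lv (lprod f (st0 ++ st) w) * sapply_at q s i T h w.
Proof.
move=> ok z1 z1' est e; elim: i h w => [|i IH] h w [|o st0] // => [_|[zi]] zw.
  rewrite /= est in zw *; have sw : size (take m w) = m.
    by rewrite size_takel // zw size_cat z1 leq_addr.
  rewrite -(cat_take_drop m w) !(sapply_same _ _ ok) // big_distrr /=.
  rewrite big_seq_cond [RHS]big_seq_cond; apply: eq_bigr => x /andP[xT /eqP xw].
  rewrite -xw in sw *; rewrite !lprod_cat ?e ?sw ?z1 //; first by ring.
  by have /allP/(_ _ xT)/andP[_ /eqP ->] := ok.
case: w zw => // a w [zw] /=.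
rewrite (lval_mul q0 s0 (f o a)) -mulrA -IH // -[RHS]addr0.
rewrite -(@sapply_at_0 F q s i T (fun=> 0) w) // -sapply_at_lin //.
by apply: eq_sapply_at => x; rewrite /= lval_mul // addr0 mulrA.
Qed.

(** At position 0 the coproduct splits into a part on the strands of the table, handled by
    [equiv_local], and a part to their right, and the weights agree entry by entry. Each step to the
    right adds the term where [X] acts on the first letter, which commutes with the table by
    [sapply_comm]. *)
Lemma sapply_at_dgen X m n i T st0 st1 st1' st2 g w :
  sizes_ok m n T -> size st1 = m -> size st1' = n -> equiv_check X st1 st1' T ->
  size st0 = i -> size w = size (st0 ++ st1 ++ st2) ->
  sapply_at q s i T (dgen X (st0 ++ st1' ++ st2) g) w
  = dgen X (st0 ++ st1 ++ st2) (sapply_at q s i T g) w.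
Proof.
move=> ok z1 z1' ec; elim: i st0 g w => [|i IH] [|o st0] g w // => [_|[zi]] zw.
  rewrite /= in zw *; have sw : size (take m w) = m.
    by rewrite size_takel // zw size_cat z1 leq_addr.
  rewrite -(cat_take_drop m w); move: (take m w) (drop m w) sw => w1 w2 sw.
  rewrite dgen_cat ?sw ?z1 // (sapply_same _ _ ok) //.
  rewrite (@eq_dgen_size X st1 _ (sapply q s T (fun w => g (w ++ w2)))); last first.
    by move=> x sx; rewrite sapply_catr // sx sw (sizes_ok_tlen ok).
  rewrite (equiv_local _ ec) ?sw ?z1 //.
  have -> : dgen X st2 (fun w => sapply q s T g (w1 ++ w)) w2 = \sum_(x <- T | x.1.1 == w1)
      lv x.2 * dgen X st2 (fun w => g (x.1.2 ++ w)) w2.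
    rewrite -dgen_sum; apply: eq_dgen => x; exact: (sapply_same _ _ ok).
  rewrite !big_distrr -big_split /= big_seq_cond [RHS]big_seq_cond.
  apply: eq_bigr => x /andP[xT /eqP xw].
  have [r l] := equiv_weight ec xT; rewrite -xw l dgen_cat; first by ring.
  by have /allP/(_ _ xT)/andP[_ /eqP ->] := ok.
case: w zw => // a w [zw]; cbn [cat dgen].
have := sapply_comm q0 s0 T i g w (letter_table_ok X o) (erefl (size [:: a])).
rewrite addn1 /= => ->.
rewrite -(sapply_at_weight (st1' := st1') _ ok z1 z1' erefl _ zi zw); last first.
  by move=> x xT; have [] := equiv_weight ec xT.
rewrite addrC -IH // -sapply_at_lin //.
by apply: eq_sapply_at => x /=; rewrite addrC.
Qed.

Lemma ev_dgen X st D st' g w : run st D = Some st' -> size w = size st ->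
  ev q s st D (dgen X st' g) w = dgen X st (ev q s st D g) w.
Proof.
elim: D st w => [|[i e] D IH] st w /=; first by case=> ->.
rewrite run_cons; case E: step => [st1|] //= r sw.
have [le sz] := step_size E.
rewrite (eq_sapply_at_size (k := size st1) (h := dgen X st1 (ev q s st1 D g)) q0 s0
  (event_table_ok _ _)); [|lia|lia|by move=> x; apply: IH].
have est : st = take i st ++ drop i st by rewrite cat_take_drop.
have zi : size (take i st) = i by rewrite size_takel //; lia.
have : step st (i, e) = omap (cat (take i st)) (step (drop i st) (0%N, e)).
  by rewrite -step_shift zi cat_take_drop.
rewrite E; case E': step => [s1|] //= [es].
have [a1 [a2 [a1' [ea z1 z1' ea' r1]]]] := step0_split E'.
have ec : equiv_check X a1 a1' (event_table (drop i st) e).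
  have := event_checkP X z1; rewrite /event_check r1 ea.
  suff -> : event_table (a1 ++ a2) e = event_table a1 e by [].
  by case: (e) z1 => [o||b] //=; case: (a1) => [|? [|? []]].
have st1E : st1 = take i st ++ a1' ++ a2 by rewrite es ea'.
have stE : st = take i st ++ a1 ++ a2 by rewrite -ea cat_take_drop.
rewrite st1E {4}stE; apply: sapply_at_dgen z1 z1' ec zi _.
  exact: event_table_ok.
by rewrite sw {1}stE.
Qed.

(** On the empty row every generator acts by its counit, which is 0. Hence a diagram without strands
    at the top defines a U_q-invariant functional. *)
Lemma ev_dgen0 X st D g w : run st D = Some [::] -> size w = size st ->
  dgen X st (ev q s st D g) w = 0.
Proof.
move=> r sw; rewrite -(ev_dgen X g r sw).
rewrite (eq_ev q0 s0 r (h := fun=> 0)) //.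
elim: D st w {r sw} => //= x D IH st w; case: step => // st'.
by apply: sapply_at_0.
Qed.

End Equivariance.

(** * The invariant of a diagram cut open at its first minimum *)

(* Formal proof that a combination of words is killed by every functional that
   is invariant under U_q. *)
Definition certificate := seq (lpoly * gen * word).

Definition cert_check (st : seq bool) (C : certificate) (t : trie) : bool :=
  all (fun x => size x.2 == size st) C
  && teqb (tsum [seq tscale x.1.1 (wgen x.1.2 st x.2) | x <- C]) t.

(** Up to monomials, [den_s] and [den_qs] are the two matrix entries of the rescaled E_2. Where one
    of them vanishes, V becomes reducible. *)
Definition den_s : lpoly := [:: (-1, (0, 0)); (1, (0, 2))]%bZ.
Definition den_qs : lpoly := [:: (-1, (0, 0)); (1, (2, 2))]%bZ.

Definition exchange_cert : certificate :=
  [:: ([:: (1, (0, 2)); (-1, (0, 4))], Gen true true, [:: c1; c3; c3; c0]);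
      ([:: (-1, (0, 0)); (1, (0, 2)); (1, (2, 2)); (-1, (2, 4))], Gen true false, [:: c2; c3; c0; c0]);
      ([:: (-1, (0, 0)); (1, (0, 2)); (1, (2, 2)); (-1, (2, 4))], Gen false true, [:: c2; c3; c2; c0]);
      ([:: (-1, (0, 2)); (1, (2, 4))], Gen true true, [:: c1; c0; c1; c1]);
      ([:: (-1, (2, 2)); (1, (2, 4))], Gen true true, [:: c0; c0; c3; c2]);
      ([:: (-1, (3, 0)); (2, (3, 2)); (-1, (3, 4))], Gen false false, [:: c0; c2; c3; c2]);
      ([:: (-1, (0, 0)); (1, (0, 2)); (1, (2, 2)); (-1, (2, 4))], Gen true false, [:: c1; c1; c0; c1]);
      ([:: (1, (0, 0)); (-2, (0, 2)); (1, (0, 4))], Gen true false, [:: c0; c3; c3; c1])]%bZ.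

Definition pair_cert (a b : color) : certificate :=
  match a, b with
  | c0, c0 => [::]
  | c0, c1 => [:: ([:: (-1, (1, 0))], Gen false false, [:: c0; c2])]
  | c0, c2 => [:: ([:: (-1, (-1, 0))], Gen false true, [:: c0; c1])]
  | c0, c3 => [:: ([:: (1, (1, 2))], Gen true true, [:: c1; c3])]
  | c1, c0 => [:: ([:: (1, (0, 0))], Gen false true, [:: c2; c0])]
  | c1, c1 => [:: ([:: (1, (0, 0))], Gen true false, [:: c0; c1])]
  | c1, c2 => [:: ([:: (1, (-1, 0))], Gen true false, [:: c1; c3])]
  | c1, c3 => [:: ([:: (1, (0, 0))], Gen false true, [:: c2; c3])]
  | c2, c0 => [:: ([:: (1, (0, 0))], Gen false false, [:: c1; c0])]
  | c2, c1 => [:: ([:: (1, (0, 0))], Gen false false, [:: c1; c1])]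
  | c2, c2 => [:: ([:: (-1, (-1, 0))], Gen false true, [:: c2; c1]);
      ([:: (1, (-2, 0))], Gen true false, [:: c0; c1])]
  | c2, c3 => [:: ([:: (1, (0, 0))], Gen false false, [:: c1; c3])]
  | c3, c0 => [:: ([:: (1, (0, 0))], Gen true false, [:: c2; c0])]
  | c3, c1 => [:: ([:: (-1, (1, 0))], Gen false false, [:: c3; c2])]
  | c3, c2 => [:: ([:: (-1, (0, 0))], Gen true false, [:: c3; c3])]
  | c3, c3 => [:: ([:: (1, (0, 0))], Gen true false, [:: c2; c3]);
      ([:: (-1, (-2, 0))], Gen true false, [:: c0; c1]);
      ([:: (1, (-1, 0))], Gen false true, [:: c2; c1])]
  end%bZ.

Definition pair_den (a b : color) : lpoly :=
  match a, b with c0, c3 => den_s | _, _ => lone end.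

(** An invariant functional that kills all these combinations is a multiple of the cap: Schur's
    lemma for V, in a form that can be computed. *)
Definition pair_target (a b : color) : trie :=
  tadd (tword [:: a; b])
    (if a == b then tscale (lmul lneg1 (lmul (mu_l a) (muV_l c0))) (tword [:: c0; c0])
     else Emp).

(** Of two minima side by side, the first word cuts the left one at colour [c0] and closes the right
    one, the second word does the opposite. Killing the difference means that both cuts give the
    same value. *)
Definition exchange_target : trie :=
  tsum [seq tadd (tword [:: c0; c0; a; a])
                 (tscale lneg1 (tword [:: a; a; c0; c0])) | a <- colors].

Lemma pair_check a b :
  cert_check [:: true; false] (pair_cert a b)
    (tscale (pair_den a b) (pair_target a b)).
Proof. by case: a b => -[]; vm_compute. Qed.

Lemma exchange_check :
  cert_check [:: true; false; true; false] exchange_cert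
    (tscale (lmul den_s den_qs) exchange_target).
Proof. by vm_compute. Qed.

Section CutInvariant.
Variables (F : fieldType) (q s : F).
Hypotheses (q0 : q != 0) (s0 : s != 0).
Hypotheses (ds0 : lval q s den_s != 0) (dqs0 : lval q s den_qs != 0).
Local Notation lv := (lval q s).
Local Notation ev := (ev q s).
Local Notation sim := (sim q s).

Definition unitf (w : word) : F := (w == [::])%:R.

Lemma ev_0 st D w : ev st D (fun=> 0) w = 0.
Proof.
elim: D st w => //= x D IH st w; case: step => // st'.
by apply: sapply_at_0.
Qed.

Lemma cert_ev st D g C d t : run st D = Some [::] -> lv d != 0 ->
  cert_check st C (tscale d t) -> teval q s t (ev st D g) = 0.
Proof.
move=> r d0 /andP[ok h]; have := teval_eqb q0 s0 (ev st D g) h.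
have -> : teval q s (tsum [seq tscale x.1.1 (wgen x.1.2 st x.2) | x <- C])
    (ev st D g) = 0.
  elim: C ok {h} => //= x C IH /andP[/eqP sx /IH h].
  by rewrite teval_add h teval_scale // teval_wgen // ev_dgen0 ?mulr0 ?addr0.
by rewrite teval_scale // => /esym/eqP; rewrite mulf_eq0 (negPf d0) => /eqP.
Qed.

Lemma pair_ev D a b : run [:: true; false] D = Some [::] ->
  ev [:: true; false] D unitf [:: a; b]
  = lv (muV_l c0) * ev [:: true; false] D unitf [:: c0; c0]
    * ev [:: true; false] [:: (0%N, Cap)] unitf [:: a; b].
Proof.
move=> r; have d0 : lv (pair_den a b) != 0.
  by case: (a) (b) => -[] //; rewrite /pair_den lval1 oner_eq0.
have := cert_ev unitf r d0 (pair_check a b).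
rewrite teval_add teval_word; move/eqP; rewrite addr_eq0 => /eqP ->.
have -> : ev [:: true; false] [:: (0%N, Cap)] unitf [:: a; b]
    = if a == b then lv (mu_l a) else 0.
  by case: a b {d0} => -[]; rewrite /= /unitf /= ?mulr1 ?addr0 ?add0r.
case: eqP => [->|_]; last by rewrite /= oppr0 mulr0.
rewrite teval_scale // teval_word !lval_mul //.
have -> : lv lneg1 = -1 by rewrite /= /tval /zval /= !expr0z !mulr1 addr0.
rewrite mulN1r mulNr opprK; ring.
Qed.

(** By [pair_ev] the functional of [D] is a multiple of the cap, and a cap absorbs a crossing of
    either sign by the first Reidemeister move. *)
Lemma double_cross b b' D : run [:: true; false] D = Some [::] ->
  ev [:: true; false] [:: (0%N, Cross b), (0%N, Cross b') & D] unitf [:: c0; c0]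
  = ev [:: true; false] D unitf [:: c0; c0].
Proof.
move=> r; pose T := [:: (0%N, Cross b); (0%N, Cross b')].
have rT : run [:: true; false] T = Some [:: true; false] by [].
rewrite -[[:: (_, Cross b), _ & D]]/(T ++ D) (ev_cat _ _ _ _ _ rT).
set c := lv (muV_l c0) * ev [:: true; false] D unitf [:: c0; c0].
pose cap := ev [:: true; false] [:: (0%N, Cap)] unitf.
have pc x : size x = 2 -> ev [:: true; false] D unitf x = c * cap x + 0.
  by case: x => [|x [|y []]] // _; rewrite addr0 pair_ev.
rewrite (eq_ev q0 s0 rT (h := fun x => c * cap x + 0)) // ev_lin.
rewrite ev_0 addr0.
rewrite -(ev_cat q s _ _ _ rT).
have e : sim [:: true; false] (T ++ [:: (0%N, Cap)]) [:: (0%N, Cap)].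
  apply: (sim_checkP q0 s0); first by [].
  by rewrite /T; case: (b) (b') => -[]; vm_compute.
by rewrite e.2 // [RHS]pair_ev.
Qed.

(** The cap takes the value [mu_l c0] on this word. With the factor [muV_l c0] the result is the
    ratio of [D] to the cap, hence 1 for the unknot. *)
Definition cut_ev (D : diagram) : F :=
  lv (muV_l c0) * ev [:: true; false] D unitf [:: c0; c0].

(* A first minimum with left leg downwards is replaced by the opposite one
   followed by a kink. *)
Definition Phi (D : diagram) : F :=
  match D with
  | (0%N, Cup true) :: D' => cut_ev D'
  | (0%N, Cup false) :: D' => cut_ev ((0%N, Cross true) :: D')
  | _ => 0
  end.

Lemma Phi_sim o D D' : sim [:: o; ~~ o] D D' ->
  Phi ((0%N, Cup o) :: D) = Phi ((0%N, Cup o) :: D').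
Proof.
case: o => e; congr (_ * _); first by rewrite e.2.
have := sim_ctx q0 s0 [::] (A := [:: (0%N, Cross true)])
  (st := [:: true; false]) erefl e.
by rewrite !cats0 => -[_ h]; apply: h.
Qed.

Lemma exchange_cups D : run [:: true; false; true; false] D = Some [::] ->
  Phi [:: (0%N, Cup true), (2, Cup true) & D]%N
  = Phi [:: (0%N, Cup true), (0, Cup true) & D]%N.
Proof.
move=> r; congr (_ * _).
have d0 : lv (lmul den_s den_qs) != 0 by rewrite lval_mul // mulf_neq0.
have := cert_ev unitf r d0 exchange_check.
set st := [:: true; false; true; false].
have two x y z t : ev st D unitf [:: x; y; z; t]
    - ev st D unitf [:: z; t; x; y] = teval q s (tadd (tword [:: x; y; z; t])
      (tscale lneg1 (tword [:: z; t; x; y]))) (ev st D unitf).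
  rewrite teval_add teval_scale // !teval_word.
  have -> : lv lneg1 = -1 by rewrite /= /tval /zval /= !expr0z !mulr1 addr0.
  by rewrite mulN1r.
rewrite tsum_eval // big_map; under eq_bigr do rewrite -two.
rewrite sumrB => /eqP; rewrite subr_eq0 !big_cons !big_nil !addr0 => /eqP e.
have z C : run [:: true; false] [:: C] = Some st -> forall w,
  ev [:: true; false] (C :: D) unitf w =
  sapply_at q s C.1 (event_table (drop C.1 [:: true; false]) C.2) (ev st D unitf) w.
  by rewrite run_cons /= => + w; case: step => //= x [->].
rewrite !z //=; have -> : tval q s (1, (0, 0))%bZ + 0 = 1 by exact: lval1.
by rewrite !mul1r !addr0.
Qed.

Lemma run_first i e D : run [::] ((i, e) :: D) <> None ->
  i = 0%N /\ exists o, e = Cup o.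
Proof.
rewrite run_cons /step; case: e => [o||b] /=; rewrite ?leqn0 //.
by case: eqP => // -> _; split; last exists o.
Qed.

(** For left legs upwards this is [exchange_cups]. A minimum of the other kind is written as an
    upward one followed by a kink, and the kink is carried along as a distant event. *)
Lemma Phi_first_cups o o' D : link_diagram [:: (0, Cup o), (2, Cup o') & D]%N ->
  Phi [:: (0, Cup o), (2, Cup o') & D]%N = Phi [:: (0, Cup o'), (0, Cup o) & D]%N.
Proof.
have distant st k e e' D1 : run st [:: (0, e); (legs_out e + k, e')]%N <> None ->
    run st [:: (legs_in e + k, e'); (0, e)]%N <> None ->
    sim st [:: (0, e), (legs_out e + k, e') & D1]%N
           [:: (legs_in e + k, e'), (0, e) & D1]%N.
  move=> r r'; exact: (sim_ctx q0 s0 D1 (A := [::]) erefl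
    (move_sim q0 s0 (move_distant 0 k e e') r r')).
have kink st i p D1 : (i <= size st)%N ->
    sim st [:: (i, Cup p), (i, Cross true) & D1] ((i, Cup (~~ p)) :: D1).
  move=> le; have r : run st [:: (i, Cup p); (i, Cross true)] <> None.
    have z : size (take i st) = i by rewrite size_takel.
    by rewrite run_cons /step le /= run_cons /step drop_cat z ltnn subnn.
  have r' : run st [:: (i, Cup (~~ p))] <> None by rewrite run_cons /step le.
  exact: (sim_ctx q0 s0 D1 (A := [::]) erefl
    (move_sim q0 s0 (move_R1_cup i p true) r r')).
have TT D1 : link_diagram [:: (0, Cup true), (2, Cup true) & D1]%N ->
    Phi [:: (0, Cup true), (2, Cup true) & D1]%N
    = Phi [:: (0, Cup true), (0, Cup true) & D1]%N.
  by move=> l; apply: exchange_cups.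
have To p D1 : link_diagram [:: (0, Cup true), (2, Cup p) & D1]%N ->
    Phi [:: (0, Cup true), (2, Cup p) & D1]%N
    = Phi [:: (0, Cup p), (0, Cup true) & D1]%N.
  case: p => [|l]; first exact: TT.
  have := @Phi_sim true _ _ (kink [:: true; false] 2 true D1 erefl).
  move=> <-; rewrite TT //.
  apply: (@Phi_sim true); exact: (distant [:: true; false] 0%N (Cup true)).
case: o => [|l]; first exact: To.
transitivity (Phi [:: (0, Cup true), (0, Cross true), (2, Cup o') & D]%N) => //.
have := @Phi_sim true _ _ (@distant [:: true; false] 0%N (Cross true) (Cup o') D _ _).
move=> -> //; rewrite To //.
by apply: Phi_sim; apply: kink.
Qed.

(** Against the kink built into [Phi], the two sides differ by a pair of crossings. Such a pair goes
    away by the second Reidemeister move or by [double_cross]. *)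
Lemma Phi_first_kink o b D : link_diagram ((0, Cup (~~ o)) :: D)%N ->
  Phi [:: (0, Cup o), (0, Cross b) & D]%N = Phi ((0, Cup (~~ o)) :: D)%N.
Proof.
have R2 st c D1 : size st = 2 ->
    sim st [:: (0, Cross c), (0, Cross (~~ c)) & D1]%N D1.
  case: st => [|x [|y []]] // _.
  exact: (sim_ctx q0 s0 D1 (A := [::]) (st := [:: x; y]) erefl
    (move_sim q0 s0 (move_R2 0 c) _ _)).
case: o => /= l.
  case: b => //; congr (_ * _).
  have [_ e] := sim_ctx q0 s0 [::] (A := [:: (0%N, Cross false)])
    (st := [:: true; false]) erefl (R2 [:: false; true] false D erefl).
  rewrite !cats0 in e; rewrite -[LHS]e //.
  exact: (double_cross false false (D := (0%N, Cross true) :: D)).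
case: b; congr (_ * _); first exact: double_cross.
by have [_ ->] := R2 [:: true; false] true D erefl.
Qed.

(** A move above the first minimum is covered by [Phi_sim]. At the very bottom both sides have to
    run from the empty row, which leaves the exchange of two minima and a kink on the first one. *)
Lemma Phi_local D D' : local_move D D' -> Phi D = Phi D'.
Proof.
case=> -[|[i e] A] B C C' m l l' {D D'}; last first.
  have [|i0 [o eo]] := @run_first i e (A ++ C ++ B); first by rewrite [run _ _]l.
  subst i e; move: l l'; rewrite /link_diagram !run_cons /step /=.
  rewrite run_cat; case rA: run => [st|] //=; rewrite run_cat => rC.
  rewrite run_cat rA /= run_cat => rC'.
  apply: Phi_sim; apply: (sim_ctx q0 s0 _ rA); apply: move_sim => // n.
    by rewrite n in rC.
  by rewrite n in rC'.
have nC : run [::] C <> None by move: l; rewrite /link_diagram /= run_cat; case: run.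
have nC' : run [::] C' <> None by move: l'; rewrite /link_diagram /= run_cat; case: run.
case: m l l' nC nC' => [i k e e'|i o|i o|i b|i o b|i b|i o b|i b|i b] l l' r r'.
- have [e0 [o eo]] := run_first r; have [e0' [o' eo']] := run_first r'.
  have k0 : k = 0%N by lia.
  subst; exact: Phi_first_cups.
- by have [] := run_first r.
- by have [i0 _] := run_first r; subst.
- by have [] := run_first r.
- by have [i0 _] := run_first r; subst.
- by have [_ []] := run_first r.
- by have [i0 _] := run_first r; subst; apply: Phi_first_kink.
- by have [_ []] := run_first r.
- by have [_ []] := run_first r.
Qed.

Lemma Phi_isotopic D D' : isotopic D D' -> Phi D = Phi D'.
Proof.
elim=> {D D'} [D D' /Phi_local -> //|//|D D' _ -> //|D D' D'' _ -> _ -> //].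
Qed.

End CutInvariant.

(** * The operator sigma *)

Definition col (i : 'I_4) : color := nth c0 colors i.
Definition ord_of (a : color) : 'I_4 :=
  match a with c0 => inord 0 | c1 => inord 1 | c2 => inord 2 | c3 => inord 3 end.

Lemma colK : cancel col ord_of.
Proof.
by case=> -[|[|[|[|//]]]] hi; apply: val_inj; rewrite /= inordK.
Qed.

Lemma ord_ofK : cancel ord_of col.
Proof. by case; rewrite /col /ord_of inordK. Qed.

(* Matrices over V (x) V: [f a b c d] is the coefficient of x_a (x) x_b in the
   image of x_c (x) x_d. *)
Definition fmx := color -> color -> color -> color -> lpoly.
Definition fvec := color -> color -> lpoly.

Definition lsum (f : color -> lpoly) : lpoly :=
  foldr (fun a p => ladd (f a) p) [::] colors.

(** The matrices are sparse; testing for the empty list keeps the products computable. *)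
Definition fmul (f g : fmx) : fmx := fun a b c d =>
  lsum (fun e => lsum (fun h =>
    if f a b e h is [::] then [::] else lmul (f a b e h) (g e h c d))).
Definition fapp (f : fmx) (v : fvec) : fvec := fun a b =>
  lsum (fun e => lsum (fun h =>
    if f a b e h is [::] then [::] else lmul (f a b e h) (v e h))).

Definition all_colors (P : color -> bool) : bool := all P colors.
Lemma all_colorsP P : all_colors P -> forall a, P a.
Proof. by case/and5P=> h0 h1 h2 h3 _; case. Qed.

Definition feqb (f g : fmx) : bool :=
  all_colors (fun a => all_colors (fun b => all_colors (fun c =>
    all_colors (fun d => leqb (f a b c d) (g a b c d))))).
Definition fveqb (v w : fvec) : bool :=
  all_colors (fun a => all_colors (fun b => leqb (v a b) (w a b))).

Definition fdelta (a b : color) : lpoly := if color_eqb a b then lone else [::].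
Definition fone : fmx := fun a b c d => lmul (fdelta a c) (fdelta b d).
Definition fscale (p : lpoly) (f : fmx) : fmx := fun a b c d => lmul p (f a b c d).
Definition fadd (f g : fmx) : fmx := fun a b c d => ladd (f a b c d) (g a b c d).

Definition ftable (T : table) : fmx := fun a b c d =>
  foldr (fun x p => if (x.1.1 == [:: c; d]) && (x.1.2 == [:: a; b])
                    then ladd x.2 p else p) [::] T.

Definition fgen1 (X : gen) (a c : color) : lpoly :=
  foldr (fun x p => if color_eqb x.1.1 c && color_eqb x.1.2 a
                    then ladd x.2 p else p) [::] (gen_entries X).
Definition fdiag (f : color -> lpoly) (a c : color) : lpoly := lmul (f a) (fdelta a c).

Definition fgen (X : gen) : fmx := fun a b c d =>
  let: Gen i e := X in
  ladd (lmul (fgen1 X a c) (if e then fdiag (kweight i) b d else fdelta b d))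
       (lmul (lmul (lsign (i && cparity c))
                   (if e then fdelta a c else fdiag (kweightV i) a c))
             (fgen1 X b d)).

Definition fK (i : bool) : fmx := fun a b c d =>
  lmul (fdiag (kweight i) a c) (fdiag (kweight i) b d).

Definition fsigma := ftable cross_pos.
Definition fsigmaV := ftable cross_neg.

Lemma fsigma_comm X : feqb (fmul fsigma (fgen X)) (fmul (fgen X) fsigma).
Proof. by case: X => -[] []; vm_compute. Qed.
Lemma fsigma_commK i : feqb (fmul fsigma (fK i)) (fmul (fK i) fsigma).
Proof. by case: i; vm_compute. Qed.
Lemma fsigma_inv : feqb (fmul fsigmaV fsigma) fone.
Proof. by vm_compute. Qed.

(* Weight spaces of the three highest weights. *)
Definition hw_support (j : nat) (a b : color) : bool :=
  match j, a, b with
  | 0, c0, c0 => true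
  | 1, c0, c1 | 1, c1, c0 => true
  | 2, c0, c3 | 2, c1, c2 | 2, c2, c1 | 2, c3, c0 => true
  | _, _, _ => false
  end%N.

Definition hw_scalar (j : nat) : lpoly :=
  match j with
  | 0%N => [:: (1, (0, 2))] | 1%N => lneg1 | _ => [:: (1, (-2, -2))] end%bZ.

Definition hw_den (j : nat) : lpoly :=
  match j with 0%N => lone | 1%N => den_s | _ => den_qs end.

(* On the weight space, hw_den (sigma - scalar) is a combination of E_1, E_2. *)
Definition hw_cert (j : nat) (i : bool) : table :=
  match j, i with
  | 1%N, true =>
   [:: ([:: c0; c0], [:: c0; c1], [:: (1, (0, 1))]);
       ([:: c0; c0], [:: c1; c0], [:: (1, (0, 2))])]
  | 2%N, false =>
   [:: ([:: c1; c1], [:: c0; c3], [:: (-1, (0, -1)); (1, (0, 1))]);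
       ([:: c1; c1], [:: c1; c2], [:: (1, (-2, -2)); (-1, (0, 0))]);
       ([:: c1; c1], [:: c2; c1], [:: (1, (-1, 0)); (-1, (1, 2))]);
       ([:: c1; c1], [:: c3; c0], [:: (1, (0, -1)); (-1, (0, 1))])]
  | 2%N, true =>
   [:: ([:: c0; c2], [:: c0; c3], [:: (-1, (-1, -1))]);
       ([:: c2; c0], [:: c0; c3], [:: (1, (1, 0))]);
       ([:: c2; c0], [:: c1; c2], [:: (-1, (-1, -1)); (1, (1, 1))]);
       ([:: c2; c0], [:: c2; c1], [:: (1, (-2, -1)); (-1, (0, 1))]);
       ([:: c0; c2], [:: c3; c0], [:: (1, (1, 1))]);
       ([:: c2; c0], [:: c3; c0], [:: (-1, (-1, 0)); (-1, (1, 0)); (1, (1, 2))])]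
  | _, _ => [::]
  end%bZ.

(** Explicit highest weight vectors, at which the eigenvalue conditions of [is_sigma] become
    equations for an unknown solution. *)
Definition hw_vec (j : nat) : fvec := fun a b =>
  match j, a, b with
  | 0%N, c0, c0 => lone
  | 1%N, c0, c1 => [:: (-1, (0, 1))]
  | 1%N, c1, c0 => lone
  | 2%N, c0, c3 => [:: (-1, (2, 0)); (1, (2, 2))]
  | 2%N, c1, c2 => [:: (1, (0, -1)); (-1, (2, 1))]
  | 2%N, c2, c1 => [:: (-1, (-1, -1)); (1, (1, 1))]
  | 2%N, c3, c0 => [:: (-1, (0, -2)); (1, (0, 0))]
  | _, _, _ => [::]
  end%bZ.

Definition frestr (P : color -> color -> bool) (f : fmx) : fmx := fun a b c d =>
  if P c d then f a b c d else [::].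

(** A vector of the weight space killed by E_1 and E_2 is thereby an eigenvector of sigma. The
    argument covers every highest weight vector of that weight, without the dimension of their
    space. *)
Lemma hw_check j : (j < 3)%N ->
  feqb (frestr (hw_support j) (fadd (fscale (hw_den j) fsigma)
         (fscale (lopp (lmul (hw_den j) (hw_scalar j))) fone)))
       (frestr (hw_support j)
         (fadd (fmul (ftable (hw_cert j false)) (fgen (Gen false true)))
               (fmul (ftable (hw_cert j true)) (fgen (Gen true true))))).
Proof. by case: j => [|[|[|//]]] _; vm_compute. Qed.

Lemma hw_vec_E j i : (j < 3)%N ->
  fveqb (fapp (fgen (Gen i true)) (hw_vec j)) (fun _ _ => [::]).
Proof. by case: j => [|[|[|//]]] _; case: i; vm_compute. Qed.

Definition hw_weight (j : nat) (i : bool) : lpoly :=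
  match j, i with
  | 1%N, false => [:: (1, (1, 0))] | _, false => lone
  | 2%N, true => [:: (1, (1, 2))] | _, true => [:: (1, (0, 2))]
  end%bZ.

Lemma hw_vec_K j i : (j < 3)%N ->
  fveqb (fapp (fK i) (hw_vec j)) (fun a b => lmul (hw_weight j i) (hw_vec j a b)).
Proof. by case: j => [|[|[|//]]] _; case: i; vm_compute. Qed.

(** This is (1 + s^2) (q^2 s^4 - 1) (1 + q^2 s^2), a common denominator for expressing the basis
    through the highest weight vectors. *)
Definition gen_den : lpoly :=
  [:: (-1, (0, 0)); (-1, (0, 2)); (-1, (2, 2)); (1, (2, 6)); (1, (4, 6)); (1, (4, 8))]%bZ.

(* Coefficients of gen_den x_a (x) x_b on the F-words applied to the three highest
   weight vectors; words are read from left to right. *)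
Definition gen_cert (a b : color) : seq (nat * seq bool * lpoly) :=
  match a, b with
  | c0, c0 => [:: (0%N, [::], [:: (-1, (0, 0)); (-1, (0, 2)); (-1, (2, 2)); (1, (2, 6)); (1, (4, 6)); (1, (4, 8))])]
  | c0, c1 => [:: (0%N, [:: true], [:: (-1, (0, 1)); (-1, (2, 3)); (1, (2, 5)); (1, (4, 7))]);
      (1%N, [::], [:: (1, (0, 1)); (1, (2, 3)); (-1, (2, 5)); (-1, (4, 7))])]
  | c0, c2 => [:: (0%N, [:: true; false], [:: (-1, (0, 1)); (-1, (2, 3)); (1, (2, 5)); (1, (4, 7))]);
      (1%N, [:: false], [:: (1, (0, 1)); (1, (2, 3)); (-1, (2, 5)); (-1, (4, 7))])]
  | c0, c3 => [:: (0%N, [:: true; false; true], [:: (-1, (0, 2)); (1, (4, 6))]);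
      (1%N, [:: false; true], [:: (1, (0, 2)); (1, (2, 2)); (-1, (2, 6)); (-1, (4, 6))]);
      (1%N, [:: true; false], [:: (-1, (1, 2)); (1, (3, 6))]);
      (2%N, [::], [:: (1, (2, 4)); (1, (2, 6))])]
  | c1, c0 => [:: (0%N, [:: true], [:: (-1, (0, 2)); (-1, (2, 4)); (1, (2, 6)); (1, (4, 8))]);
      (1%N, [::], [:: (-1, (0, 0)); (-1, (2, 2)); (1, (2, 4)); (1, (4, 6))])]
  | c1, c1 => [:: (1%N, [:: true], [:: (1, (0, 1)); (1, (2, 3)); (-1, (2, 5)); (-1, (4, 7))])]
  | c1, c2 => [:: (0%N, [:: true; false; true], [:: (-1, (2, 3)); (1, (2, 5)); (-1, (4, 5)); (1, (4, 7))]);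
      (1%N, [:: false; true], [:: (-1, (2, 1)); (1, (2, 3)); (1, (4, 5)); (-1, (4, 7))]);
      (1%N, [:: true; false], [:: (1, (1, 1)); (-1, (3, 5))]);
      (2%N, [::], [:: (-1, (2, 3)); (-1, (2, 5))])]
  | c1, c3 => [:: (1%N, [:: true; false; true], [:: (-1, (1, 2)); (1, (3, 6))]);
      (2%N, [:: true], [:: (1, (2, 4)); (1, (2, 6))])]
  | c2, c0 => [:: (0%N, [:: true; false], [:: (-1, (0, 2)); (-1, (2, 4)); (1, (2, 6)); (1, (4, 8))]);
      (1%N, [:: false], [:: (-1, (0, 0)); (-1, (2, 2)); (1, (2, 4)); (1, (4, 6))])]
  | c2, c1 => [:: (0%N, [:: true; false; true], [:: (1, (1, 3)); (-1, (1, 5)); (1, (3, 5)); (-1, (3, 7))]);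
      (1%N, [:: false; true], [:: (1, (1, 1)); (-1, (1, 3)); (-1, (3, 5)); (1, (3, 7))]);
      (1%N, [:: true; false], [:: (1, (2, 3)); (-1, (4, 7))]);
      (2%N, [::], [:: (1, (1, 3)); (1, (1, 5))])]
  | c2, c2 => [:: (1%N, [:: false; true; false], [:: (1, (0, 1)); (1, (2, 3)); (-1, (2, 5)); (-1, (4, 7))])]
  | c2, c3 => [:: (1%N, [:: false; true; false; true], [:: (-1, (1, 2)); (1, (3, 6))]);
      (2%N, [:: true; false], [:: (1, (2, 4)); (1, (2, 6))])]
  | c3, c0 => [:: (0%N, [:: true; false; true], [:: (-1, (0, 4)); (1, (4, 8))]);
      (1%N, [:: false; true], [:: (-1, (0, 2)); (-1, (2, 2)); (1, (2, 6)); (1, (4, 6))]);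
      (1%N, [:: true; false], [:: (1, (1, 2)); (-1, (3, 6))]);
      (2%N, [::], [:: (1, (0, 2)); (1, (0, 4))])]
  | c3, c1 => [:: (1%N, [:: true; false; true], [:: (1, (2, 3)); (-1, (4, 7))]);
      (2%N, [:: true], [:: (1, (1, 3)); (1, (1, 5))])]
  | c3, c2 => [:: (1%N, [:: false; true; false; true], [:: (1, (2, 3)); (-1, (4, 7))]);
      (2%N, [:: true; false], [:: (1, (1, 3)); (1, (1, 5))])]
  | c3, c3 => [:: (2%N, [:: true; false; true], [:: (1, (2, 4)); (1, (2, 6))])]
  end%bZ.

Definition gen_vec (x : nat * seq bool) : fvec :=
  foldl (fun v i => fapp (fgen (Gen i false)) v) (hw_vec x.1) x.2.

Lemma gen_check a b :
  fveqb (foldr (fun x v => fun c d => ladd (lmul x.2 (gen_vec x.1 c d)) (v c d))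
           (fun _ _ => [::]) (gen_cert a b))
        (fun c d => lmul gen_den (lmul (fdelta a c) (fdelta b d))).
Proof. by case: a b => -[]; vm_compute. Qed.

Section SigmaMatrix.
Variables (F : fieldType) (q s : F).
Hypotheses (q0 : q != 0) (s0 : s != 0).
Local Notation lv := (lval q s).

Definition mxf (f : fmx) : 'M[F]_VV_dim :=
  \matrix_(x, y) lv (f (col (enum_val x).1) (col (enum_val x).2)
                       (col (enum_val y).1) (col (enum_val y).2)).
Definition vcf (v : fvec) : 'cV[F]_VV_dim :=
  \col_x lv (v (col (enum_val x).1) (col (enum_val x).2)).

Lemma lval_lsum f : lv (lsum f) = \sum_(a <- colors) lv (f a).
Proof.
rewrite /lsum; elim: colors => [|a r IH]; first by rewrite big_nil.
by rewrite big_cons /= lval_add IH.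
Qed.

Lemma lval_pmul p r : lv (if p is [::] then [::] else lmul p r) = lv p * lv r.
Proof. by rewrite -lval_mul //; case: p. Qed.

Lemma sum_col (G : color -> F) : \sum_(i < 4) G (col i) = \sum_(a <- colors) G a.
Proof. by rewrite !big_ord_recl big_ord0 !big_cons big_nil. Qed.

Lemma sum_VV (G : color -> color -> F) :
  \sum_(k < VV_dim) G (col (enum_val k).1) (col (enum_val k).2)
  = \sum_(a <- colors) \sum_(b <- colors) G a b.
Proof.
rewrite (reindex (@enum_rank {: 'I_4 * 'I_4})) /=; last first.
  by exists enum_val => x _; rewrite ?enum_valK ?enum_rankK.
under eq_bigr do rewrite enum_rankK.
rewrite -(pair_bigA _ (fun i j => G (col i) (col j))) /=.
by rewrite -sum_col; apply: eq_bigr => i _; rewrite sum_col.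
Qed.

Lemma mxf_mul f g : mxf (fmul f g) = mxf f *m mxf g.
Proof.
apply/matrixP => x y; rewrite !mxE lval_lsum.
under eq_bigr => a _ do (rewrite lval_lsum; under eq_bigr do rewrite lval_pmul).
rewrite -(sum_VV (fun a b => lv (f (col (enum_val x).1) (col (enum_val x).2) a b)
  * lv (g a b (col (enum_val y).1) (col (enum_val y).2)))).
by apply: eq_bigr => k _; rewrite !mxE.
Qed.

Lemma mxf_app f v : vcf (fapp f v) = mxf f *m vcf v.
Proof.
apply/matrixP => x y; rewrite !mxE lval_lsum.
under eq_bigr => a _ do (rewrite lval_lsum; under eq_bigr do rewrite lval_pmul).
rewrite -(sum_VV (fun a b => lv (f (col (enum_val x).1) (col (enum_val x).2) a b)
  * lv (v a b))).
by apply: eq_bigr => k _; rewrite !mxE.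
Qed.

Lemma mxf_eq f g : feqb f g -> mxf f = mxf g.
Proof.
move=> h; apply/matrixP => x y; rewrite !mxE; apply: lval_eqb.
by move/all_colorsP: h => /(_ _)/all_colorsP/(_ _)/all_colorsP/(_ _)/all_colorsP.
Qed.

Lemma vcf_eq v w : fveqb v w -> vcf v = vcf w.
Proof.
move=> h; apply/matrixP => x y; rewrite !mxE; apply: lval_eqb.
by move/all_colorsP: h => /(_ _)/all_colorsP.
Qed.

Lemma mxf_add f g : mxf (fadd f g) = mxf f + mxf g.
Proof. by apply/matrixP => x y; rewrite !mxE lval_add. Qed.

Lemma mxf_scale p f : mxf (fscale p f) = lv p *: mxf f.
Proof. by apply/matrixP => x y; rewrite !mxE lval_mul. Qed.

Lemma lval_delta a b : lv (fdelta a b) = (a == b)%:R.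
Proof. by rewrite /fdelta -[color_eqb a b]/(a == b); case: eqP; rewrite ?lval1. Qed.

Lemma mxf_one : mxf fone = 1%:M.
Proof.
apply/matrixP => x y; rewrite !mxE lval_mul // !lval_delta -natrM mulnb.
rewrite !(inj_eq (can_inj colK)); congr (_%:R); congr nat_of_bool.
by rewrite -(inj_eq enum_val_inj) -pair_eqE.
Qed.

(** The factor by which [gen_entries] rescales E_2. *)
Definition gen_scale (X : gen) : F :=
  if X is Gen true true then q - q^-1 else 1.

Definition gen_mx (X : gen) : 'M[F]_4 :=
  let: Gen i e := X in
  let j : 'I_2 := if i then 1 else 0 in if e then uE (V q s) j else uF (V q s) j.

Definition gen_mx2 (X : gen) : 'M[F]_VV_dim :=
  let: Gen i e := X in
  let j : 'I_2 := if i then 1 else 0 in if e then uE (VV q s) j else uF (VV q s) j.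

Hypothesis q2 : q ^+ 2 != 1.

Lemma qq0 : q - q^-1 != 0.
Proof.
apply: contraNneq q2 => h; apply/eqP; have := congr1 (fun x => q * x) h.
by rewrite mulrBr mulfV // mulr0 -expr2 => /eqP; rewrite subr_eq0 => /eqP.
Qed.

Lemma lval_kweight i (j : 'I_2) a c : j = (if i then 1 else 0) ->
  lv (fdiag (kweight i) (col a) (col c)) = uK (V q s) j a c.
Proof.
move=> ->; rewrite lval_mul // lval_delta (inj_eq (can_inj colK)).
rewrite -mulr_natr.
have k : lv (kweight i (col a)) =
    nth 0 (if i then [:: s; s; q * s; q * s] else [:: 1; q; q^-1; 1]) a.
  case: i; case: a => -[|[|[|[|//]]]] ?; rewrite /= /tval /zval /= ?exprz1 ?expr0z;
    by rewrite ?mul1r ?mulr1 ?addr0 // -?exprN1.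
by rewrite mulr_natr k; case: (i); rewrite /= !mxE mulr_natr.
Qed.

Lemma lval_gen1 X a c : lv (fgen1 X (col a) (col c)) = gen_scale X * gen_mx X a c.
Proof.
have qs : (q * s)^-1 = q^-1 * s^-1 by rewrite invfM.
case: X => -[] []; case: a c => -[|[|[|[|//]]]] ? [[|[|[|[|//]]]] ?];
  rewrite /gen_mx /= !mxE /= ?mulr0 ?mul1r //= /tval /zval /= ?expr0z ?exprz1
   ?mul1r ?mulr1 ?addr0 //; rewrite /qbr [RHS]mulrC divfK ?qq0 //.
- by rewrite mulN1r addrC -exprN1.
- by rewrite mulN1r mulNr addrC qs -!exprN1.
Qed.

Lemma lval_kweightV i (j : 'I_2) a c : j = (if i then 1 else 0) ->
  lv (fdiag (kweightV i) (col a) (col c)) = invmx (uK (V q s) j) a c.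
Proof.
move=> ->; rewrite lval_mul // lval_delta (inj_eq (can_inj colK)).
have k : lv (kweightV i (col a)) =
    nth 0 (if i then [:: s^-1; s^-1; (q * s)^-1; (q * s)^-1]
           else [:: 1; q^-1; q; 1]) a.
  case: i; case: a => -[|[|[|[|//]]]] ?; rewrite /= /tval /zval /= ?exprz1 ?expr0z;
    by rewrite ?mul1r ?mulr1 ?addr0 ?invfM -?exprN1.
have [_ e0] : diag4 [:: 1; q; q^-1; 1] \in unitmx /\
    invmx (diag4 [:: 1; q; q^-1; 1]) = diag4 [:: 1; q^-1; q; 1].
  by apply: diag4_inv => -[[|[|[|[|//]]]] ?] /=; rewrite ?mulr1 ?mulfV ?mulVf.
have [_ e1] : diag4 [:: s; s; q * s; q * s] \in unitmx /\
    invmx (diag4 [:: s; s; q * s; q * s])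
    = diag4 [:: s^-1; s^-1; (q * s)^-1; (q * s)^-1].
  by apply: diag4_inv => -[[|[|[|[|//]]]] ?] /=; rewrite mulfV ?mulf_neq0.
by rewrite mulr_natr k; case: (i); rewrite /= ?e0 ?e1 mxE.
Qed.

Lemma lval_lsign b : lv (lsign b) = (-1) ^+ b.
Proof. by case: b; rewrite ?lval1 //= /tval /zval /= !expr0z !mulr1 addr0. Qed.

Lemma V_oddE a : V_odd a = cparity (col a).
Proof. by case: a => -[|[|[|[|]]]]. Qed.

Lemma gen_mx2E X : gen_scale X *: gen_mx2 X = mxf (fgen X).
Proof.
apply/matrixP => x y; rewrite !mxE; case: X => i e; rewrite /fgen.
have o : uq_odd (if i then 1 else 0) = i by case: i.
have d a c : lv (fdelta (col a) (col c)) = (1%:M : 'M[F]_4) a c.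
  by rewrite lval_delta (inj_eq (can_inj colK)) !mxE.
rewrite lval_add !lval_mul // !lval_gen1 //=.
by case: e; rewrite /= !mxE /=; case: (enum_val x) (enum_val y) => [a b] [c h] /=;
  rewrite o ?(lval_kweight (j := if i then 1 else 0)) //
  ?(lval_kweightV (j := if i then 1 else 0)) // !d
  lval_lsign V_oddE mul1r; case: (i); rewrite /gen_mx /=; ring.
Qed.

Lemma fK_E i (j : 'I_2) : j = (if i then 1 else 0) -> mxf (fK i) = uK (VV q s) j.
Proof.
move=> ij; apply/matrixP => x y; rewrite !mxE lval_mul // !(lval_kweight _ _ ij).
by case: (enum_val x) (enum_val y) => [a b] [c h] /=; rewrite mul1r.
Qed.

Definition sigma_mx := mxf fsigma.

Lemma gen_scale0 X : gen_scale X != 0.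
Proof. by case: X => -[] []; rewrite /= ?oner_eq0 ?qq0. Qed.

Lemma sigma_comm X : sigma_mx *m gen_mx2 X = gen_mx2 X *m sigma_mx.
Proof.
apply: (scalerI (gen_scale0 X)); rewrite scalemxAr scalemxAl gen_mx2E.
by rewrite -!mxf_mul; apply/mxf_eq/fsigma_comm.
Qed.

Lemma sigma_commK i : sigma_mx *m uK (VV q s) i = uK (VV q s) i *m sigma_mx.
Proof.
have [j ->] : exists j : bool, i = if j then 1 else 0.
  case: i => -[|[|//]] ?; [exists false|exists true]; exact: val_inj.
by rewrite -(fK_E erefl) -!mxf_mul; apply/mxf_eq/fsigma_commK.
Qed.

Lemma I2_bool (i : 'I_2) : exists j : bool, i = if j then 1 else 0.
Proof. by case: i => -[|[|//]] ?; [exists false|exists true]; apply: val_inj. Qed.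

Lemma sigma_commE i : sigma_mx *m uE (VV q s) i = uE (VV q s) i *m sigma_mx.
Proof. by have [j ->] := I2_bool i; exact: (sigma_comm (Gen j true)). Qed.
Lemma sigma_commF i : sigma_mx *m uF (VV q s) i = uF (VV q s) i *m sigma_mx.
Proof. by have [j ->] := I2_bool i; exact: (sigma_comm (Gen j false)). Qed.

(* The eigenspaces of sigma are submodules. *)
Lemma sigma_generated (l : F) v w : sigma_mx *m v = l *: v ->
  generated (VV q s) v w -> sigma_mx *m w = l *: w.
Proof.
move=> hv /(_ (kermx (sigma_mx - l%:M)^T)).
have kerP u : (u^T <= kermx (sigma_mx - l%:M)^T)%MS = (sigma_mx *m u == l *: u).
  rewrite sub_kermx -trmx_mul -trmx0 (inj_eq trmx_inj) mulmxBl mul_scalar_mx.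
  by rewrite subr_eq0.
rewrite !kerP hv eqxx => h; apply/eqP/h => // i.
have st (X : 'M_VV_dim) : sigma_mx *m X = X *m sigma_mx ->
    stablemx (kermx (sigma_mx - l%:M)^T) X^T.
  move=> c; rewrite sub_kermx -mulmxA -trmx_mul mulmxBl c.
  rewrite -scalar_mxC -mulmxBr trmx_mul mulmxA; apply/eqP.
  by rewrite mulmx_ker mul0mx.
split; apply: st; [exact: sigma_commE|exact: sigma_commF|exact: sigma_commK].
Qed.

Hypotheses (ds0 : lv den_s != 0) (dqs0 : lv den_qs != 0).

Lemma hw_den0 j : lv (hw_den j) != 0.
Proof. by case: j => [|[|j]] //; rewrite lval1 oner_eq0. Qed.

Lemma q1 : q != 1.
Proof. by apply: contraNneq q2 => ->; rewrite expr1n. Qed.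

(** A test that two weights differ in [F]: the same power of s, and powers of q at distance 1 or 2,
    which [q ^+ 2 != 1] separates. It is enough for all weights of the tensor square that compete
    with a highest weight. *)
Definition near_monomials (p r : lpoly) : bool :=
  match p, r with
  | [:: (Zpos xH, (x, y))], [:: (Zpos xH, (x', y'))] =>
      (y == y') && (Z.sub x x' \in [:: 1; -1; 2; -2]%bZ)
  | _, _ => false
  end.

Lemma near_monomials_neq p r : near_monomials p r -> lv p != lv r.
Proof.
case: p => [|[[|[c|c|]|c] [x y]] [|t p]] //.
case: r => [|[[|[c|c|]|c] [x' y']] [|u r]] //.
rewrite [near_monomials _ _]/=.
case/andP=> /eqP -> h; rewrite /= /tval (_ : zval F _ = 1) // !mul1r !addr0.
rewrite (inj_eq (mulIf (expfz_neq0 _ s0))).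
have -> : int_of_Z x = int_of_Z x' + int_of_Z (Z.sub x x').
  by rewrite -[Z.sub x x']/(x - x') rmorphB addrC subrK.
rewrite expfzDr // -[X in _ != X]mulr1 (inj_eq (mulfI (expfz_neq0 _ q0))).
have n1 := q1; have inv y1 : y1 != 1 -> y1^-1 != 1.
  by apply: contraNneq => h1; rewrite -[y1]invrK h1 invr1.
move: h; rewrite !inE => /or4P[] /eqP -> //.
- by rewrite -[q ^ _]/(q^-1) inv.
- by rewrite -[q ^ _]/((q ^+ 2)^-1) inv.
Qed.

Lemma hw_weights_check j a b : (j < 3)%N ->
  hw_support j a b || near_monomials (lmul (kweight false a) (kweight false b)) (hw_weight j false)
  || near_monomials (lmul (kweight true a) (kweight true b)) (hw_weight j true).
Proof. by case: j => [|[|[|//]]] _; case: a b => -[]; vm_compute. Qed.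

End SigmaMatrix.

(** * Existence and uniqueness of sigma *)

Section SigmaUnique.
Variables (F : fieldType) (q s : F).
Hypotheses (q0 : q != 0) (s0 : s != 0) (q2 : q ^+ 2 != 1).
Local Notation lv := (lval q s).
Hypotheses (ds0 : lv den_s != 0) (dqs0 : lv den_qs != 0) (dg0 : lv gen_den != 0).
Local Notation mxf := (mxf q s).
Local Notation vcf := (vcf q s).
Local Notation sigma_mx := (sigma_mx q s).

Lemma mxf_restr P f (v : 'cV_VV_dim) :
  (forall x, ~~ P (col (enum_val x).1) (col (enum_val x).2) -> v x 0 = 0) ->
  mxf (frestr P f) *m v = mxf f *m v.
Proof.
move=> h; apply/matrixP => x y; rewrite !mxE; apply: eq_bigr => k _.
rewrite !mxE /frestr; case: ifP => // /negbT /h; rewrite (ord1 y) => ->.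
by rewrite !mulr0.
Qed.

Lemma fK_diag i (v : 'cV_VV_dim) x :
  (mxf (fK i) *m v) x 0 =
  lv (lmul (kweight i (col (enum_val x).1)) (kweight i (col (enum_val x).2))) * v x 0.
Proof.
rewrite !mxE (bigD1 x) //= big1 => [|y yx].
  rewrite !mxE /fK !lval_mul // !lval_delta !eqxx !mulr1 addr0 //.
rewrite !mxE /fK !lval_mul // !lval_delta.
case: eqP => [/(can_inj colK) e1|]; last by rewrite !(mulr0, mul0r).
case: eqP => [/(can_inj colK) e2|]; last by rewrite !(mulr0, mul0r).
case/eqP: yx; apply: enum_val_inj.
by case: (enum_val x) (enum_val y) e1 e2 => [a b] [c d] /= -> ->.
Qed.

Lemma hw_sigma j (v : 'cV_VV_dim) : (j < 3)%N ->
  (forall i, uE (VV q s) i *m v = 0) ->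
  (forall i, mxf (fK i) *m v = lv (hw_weight j i) *: v) ->
  sigma_mx *m v = lv (hw_scalar j) *: v.
Proof.
move=> j3 hE hK.
(* K_1 and K_2 are diagonal, and a basis vector outside the support differs from the highest weight
   in one of their eigenvalues, so its coordinate is 0. *)
have sup x : ~~ hw_support j (col (enum_val x).1) (col (enum_val x).2) -> v x 0 = 0.
  move=> ns; apply/eqP; apply: contraT => vx.
  have w i : lv (lmul (kweight i (col (enum_val x).1)) (kweight i (col (enum_val x).2)))
      = lv (hw_weight j i).
    have := congr1 (fun M : 'cV_VV_dim => M x 0) (hK i); rewrite fK_diag mxE.
    exact: (mulIf vx).
  have := hw_weights_check (col (enum_val x).1) (col (enum_val x).2) j3.
  rewrite (negPf ns) orFb => /orP[] /(near_monomials_neq q0 s0 q2); by rewrite w eqxx.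
have E0 i : mxf (fgen (Gen i true)) *m v = 0.
  by rewrite -gen_mx2E // -scalemxAl /gen_mx2 hE scaler0.
have := mxf_eq q s (hw_check j3) => /(congr1 (mulmx^~ v)).
rewrite !mxf_restr // 2!mxf_add // !mxf_mul // !mulmxDl -!mulmxA !E0 !mulmx0 addr0.
rewrite !mxf_scale // mxf_one // -!scalemxAl mul1mx lval_opp lval_mul // scaleNr.
rewrite -scalerA -scalerBr => /eqP; rewrite scaler_eq0 (negPf (hw_den0 ds0 dqs0 j)) /=.
by rewrite subr_eq0 => /eqP.
Qed.

Lemma lval_mono i j : lv [:: (1%bZ, (i, j))] = q ^ int_of_Z i * s ^ int_of_Z j.
Proof. by rewrite /= /tval (_ : zval F _ = 1) // mul1r addr0. Qed.

Lemma hw_scalarE : [/\ lv (hw_scalar 0) = s ^+ 2, lv (hw_scalar 1) = - 1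
  & lv (hw_scalar 2) = q ^- 2 * s ^- 2].
Proof.
split; [|exact: (lval_lsign q s true)|]; rewrite lval_mono ?expr0z ?mul1r; reflexivity.
Qed.

Lemma hw_weightE : [/\ lv (hw_weight 0 false) = 1, lv (hw_weight 0 true) = s ^+ 2,
  lv (hw_weight 1 false) = q, lv (hw_weight 1 true) = s ^+ 2 &
  lv (hw_weight 2 false) = 1 /\ lv (hw_weight 2 true) = q * s ^+ 2].
Proof.
split; [exact: lval1| | | |split; first exact: lval1];
  rewrite lval_mono ?expr0z ?mul1r ?mulr1; reflexivity.
Qed.

Definition hw_l1 (j : nat) : F := if j is 1%N then q else 1.
Definition hw_l2 (j : nat) : F := if j is 2%N then q * s ^+ 2 else s ^+ 2.

Lemma hw_lE j i (k : 'I_2) : (j < 3)%N -> k = (if i then 1 else 0) ->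
  lv (hw_weight j i) = if i then hw_l2 j else hw_l1 j.
Proof.
have [a b c d [e f]] := hw_weightE.
by case: j => [|[|[|//]]] _ _; case: i.
Qed.

Lemma hw_sigma_hw j v : (j < 3)%N -> highest_weight (VV q s) (hw_l1 j) (hw_l2 j) v ->
  sigma_mx *m v = lv (hw_scalar j) *: v.
Proof.
move=> j3 [_ hE h1 h2]; apply: hw_sigma => // i.
rewrite (hw_lE j3 (erefl (if i then 1 else 0))) (fK_E q0 s0 (erefl (if i then 1 else 0))).
by case: i.
Qed.

Lemma sigma_mxP : is_sigma q s sigma_mx.
Proof.
have [a b c] := hw_scalarE; split.
- exact: sigma_commE.
- exact: sigma_commF.
- exact: sigma_commK.
- by move=> v w /(@hw_sigma_hw 0 v isT); rewrite a; apply: sigma_generated.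
- move=> v w /(@hw_sigma_hw 1 v isT); rewrite b -scaleN1r; exact: sigma_generated.
- by move=> v w /(@hw_sigma_hw 2 v isT); rewrite c; apply: sigma_generated.
Qed.

Lemma hw_vec_neq0 j : (j < 3)%N -> vcf (hw_vec j) != 0.
Proof.
move=> j3; apply/eqP => z.
have zab a b : lv (hw_vec j a b) = 0.
  have := congr1 (fun M : 'cV_VV_dim => M (enum_rank (ord_of a, ord_of b)) 0) z.
  by rewrite !mxE enum_rankK /= !ord_ofK.
case: j j3 {z} zab => [|[|[|//]]] _ z.
- by have /eqP := z c0 c0; rewrite lval1 oner_eq0.
- by have /eqP := z c1 c0; rewrite lval1 oner_eq0.
have e : lv (lmul (hw_vec 2 c2 c1) [:: (1, (1, 1))]%bZ) = lv den_qs.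
  exact: lval_eqb.
by case/eqP: dqs0; rewrite -e lval_mul // (z c2 c1) mul0r.
Qed.

Lemma hw_vec_hw j : (j < 3)%N ->
  highest_weight (VV q s) (hw_l1 j) (hw_l2 j) (vcf (hw_vec j)).
Proof.
have vs p v : vcf (fun a b => lmul p (v a b)) = lv p *: vcf v.
  by apply/matrixP => x y; rewrite !mxE lval_mul.
move=> j3; have hK i k : k = (if i then 1 else 0) ->
    uK (VV q s) k *m vcf (hw_vec j) = (if i then hw_l2 j else hw_l1 j) *: vcf (hw_vec j).
  move=> e; rewrite -(fK_E q0 s0 e) -mxf_app // (vcf_eq q s (hw_vec_K i j3)) vs.
  by rewrite (hw_lE j3 e).
split; [exact: hw_vec_neq0| |exact: (hK false)|exact: (hK true)].
move=> i; have [k ->] := I2_bool i.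
apply: (scalerI (gen_scale0 q0 q2 (Gen k true))); rewrite scalemxAl.
rewrite -[uE _ _]/(gen_mx2 q s (Gen k true)) gen_mx2E // -mxf_app //.
rewrite (vcf_eq q s (hw_vec_E k j3)) scaler0.
by apply/matrixP => x y; rewrite !mxE.
Qed.

(** The difference of two solutions commutes with F_1 and F_2 and kills the three highest weight
    vectors, so it kills everything they generate, which is the whole space by [gen_check]. *)
Lemma is_sigma_unique S : is_sigma q s S -> S = sigma_mx.
Proof.
move=> hS; apply/eqP; rewrite -subr_eq0; set T := S - sigma_mx.
have gen_refl v : generated (VV q s) v v by [].
have Shw j : (j < 3)%N -> S *m vcf (hw_vec j) = lv (hw_scalar j) *: vcf (hw_vec j).
  have [a b c] := hw_scalarE; case: hS => _ _ _ h1 h2 h3.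
  case: j => [|[|[|//]]] j3.
  - by rewrite a; apply: (h1 _ _ (hw_vec_hw j3)).
  - by rewrite b scaleN1r; apply: (h2 _ _ (hw_vec_hw j3)).
  - by rewrite c; apply: (h3 _ _ (hw_vec_hw j3)).
have T0 j : T *m vcf (hw_vec j) = 0.
  case: (ltnP j 3) => j3.
    by rewrite mulmxBl Shw // (hw_sigma_hw j3 (hw_vec_hw j3)) subrr.
  (* Beyond the three indices [hw_vec] is 0 by its default branch, so [T0] holds for all [j]. *)
  have -> : vcf (hw_vec j) = 0.
    by apply/matrixP => x y; rewrite !mxE; case: j j3 => [|[|[|j]]].
  by rewrite mulmx0.
have TF i v : T *m vcf v = 0 -> T *m vcf (fapp (fgen (Gen i false)) v) = 0.
  move=> h; rewrite mxf_app // -gen_mx2E // /gen_scale.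
  have -> : (match Gen i false with Gen true true => q - q^-1 | _ => 1 end) = 1.
    by case: i.
  rewrite scale1r mulmxA /gen_mx2 mulmxBl (sigma_F hS) sigma_commF // -mulmxBr.
  by rewrite -mulmxA h mulmx0.
have Tg x : T *m vcf (gen_vec x) = 0.
  case: x => j w; rewrite /gen_vec /=; elim: w (hw_vec j) (T0 j) => //= i w IH v h.
  by apply: IH; apply: TF.
have Tcol a b : T *m vcf (fun c d => lmul (fdelta a c) (fdelta b d)) = 0.
  apply: (scalerI dg0); rewrite scaler0 scalemxAr.
  have -> : lv gen_den *: vcf (fun c d => lmul (fdelta a c) (fdelta b d))
      = vcf (fun c d => lmul gen_den (lmul (fdelta a c) (fdelta b d))).
    by apply/matrixP => x y; rewrite !mxE !lval_mul.
  rewrite -(vcf_eq q s (gen_check a b)).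
  elim: (gen_cert a b) => [|x C IH] /=.
    rewrite (_ : vcf _ = 0) ?mulmx0 //; by apply/matrixP => x y; rewrite !mxE.
  set v := foldr _ _ _ in IH *.
  have -> : vcf (fun c d => ladd (lmul x.2 (gen_vec x.1 c d)) (v c d))
      = lv x.2 *: vcf (gen_vec x.1) + vcf v.
    by apply/matrixP => y z; rewrite !mxE lval_add lval_mul.
  by rewrite mulmxDr -scalemxAr Tg scaler0 IH addr0.
apply/eqP/matrixP => x y; rewrite [RHS]mxE.
have := congr1 (fun M : 'cV_VV_dim => M x 0)
  (Tcol (col (enum_val y).1) (col (enum_val y).2)).
rewrite !mxE => <-; rewrite (bigD1 y) //= big1 => [|k ky].
  by rewrite !mxE lval_mul // !lval_delta !eqxx !mulr1 addr0.
rewrite [X in _ * X]mxE lval_mul // !lval_delta.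
case: eqP => [/(can_inj colK) e1|]; last by rewrite !(mulr0, mul0r).
case: eqP => [/(can_inj colK) e2|]; last by rewrite !(mulr0, mul0r).
case/eqP: ky; apply: enum_val_inj.
by case: (enum_val y) (enum_val k) e1 e2 => [a b] [c d] /= -> ->.
Qed.

Lemma sigmaE : sigma q s = sigma_mx.
Proof.
apply: is_sigma_unique; apply: (epsilon_spec (inhabits 0) (is_sigma q s)).
by exists sigma_mx; apply: sigma_mxP.
Qed.

Lemma invmx_sigmaE : invmx (sigma q s) = mxf fsigmaV.
Proof.
rewrite sigmaE; have e : mxf fsigmaV *m sigma_mx = 1%:M.
  by rewrite -mxf_mul // -(mxf_one q0 s0); apply: mxf_eq; exact: fsigma_inv.
have [_ u] := mulmx1_unit e.
by rewrite -[LHS]mul1mx -e -mulmxA mulmxV // mulmx1.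
Qed.

End SigmaUnique.

(** * Closures of braids *)

Lemma words_size n w : (w \in words n) = (size w == n).
Proof.
apply/idP/eqP => [|<-]; last exact: mem_words.
elim: n w => [|n IH] w; first by rewrite inE => /eqP ->.
by case/allpairsP=> -[a x] /= [_ /IH <- ->].
Qed.

Lemma words_uniq n : uniq (words n).
Proof.
elim: n => // n IH; apply: allpairs_uniq => //.
by move=> [a x] [b y] _ _ [-> ->].
Qed.

Definition wd (s : seq 'I_4) : word := map col s.

Lemma size_wd n (t : n.-tuple 'I_4) : size (wd t) = n.
Proof. by rewrite size_map size_tuple. Qed.

Lemma nth_wd n (t : n.-tuple 'I_4) (l : 'I_n) : nth c0 (wd t) l = col (tnth t l).
Proof. by rewrite (nth_map 0) ?size_tuple // (tnth_nth 0). Qed.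

Lemma sum_words (R : nmodType) n (G : word -> R) :
  \sum_(w <- words n) G w = \sum_(t : n.-tuple 'I_4) G (wd t).
Proof.
rewrite -(big_map (fun t : n.-tuple 'I_4 => wd t) xpredT G).
apply: perm_big; apply: uniq_perm; first exact: words_uniq.
  rewrite map_inj_uniq; first exact: index_enum_uniq.
  by move=> t u /(inj_map (can_inj colK)) /val_inj.
move=> w; rewrite words_size; apply/eqP/mapP => [sw|[t _ ->]]; last first.
  by rewrite size_map size_tuple.
have st : size (map ord_of w) == n by rewrite size_map sw.
exists (Tuple st); first by rewrite mem_index_enum.
by rewrite /wd /= -map_comp map_id_in // => c _; rewrite /= ord_ofK.
Qed.

Definition ncups (j n : nat) : diagram := [seq (i, Cup true) | i <- iota j n].
Definition ncaps (n : nat) : diagram := [seq (i, Cap) | i <- rev (iota 0 n)].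
Definition band (n : nat) : seq bool := nseq n true ++ nseq n false.

Definition braid_events (k : nat) (b : braid k) : diagram :=
  [seq (nat_of_ord x.1, Cross x.2) | x <- b].

Lemma closureE k (b : braid k) :
  closure b = ncups 0 k.+1 ++ braid_events b ++ ncaps k.+1.
Proof. by []. Qed.

Lemma nseqSr (T : Type) n (x : T) : nseq n.+1 x = rcons (nseq n x) x.
Proof. by elim: n => //= n <-. Qed.

Lemma step_cup_band j : step (band j) (j, Cup true) = Some (band j.+1).
Proof.
rewrite /step /band size_cat !size_nseq leq_addr.
rewrite take_size_cat ?size_nseq // drop_size_cat ?size_nseq //.
by rewrite nseqSr -cats1 -!catA.
Qed.

Lemma step_cap_band j : step (band j.+1) (j, Cap) = Some (band j).
Proof.
rewrite /step /band nseqSr -cats1 -catA.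
by rewrite take_size_cat ?size_nseq // drop_size_cat ?size_nseq.
Qed.

Lemma run_ncups j n : run (band j) (ncups j n) = Some (band (j + n)).
Proof.
elim: n j => [|n IH] j; first by rewrite addn0.
by rewrite /ncups /= run_cons step_cup_band [obind _ _]IH addnS.
Qed.

Lemma ncapsS n : ncaps n.+1 = (n, Cap) :: ncaps n.
Proof. by rewrite /ncaps -addn1 iotaD rev_cat. Qed.

Lemma run_ncaps n : run (band n) (ncaps n) = Some [::].
Proof. by elim: n => // n IH; rewrite ncapsS run_cons step_cap_band. Qed.

Lemma run_braid k (b : braid k) st :
  run (nseq k.+1 true ++ st) (braid_events b) = Some (nseq k.+1 true ++ st).
Proof.
elim: b => // -[i c] b IH; rewrite /braid_events /= run_cons.
suff -> : step (nseq k.+1 true ++ st) (nat_of_ord i, Cross c)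
    = Some (nseq k.+1 true ++ st) by exact: IH.
have e : nseq k.+1 true = nseq i true ++ [:: true; true] ++ nseq (k.+1 - i - 2) true.
  rewrite -[[:: true; true]]/(nseq 2 true) -!nseqD; congr nseq.
  by have := ltn_ord i; lia.
rewrite e -!catA /step take_size_cat ?size_nseq // drop_size_cat ?size_nseq //.
Qed.

Lemma closure_link k (b : braid k) : link_diagram (closure b).
Proof.
rewrite /link_diagram closureE run_cat (run_ncups 0) /= run_cat.
by rewrite run_braid; exact: run_ncaps.
Qed.

Section BraidTrace.
Variables (F : fieldType) (q s : F).
Hypotheses (q0 : q != 0) (s0 : s != 0).
Lemma ev_cons st x st' D g w : step st x = Some st' ->
  ev q s st (x :: D) g w
  = sapply_at q s x.1 (event_table (drop x.1 st) x.2) (ev q s st' D g) w.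
Proof. by move=> h; cbn [ev]; rewrite h. Qed.

Local Notation lv := (lval q s).
Local Notation ev := (ev q s).
Local Notation unitf := (unitf F).

Lemma ev_ncups j n g w1 w2 : size w1 = j ->
  ev (band j) (ncups j n) g (w1 ++ w2)
  = \sum_(t <- words n) g (w1 ++ t ++ rev t ++ w2).
Proof.
elim: n j w1 w2 => [|n IH] j w1 w2 sw; first by rewrite big_seq1.
rewrite /ncups [iota _ _]/= map_cons (ev_cons _ _ _ (step_cup_band j)).
have -> : sapply_at q s j (cup_table true)
     (ev (band j.+1) (ncups j.+1 n) g) (w1 ++ w2)
   = \sum_(a <- colors) ev (band j.+1) (ncups j.+1 n) g (w1 ++ [:: a; a] ++ w2).
  rewrite -{1}[j]add0n -{1}sw sapply_at_catl /= !big_cons big_nil.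
  have e1 : tval q s (1, (0, 0))%bZ + 0 = 1 by exact: lval1.
  by rewrite !e1 !mul1r.
rewrite -[words n.+1]/(allpairs cons colors (words n)) big_allpairs_dep.
apply: eq_bigr => a _; rewrite -[[:: a; a] ++ w2]/([:: a] ++ a :: w2) catA IH.
  by apply: eq_bigr => t _; rewrite /= rev_cons cat_rcons -catA.
by rewrite size_cat sw addn1.
Qed.

Definition lmu (w : word) : F := \prod_(a <- w) lv (mu_l a).

Lemma ev_ncaps n u v : size u = n -> size v = n ->
  ev (band n) (ncaps n) unitf (u ++ v) = lmu u *+ (v == rev u).
Proof.
elim: n u v => [|n IH] u v.
  by move=> /size0nil -> /size0nil ->; rewrite /lmu big_nil.
case/lastP: u => // u x; case: v => // y v; rewrite size_rcons => -[su] [sv].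
rewrite ncapsS (ev_cons _ _ _ (step_cap_band n)).
have -> : event_table (drop n (band n.+1)) Cap = cap_table true.
  by rewrite /band nseqSr -cats1 -catA drop_size_cat ?size_nseq.
rewrite -{1}[n]add0n -{1}su cat_rcons sapply_at_catl.
have -> : sapply_at q s 0 (cap_table true)
    (fun w => ev (band n) (ncaps n) unitf (u ++ w)) [:: x, y & v]
  = lv (mu_l x) * ev (band n) (ncaps n) unitf (u ++ v) *+ (x == y).
  by case: x y => -[] /=; rewrite ?(addr0, add0r).
rewrite IH // rev_rcons eqseq_cons eq_sym /lmu big_rcons /= mulrC (eq_sym y).
by case: (x == y); case: (rev u == v); rewrite ?mulr0n ?mulr1n ?mulr0 ?mul0r.
Qed.

Hypotheses (q2 : q ^+ 2 != 1).
Hypotheses (ds0 : lv den_s != 0) (dqs0 : lv den_qs != 0) (dg0 : lv gen_den != 0).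

Lemma sapply_cross (b : bool) (S : 'M[F]_VV_dim) g x y w :
  S = mxf q s (ftable (cross_up b)) ->
  sapply q s (cross_up b) g [:: col x, col y & w]
  = \sum_(p : 'I_4 * 'I_4)
      S (enum_rank p) (enum_rank (x, y)) * g [:: col p.1, col p.2 & w].
Proof.
move=> ->; rewrite -[_ :: _]/([:: col x; col y] ++ w).
have ok : sizes_ok 2 2 (cross_up b) by case: (b).
rewrite (@sapply_same _ q s 2 2 (cross_up b) g [:: col x; col y] w ok erefl).
under [RHS]eq_bigr => p _ do rewrite !mxE !enum_rankK.
rewrite -(pair_bigA _ (fun i j => lv (ftable (cross_up b) (col i) (col j) (col x) (col y))
  * g [:: col i, col j & w])).
rewrite (sum_col (fun a => \sum_(j < 4)
  lv (ftable (cross_up b) a (col j) (col x) (col y)) * g [:: a, col j & w])).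
under [RHS]eq_bigr => a _ do
  rewrite (sum_col (fun c => lv (ftable (cross_up b) a c (col x) (col y))
  * g [:: a, c & w])).
rewrite /ftable; elim: (cross_up b) ok => [|[[u v] p] T IH] /=.
  by rewrite big_nil !big1 // => a _; rewrite big1 // => c _; rewrite mul0r.
case/andP=> /andP[_ sv] /IH {}IH; rewrite big_cons /= IH.
case: (u == _) => /=; last by [].
case: v sv => [|a0 [|b0 [|]]] // _.
have -> : \sum_(a <- colors) \sum_(c <- colors) lv (if [:: a0; b0] == [:: a; c]
      then ladd p (foldr (fun z r => if (z.1.1 == [:: col x; col y]) && (z.1.2 == [:: a; c])
             then ladd z.2 r else r) [::] T)
      else foldr (fun z r => if (z.1.1 == [:: col x; col y]) && (z.1.2 == [:: a; c])
             then ladd z.2 r else r) [::] T) * g [:: a, c & w]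
  = \sum_(a <- colors) \sum_(c <- colors) (lv p * g [:: a0, b0 & w] *+ ([:: a; c] == [:: a0; b0])
     + lv (foldr (fun z r => if (z.1.1 == [:: col x; col y]) && (z.1.2 == [:: a; c])
             then ladd z.2 r else r) [::] T) * g [:: a, c & w]).
  apply: eq_bigr => a _; apply: eq_bigr => c _; rewrite eq_sym.
  by case: eqP => [[-> ->]|_]; rewrite ?lval_add ?mulrDl ?add0r.
under [RHS]eq_bigr => a _ do rewrite big_split.
rewrite big_split /=; congr (_ + _).
by rewrite !big_cons !big_nil; case: a0 b0 => -[]; rewrite /= !(mulr0n, mulr1n, addr0, add0r).
Qed.

Definition set2 n (u : n.-tuple 'I_4) (j j' : 'I_n) (p : 'I_4 * 'I_4) :
    n.-tuple 'I_4 :=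
  [tuple if l == j then p.1 else if l == j' then p.2 else tnth u l | l < n].

Lemma wd_split k (i : 'I_k) (u : k.+1.-tuple 'I_4) :
  wd u = take i (wd u) ++ [:: col (tnth u (widen_ord (leqnSn k) i)),
    col (tnth u (lift ord0 i)) & drop i.+2 (wd u)].
Proof.
have si : (i.+1 < size (wd u))%N by rewrite size_map size_tuple ltnS ltn_ord.
rewrite -{1}(cat_take_drop i (wd u)) (drop_nth c0) ?(ltnW si) // (drop_nth c0 si).
congr (_ ++ _); congr [:: _, _ & _].
  by rewrite (nth_map 0) ?size_tuple 1?ltnW ?ltnS // (tnth_nth 0).
by rewrite (nth_map 0) ?size_tuple ?ltnS // (tnth_nth 0).
Qed.

Lemma wd_set2 k (i : 'I_k) (u : k.+1.-tuple 'I_4) p :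
  wd (set2 u (widen_ord (leqnSn k) i) (lift ord0 i) p)
  = take i (wd u) ++ [:: col p.1, col p.2 & drop i.+2 (wd u)].
Proof.
rewrite [LHS](wd_split i); congr (_ ++ _).
- apply: (@eq_from_nth _ c0); first by rewrite !size_take !size_wd.
  move=> l; have ik := ltnW (ltn_ord i); rewrite size_take size_wd ltnS ik => li.
  have lk : (l < k.+1)%N by rewrite (ltn_trans li).
  rewrite !nth_take // -[l]/(nat_of_ord (Ordinal lk)) !nth_wd tnth_mktuple -!val_eqE /=.
  by rewrite !ltn_eqF // (leq_trans li).
- congr [:: _, _ & _]; first by rewrite tnth_mktuple eqxx.
    by rewrite tnth_mktuple -val_eqE /= gtn_eqF // eqxx.
  apply: (@eq_from_nth _ c0); first by rewrite !size_drop !size_wd.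
  move=> l; rewrite size_drop size_wd => li.
  have lk : (i.+2 + l < k.+1)%N by lia.
  rewrite !nth_drop -[(i.+2 + l)%N]/(nat_of_ord (Ordinal lk)) !nth_wd tnth_mktuple.
  rewrite -!val_eqE /=.
  by rewrite !gtn_eqF // ?/bump /=; lia.
Qed.

Lemma sapply_act2 k (i : 'I_k) (b : bool) S g (u : k.+1.-tuple 'I_4) :
  S = mxf q s (ftable (cross_up b)) ->
  sapply_at q s i (cross_up b) g (wd u)
  = \sum_(t : k.+1.-tuple 'I_4)
      act2 i S (enum_rank t) (enum_rank u) * g (wd t).
Proof.
move=> eS; set j := widen_ord (leqnSn k) i; set j' := lift ord0 i.
have jj' : (j' == j) = false by rewrite -val_eqE /= gtn_eqF.
rewrite [in LHS](wd_split i).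
have zt : size (take i (wd u)) = i.
  by rewrite size_takel // size_wd ltnW // ltnS ltnW.
rewrite -{1}[nat_of_ord i]add0n -{1}zt sapply_at_catl /= (sapply_cross _ _ _ _ eS).
under [RHS]eq_bigr => t _ do rewrite mxE !enum_rankK.
rewrite [RHS](bigID (fun t : k.+1.-tuple 'I_4 =>
  [forall l, [|| l == j, l == j' | tnth t l == tnth u l]])) /=.
rewrite [X in _ + X]big1 ?addr0 => [|t /negPf nt]; last by rewrite nt mul0r.
(* The tuples that agree with [u] away from the two factors correspond to the pairs of colours
   placed there. *)
rewrite (reindex_onto (set2 u j j') (fun t => (tnth t j, tnth t j'))) /=.
  rewrite [RHS]big_mkcond; apply: eq_bigr => -[a c] _ /=.
  rewrite !tnth_mktuple !eqxx jj' eqxx andbT.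
  have -> : [forall l, [|| l == j, l == j' | tnth (set2 u j j' (a, c)) l == tnth u l]].
    apply/forallP => l; rewrite tnth_mktuple.
    by case: (l == j) => //=; case: (l == j') => //=; rewrite eqxx.
  by congr (_ * g _); rewrite -(wd_set2 i u (a, c)).
move=> t /forallP h; apply: eq_from_tnth => l; rewrite tnth_mktuple /=.
case: eqP => [->//|/eqP lj]; case: eqP => [->//|/eqP lj'].
by have := h l; rewrite (negPf lj) (negPf lj') /= => /eqP.
Qed.

Lemma psi_cons k x (b : braid k) :
  psi q s (x :: b)
  = psi q s b *m act2 x.1 (if x.2 then sigma q s else invmx (sigma q s)).
Proof.
rewrite /psi /= mulmx1; set A := act2 _ _.
have H (M : tpow_op F k.+1) : foldl (fun M x => act2 x.1
    (if x.2 then sigma q s else invmx (sigma q s)) *m M) M b = psi q s b *m M.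
  rewrite /psi -{1}[M]mul1mx; elim: b (1%:M) => [|y b IH] N //=.
  by rewrite mulmxA IH.
exact: H.
Qed.

Lemma ev_braid k (b : braid k) g (u : k.+1.-tuple 'I_4) :
  ev (nseq k.+1 true) (braid_events b) g (wd u)
  = \sum_(t : k.+1.-tuple 'I_4)
      psi q s b (enum_rank t) (enum_rank u) * g (wd t).
Proof.
elim: b u => [|[i c] b IH] u.
  rewrite (bigD1 u) //= big1 => [|t tu].
    by rewrite /psi /= mxE eqxx mul1r addr0.
  by rewrite /psi /= mxE (inj_eq enum_rank_inj) (negPf tu) mul0r.
have st : step (nseq k.+1 true) (nat_of_ord i, Cross c) = Some (nseq k.+1 true).
  have := run_braid [:: (i, c)] [::]; rewrite !cats0 run_cons.
  by case: step => //= st [->].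
have dr : drop i (nseq k.+1 true) = [:: true, true & nseq (k.+1 - i - 2) true].
  rewrite drop_nseq -[[:: _, _ & _]]/(nseq (k.+1 - i - 2).+2 true); congr nseq.
  by have := ltn_ord i; lia.
rewrite /braid_events map_cons (ev_cons _ _ _ st) dr /=.
rewrite (@sapply_act2 _ _ _ (if c then sigma q s else invmx (sigma q s))); last first.
  by case: c {st}; [rewrite sigmaE|rewrite invmx_sigmaE].
rewrite psi_cons /=.
under eq_bigr => t _ do rewrite [ev _ _ _ _]IH mulr_sumr.
rewrite exchange_big; apply: eq_bigr => t _.
rewrite mxE (reindex (@enum_rank {: k.+1.-tuple 'I_4})) /=; last first.
  by exists enum_val => x _; rewrite ?enum_valK ?enum_rankK.
by rewrite mulr_suml; apply: eq_bigr => v _; ring.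
Qed.

Lemma lval_mu (i : 'I_4) : lv (mu_l (col i)) = nth 0 (mu q s) i.
Proof.
have e1 : zval F 1%bZ = 1 by []; have eN : zval F (-1)%bZ = -1 by [].
by case: i => -[|[|[|[|//]]]] ?; rewrite /= /tval /= ?e1 ?eN addr0 ?expr0z
  ?mulN1r ?mul1r ?mulr1 ?mulNr.
Qed.

Lemma mu_neq0 a : lv (mu_l a) != 0.
Proof.
rewrite -[a]ord_ofK lval_mu; case: (ord_of a) => -[|[|[|[|//]]]] ?; rewrite /= ?oppr_eq0;
  by rewrite ?mulf_neq0 ?invr_eq0 ?expf_neq0.
Qed.

(** The words on the nested minima are the summation indices of the partial trace. The nested maxima
    put [mu] on each closed strand and once more on the strand that is cut. *)
Lemma ev_closure k (b : braid k) (x y : 'I_4) :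
  ev [:: true; false] (ncups 1 k ++ braid_events b ++ ncaps k.+1) unitf [:: col x; col y]
  = lv (mu_l (col y)) * ptrace (id_mu q s k *m psi q s b) y x.
Proof.
rewrite -[[:: true; false]]/(band 1) -[[:: col x; col y]]/([:: col x] ++ [:: col y]).
rewrite (ev_cat _ _ _ _ _ (run_ncups 1 k)) ev_ncups // add1n sum_words mxE mulr_sumr.
apply: eq_bigr => t _.
rewrite (ev_cat _ _ _ _ _ (run_braid b _)).
have -> : [:: col x] ++ wd t ++ rev (wd t) ++ [:: col y]
    = wd [tuple of x :: t] ++ rev (wd [tuple of y :: t]).
  by rewrite /= rev_cons -cats1.
have rb : run (nseq k.+1 true) (braid_events b) = Some (nseq k.+1 true).
  by have := run_braid b [::]; rewrite !cats0.
rewrite (ev_catr q0 s0 _ _ _ _ rb); last by rewrite size_wd size_nseq.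
rewrite ev_braid (bigD1 [tuple of y :: t]) //= big1 ?addr0 => [|t' tt'].
  rewrite [ev _ _ _ _](ev_ncaps (u := wd [tuple of y :: t])) ?size_rev ?size_wd //;
    last by rewrite /= size_wd.
  rewrite eqxx mulrb mxE (bigD1 (enum_rank [tuple of y :: t])) //= big1 => [|z zt].
    rewrite addr0 mxE eqxx; cbv zeta; rewrite mulrb enum_rankK /lmu /= big_cons mulrC -mulrA.
    congr (_ * (_ * _)); rewrite big_map big_tuple.
    by apply: eq_bigr => l _; rewrite lval_mu tnthS.
  by rewrite mxE; cbv zeta; rewrite mulrb [_ == z]eq_sym (negPf zt) mul0r.
rewrite [ev _ _ _ _](ev_ncaps (u := wd t')) ?size_rev ?size_wd //;
  last by rewrite /= size_wd.
rewrite (inj_eq (can_inj revK)) mulrb; case: (col y :: wd t =P wd t') => [e|_]; last by rewrite mulr0.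
by case/eqP: tt'; apply: val_inj; apply: (inj_map (can_inj colK)); exact: (esym e).
Qed.

(** By [pair_ev] the functional of the cut closure is a multiple of the cap, so the partial trace is
    a scalar matrix of itself. *)
Lemma ptrace_closure k (b : braid k) :
  ptrace (id_mu q s k *m psi q s b) = (Phi q s (closure b))%:M.
Proof.
apply/matrixP => y x; apply: (mulfI (mu_neq0 (col y))); rewrite -ev_closure.
have r : run [:: true; false] (ncups 1 k ++ braid_events b ++ ncaps k.+1) = Some [::].
  by have := closure_link b; rewrite /link_diagram closureE.
have capE a c : ev [:: true; false] [:: (0%N, Cap)] unitf [:: a; c]
    = lv (mu_l c) *+ (a == c).
  by case: a c => -[]; rewrite /= /unitf /= ?mulr1 ?addr0 ?add0r.
rewrite (pair_ev q0 s0 ds0 _ _ r) capE mxE (inj_eq (can_inj colK)) [x == y]eq_sym.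
by rewrite !mulrb; case: (y == x); rewrite ?mulr0 // mulrC.
Qed.

End BraidTrace.

(** * Every link diagram is isotopic to the closure of a braid *)

(** [isotopic] compares whole link diagrams. Here only the bottom row is prescribed, so the relation
    applies to pieces of a diagram and passes to contexts ([tiso_ctx]). *)
Inductive tstep (st : seq bool) : diagram -> diagram -> Prop :=
| TStep A B E E' st1 st2 : run st A = Some st1 -> move E E' ->
    run st1 E = Some st2 -> run st1 E' = Some st2 ->
    tstep st (A ++ E ++ B) (A ++ E' ++ B).

Definition tiso (st : seq bool) : diagram -> diagram -> Prop :=
  clos_refl_sym_trans diagram (tstep st).

Lemma tiso_refl st D : tiso st D D.
Proof. exact: rst_refl. Qed.
Lemma tiso_sym st D D' : tiso st D D' -> tiso st D' D.
Proof. exact: rst_sym. Qed.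
Lemma tiso_trans st D' D D'' : tiso st D D' -> tiso st D' D'' -> tiso st D D''.
Proof. exact: rst_trans. Qed.
#[global] Hint Resolve tiso_refl : core.

Lemma tiso_run st D D' : tiso st D D' -> run st D = run st D'.
Proof.
elim=> {D D'} [D D' [A B E E' st1 st2 rA _ rE rE']|//|//|D D' D'' _ -> _ ->//].
by rewrite !run_cat rA /= !run_cat rE rE'.
Qed.

Lemma tiso_ctx st A B st1 D D' : run st A = Some st1 -> tiso st1 D D' ->
  tiso st (A ++ D ++ B) (A ++ D' ++ B).
Proof.
move=> rA; elim=> {D D'} [D D' [A1 B1 E E' st2 st3 rA1 m rE rE']|D|D D' _|D D' D'' _ + _].
- have aux G : A ++ (A1 ++ G ++ B1) ++ B = (A ++ A1) ++ G ++ (B1 ++ B).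
    by rewrite -!catA.
  rewrite !aux; apply: rst_step.
  by apply: (TStep _ _ m rE rE'); rewrite run_cat rA.
- exact: tiso_refl.
- exact: tiso_sym.
- exact: tiso_trans.
Qed.

Lemma tiso_catl st A st1 D D' : run st A = Some st1 -> tiso st1 D D' ->
  tiso st (A ++ D) (A ++ D').
Proof. by move=> r /(tiso_ctx [::] r); rewrite !cats0. Qed.

Lemma tiso_catr st D D' B : tiso st D D' -> tiso st (D ++ B) (D' ++ B).
Proof. exact: (@tiso_ctx st [::]). Qed.

Lemma tiso_cons st x st1 D D' : step st x = Some st1 -> tiso st1 D D' ->
  tiso st (x :: D) (x :: D').
Proof. by move=> r; apply: (@tiso_catl st [:: x]); rewrite run_cons r. Qed.

Lemma tiso_isotopic D D' : link_diagram D -> tiso [::] D D' -> isotopic D D'.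
Proof.
move=> + h; elim: h => {D D'} [D D' h l|D _|D D' h IH l|D D' D'' h1 I1 h2 I2 l].
- have r := tiso_run (rst_step _ _ _ _ h); apply: rst_step.
  case: h l r => A B E E' st1 st2 _ m _ _ l r.
  by apply: LocalMove => //; rewrite /link_diagram -r.
- exact: rst_refl.
- by apply: rst_sym; apply: IH; rewrite /link_diagram (tiso_run h).
- apply: rst_trans (I1 l) (I2 _).
  by rewrite /link_diagram -(tiso_run h1).
Qed.

Lemma move_shift j D D' : move D D' -> move (shift j D) (shift j D').
Proof.
have e i k : ((i + k + j) = i + j + k)%N by lia.
by case=> *; rewrite /shift /= ?addSn ?e; constructor.
Qed.

Lemma tiso_shift st1 st D D' : tiso st D D' ->
  tiso (st1 ++ st) (shift (size st1) D) (shift (size st1) D').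
Proof.
elim=> {D D'} [D D' [A B E E' st2 st3 rA m rE rE']|D|D D' _|D D' D'' _ + _].
- rewrite /shift !map_cat -![map _ _]/(shift (size st1) _).
  apply: rst_step; apply: TStep (move_shift _ m) _ _; first by rewrite run_shift rA.
    by rewrite run_shift rE.
  by rewrite run_shift rE'.
- exact: tiso_refl.
- exact: tiso_sym.
- exact: tiso_trans.
Qed.

Lemma tiso_move st E E' st2 : move E E' -> run st E = Some st2 ->
  run st E' = Some st2 -> tiso st E E'.
Proof.
move=> m r r'; rewrite -[E]cats0 -[E']cats0; apply: rst_step.
exact: (@TStep st [::] [::] E E' st st2).
Qed.

Lemma distant_run st k e e' x :
  run st [:: (0, e); (legs_out e + k, e')]%N = Some x <->
  run st [:: (legs_in e + k, e'); (0, e)]%N = Some x.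
Proof.
have one s1 s2 s1' s2' : size s1 = legs_in e -> size s1' = legs_out e ->
    step s1 (0%N, e) = Some s1' -> step s2 (k, e') = Some s2' ->
    run (s1 ++ s2) [:: (0, e); (legs_out e + k, e')]%N = Some (s1' ++ s2') /\
    run (s1 ++ s2) [:: (legs_in e + k, e'); (0, e)]%N = Some (s1' ++ s2').
  move=> z z' r r2; rewrite !run_cons (step_catr _ r) /= run_cons.
  rewrite -z' (addnC (size s1')) step_shift r2 /= -z (addnC (size s1)) step_shift r2.
  by rewrite /= run_cons (step_catr _ r).
rewrite !run_cons; split.
- case E: step => [st1|] //=.
  have [s1 [s2 [s1' [es z1 z1' es' r1]]]] := step0_split E; subst st st1.
  rewrite run_cons -{1}z1' (addnC (size s1')) step_shift; case E2: step => [s2'|] //= [<-].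
  by have [_ h] := one _ _ _ _ z1 z1' r1 E2; rewrite run_cons in h.
- case E: step => [st1|] //=; have [le _] := step_size E.
  have z : size (take (legs_in e) st) = legs_in e by rewrite size_takel //; lia.
  move: E; rewrite -{1}z -{1}(cat_take_drop (legs_in e) st) (addnC (size _)) step_shift.
  case E2: step => [s2'|] //= [<-]; rewrite run_cons; case E: step => [st2|] //= [<-].
  have [s1 [s2 [s1' [es z1 z1' es' r1]]]] := step0_split E.
  have /eqP := es; rewrite eqseq_cat ?z ?z1 // => /andP[/eqP e1 /eqP e2]; subst s2.
  rewrite -e1 in r1; rewrite es'.
  by have [h _] := one _ _ _ _ z z1' r1 E2; rewrite cat_take_drop run_cons in h.
Qed.

Lemma distant_run_at st i k e e' x :
  run st [:: (i, e); (i + legs_out e + k, e')]%N = Some x <->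
  run st [:: (i + legs_in e + k, e'); (i, e)]%N = Some x.
Proof.
have [le|lt] := leqP i (size st); last first.
  by rewrite !run_cons; split; case E: step => [st1|] //; have [] := step_size E; lia.
have sh D : run st (shift i D) = omap (cat (take i st)) (run (drop i st) D).
  by rewrite -{1}(cat_take_drop i st) -{3}(size_takel le) run_shift.
have -> : [:: (i, e); (i + legs_out e + k, e')]%N
    = shift i [:: (0, e); (legs_out e + k, e')]%N.
  by congr [:: (_, _); (_, _)] => /=; lia.
have -> : [:: (i + legs_in e + k, e'); (i, e)]%N
    = shift i [:: (legs_in e + k, e'); (0, e)]%N.
  by congr [:: (_, _); (_, _)] => /=; lia.
rewrite !sh; split; case E: run => [y|] //= [<-].
  by rewrite ((distant_run _ _ _ _ _).1 E).
by rewrite ((distant_run _ _ _ _ _).2 E).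
Qed.

(* Distant events, the leftmost one first (resp. last) on the left. *)
Lemma tiso_distant st i j j' e e' B :
  (i + legs_out e <= j)%N -> (j + legs_in e = j' + legs_out e)%N ->
  run st [:: (i, e); (j, e')] <> None ->
  tiso st [:: (i, e), (j, e') & B] [:: (j', e'), (i, e) & B].
Proof.
move=> le ej; case R: run => [x|] // _.
suff c : tiso st [:: (i, e); (j, e')] [:: (j', e'); (i, e)] by exact: (tiso_catr B c).
have ek : j = (i + legs_out e + (j - (i + legs_out e)))%N by lia.
have ek' : j' = (i + legs_in e + (j - (i + legs_out e)))%N by lia.
rewrite ek' {1}ek; apply: tiso_move (move_distant _ _ _ _) _ _.
  by rewrite -ek; exact: R.
by apply/distant_run_at; rewrite -ek; exact: R.
Qed.

Lemma tiso_distant' st i j j' e e' B :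
  (i + legs_in e <= j')%N -> (j + legs_in e = j' + legs_out e)%N ->
  run st [:: (j', e'); (i, e)] <> None ->
  tiso st [:: (j', e'), (i, e) & B] [:: (i, e), (j, e') & B].
Proof.
move=> le ej; case R: run => [x|] // _; apply: tiso_sym; apply: tiso_distant; try lia.
have ek : j = (i + legs_out e + (j' - (i + legs_in e)))%N by lia.
have h := (distant_run_at st i (j' - (i + legs_in e)) e e' x).2.
by rewrite ek h // -R; congr run; congr [:: (_, _); _]; lia.
Qed.

Lemma tmove st A B E E' st1 st2 : move E E' -> run st A = Some st1 ->
  run st1 E = Some st2 -> run st1 E' = Some st2 ->
  tiso st (A ++ E ++ B) (A ++ E' ++ B).
Proof. by move=> m rA rE rE'; apply: rst_step; apply: TStep rA m rE rE'. Qed.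

Lemma tiso_extend st st2 D D' : tiso st D D' -> tiso (st ++ st2) D D'.
Proof.
elim=> {D D'} [D D' [A B E E' st3 st4 rA m rE rE']|D|D D' _|D D' D'' _ + _].
- by apply: (tmove _ m (run_catr _ rA)) (run_catr _ rE) (run_catr _ rE').
- exact: tiso_refl.
- exact: tiso_sym.
- exact: tiso_trans.
Qed.

Lemma tiso_local st1 st st2 D D' : tiso st D D' ->
  tiso (st1 ++ st ++ st2) (shift (size st1) D) (shift (size st1) D').
Proof. by move=> h; apply: tiso_shift; apply: tiso_extend. Qed.

(* In a good crossing the strands are parallel or the downward one is over. *)
Definition good (st : seq bool) (i : nat) (b : bool) : bool :=
  (nth true st i == nth true st i.+1) || (b == nth true st i.+1).

(** In a word of good crossings the downward strands run over all upward ones, so they can be pulled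
    off to the right. The flag [c] admits maxima, for the stage at which only the minima have been
    moved away. *)
Fixpoint goodX (c : bool) (st : seq bool) (D : diagram) : bool :=
  if D is (i, e) :: D' then
    if step st (i, e) is Some st' then
      match e with Cup _ => false | Cap => c | Cross b => good st i b end
      && goodX c st' D'
    else false
  else true.

Lemma goodX_cat c st A B st1 : run st A = Some st1 ->
  goodX c st (A ++ B) = goodX c st A && goodX c st1 B.
Proof.
elim: A st => [|[i e] A IH] st /=; first by case=> ->.
rewrite run_cons; case: step => //= st2 r; by rewrite (IH st2) // andbA.
Qed.

Lemma goodX_size st D st' : goodX false st D -> run st D = Some st' ->
  size st' = size st.
Proof.
elim: D st => [|[i e] D IH] st /=; first by move=> _ [->].
rewrite run_cons; case E: step => [st1|] //= /andP[ge gD] r.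
rewrite (IH _ gD r); have [_] := step_size E.
by case: e ge {E} => //= b _; lia.
Qed.

Lemma goodX_weak c st D : goodX false st D -> goodX c st D.
Proof.
elim: D st => //= -[i e] D IH st; case: step => // st1 /andP[ge /IH ->].
by rewrite andbT; case: e ge.
Qed.

Lemma goodX_extend c st st2 D : goodX c st D -> goodX c (st ++ st2) D.
Proof.
elim: D st => //= -[i e] D IH st; case E: step => [st1|] // /andP[ge gD].
rewrite (step_catr _ E) IH // andbT; case: e ge E => // b; rewrite /good => g E.
by have [/= le _] := step_size E; rewrite !nth_cat !ifT //; lia.
Qed.

Lemma goodX_shift c st1 st D : goodX c st D ->
  goodX c (st1 ++ st) (shift (size st1) D).
Proof.
elim: D st => //= -[i e] D IH st; rewrite step_shift; case: step => //= st2.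
case/andP=> ge /IH ->; rewrite andbT; case: e ge => // b.
by rewrite /good !nth_cat !ifN ?addKn -?leqNgt ?leq_addl ?addnK ?leqW ?leq_addl // -addSn addnK.
Qed.

(** * Sliding minima and maxima across other strands *)

Definition ins (i : nat) (st : seq bool) : seq bool :=
  take i st ++ [:: true; false] ++ drop i st.

Lemma step_cup i st : (i <= size st)%N -> step st (i, Cup true) = Some (ins i st).
Proof. by rewrite /step => ->. Qed.

Lemma step_ins i st : (i <= size st)%N -> step (ins i st) (i, Cap) = Some st.
Proof.
move=> le; rewrite /step /ins take_size_cat ?size_takel //.
by rewrite drop_size_cat ?size_takel //= cat_take_drop.
Qed.

Lemma ins_split st1 st x :
  ins (size st1) (st1 ++ x :: st) = st1 ++ [:: true, false, x & st] /\
  ins (size st1).+1 (st1 ++ x :: st) = st1 ++ [:: x, true, false & st].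
Proof.
split; first by rewrite /ins take_size_cat // drop_size_cat.
rewrite -(size_rcons st1 x) -cat_rcons /ins take_size_cat // drop_size_cat //.
by rewrite cat_rcons.
Qed.

(** A minimum passes over an upward strand and under a downward one, so that the leg antiparallel to
    the strand meets it in a good crossing. The other slides of minima and maxima obey the same
    rule. *)
Lemma slide_cup_right x :
  tiso [:: x] [:: (0, Cup true)]%N
    [:: (1, Cup true); (0, Cross (~~ x)); (1, Cross (~~ x))]%N.
Proof.
apply: tiso_sym; apply: (tiso_trans (D' := [:: (0, Cup true); (1, Cross x); (1, Cross (~~ x))]%N)).
  by case: x; apply: tiso_sym;
    [exact: (@tmove [:: true] [::] [:: _] _ _ _ _ (move_slide_cup 0 true true) erefl erefl erefl)
    |exact: (@tmove [:: false] [::] [:: _] _ _ _ _ (move_slide_cup 0 true false) erefl erefl erefl)].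
exact: (@tmove [:: x] [:: (0, Cup true)]%N [::] _ _ _ _ (move_R2 1 x) erefl erefl erefl).
Qed.

Lemma slide_cup_left x :
  tiso [:: x] [:: (1, Cup true)]%N
    [:: (0, Cup true); (1, Cross x); (0, Cross x)]%N.
Proof.
apply: tiso_sym; apply: (tiso_trans (D' := [:: (1, Cup true); (0, Cross (~~ x)); (0, Cross x)]%N)).
  by case: x;
    [exact: (@tmove [:: true] [::] [:: _] _ _ _ _ (move_slide_cup 0 true true) erefl erefl erefl)
    |exact: (@tmove [:: false] [::] [:: _] _ _ _ _ (move_slide_cup 0 true false) erefl erefl erefl)].
by case: x;
  [exact: (@tmove [:: _] [:: (1, Cup true)]%N [::] _ _ _ _ (move_R2 0 false) erefl erefl erefl)
  |exact: (@tmove [:: _] [:: (1, Cup true)]%N [::] _ _ _ _ (move_R2 0 true) erefl erefl erefl)].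
Qed.

Lemma slide_cap_right x :
  tiso [:: true; false; x] [:: (0, Cap)]%N
    [:: (1, Cross x); (0, Cross x); (1, Cap)]%N.
Proof.
apply: tiso_sym; apply: (tiso_trans (D' := [:: (1, Cross x); (1, Cross (~~ x)); (0, Cap)]%N)).
  apply: tiso_sym; case: x;
  [exact: (@tmove [:: true; false; true] [:: (1, Cross true)]%N [::] _ _ _ _ (move_slide_cap 0 false) erefl erefl erefl)
  |exact: (@tmove [:: true; false; false] [:: (1, Cross false)]%N [::] _ _ _ _ (move_slide_cap 0 true) erefl erefl erefl)].
by case: x;
  [exact: (@tmove [:: true; false; true] [::] [:: _] _ _ _ _ (move_R2 1 true) erefl erefl erefl)
  |exact: (@tmove [:: true; false; false] [::] [:: _] _ _ _ _ (move_R2 1 false) erefl erefl erefl)].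
Qed.

Lemma slide_cap_left x :
  tiso [:: x; true; false] [:: (1, Cap)]%N
    [:: (0, Cross (~~ x)); (1, Cross (~~ x)); (0, Cap)]%N.
Proof.
apply: tiso_sym; apply: (tiso_trans (D' := [:: (0, Cross (~~ x)); (0, Cross x); (1, Cap)]%N)).
  case: x;
  [exact: (@tmove [:: true; true; false] [:: (0, Cross false)]%N [::] _ _ _ _ (move_slide_cap 0 false) erefl erefl erefl)
  |exact: (@tmove [:: false; true; false] [:: (0, Cross true)]%N [::] _ _ _ _ (move_slide_cap 0 true) erefl erefl erefl)].
by case: x;
  [exact: (@tmove [:: true; true; false] [::] [:: _] _ _ _ _ (move_R2 0 false) erefl erefl erefl)
  |exact: (@tmove [:: false; true; false] [::] [:: _] _ _ _ _ (move_R2 0 true) erefl erefl erefl)].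
Qed.

(* A bad crossing is a rotated crossing of parallel strands. *)
Lemma bad_crossing o :
  tiso [:: o; ~~ o] [:: (0, Cross o)]%N
    [:: (0, Cup (~~ o)); (1, Cross (~~ o)); (2, Cap)]%N.
Proof.
apply: tiso_sym; apply: (tiso_trans (D' := [:: (1, Cup (~~ o)); (0, Cross o); (2, Cap)]%N)).
  by case: o;
  [exact: (@tmove [:: true; false] [::] [:: _] _ _ _ _ (move_slide_cup 0 false false) erefl erefl erefl)
  |exact: (@tmove [:: false; true] [::] [:: _] _ _ _ _ (move_slide_cup 0 true true) erefl erefl erefl)].
apply: (tiso_trans (D' := [:: (1, Cup (~~ o)); (2, Cap); (0, Cross o)]%N)).
  by case: o;
  [exact: (@tmove [:: true; false] [:: (1, Cup false)]%N [::] _ _ _ _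
    (move_distant 0 0 (Cross true) Cap) erefl erefl erefl)
  |exact: (@tmove [:: false; true] [:: (1, Cup true)]%N [::] _ _ _ _
    (move_distant 0 0 (Cross false) Cap) erefl erefl erefl)].
by case: o;
  [exact: (@tmove [:: true; false] [::] [:: _] _ _ _ _ (move_zigzag_r 1 false) erefl erefl erefl)
  |exact: (@tmove [:: false; true] [::] [:: _] _ _ _ _ (move_zigzag_r 1 true) erefl erefl erefl)].
Qed.

Lemma cup_to st i j : (i <= size st)%N -> (j <= size st)%N ->
  exists2 W, tiso st [:: (i, Cup true)] ((j, Cup true) :: W) & goodX false (ins j st) W.
Proof.
have trans a b c W W' : (b <= size st)%N -> (c <= size st)%N ->
    tiso st [:: (a, Cup true)] ((b, Cup true) :: W) -> goodX false (ins b st) W ->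
    tiso st [:: (b, Cup true)] ((c, Cup true) :: W') -> goodX false (ins c st) W' ->
    tiso st [:: (a, Cup true)] ((c, Cup true) :: W' ++ W)
    /\ goodX false (ins c st) (W' ++ W).
  move=> lb lc t1 g1 t2 g2; split.
    apply: tiso_trans t1 _; exact: (tiso_catr W t2).
  have := tiso_run t2; rewrite !run_cons !step_cup //= => /esym r.
  by rewrite (goodX_cat _ _ r) g2.
have split_at a : (a < size st)%N -> exists st1 x st2,
    st = st1 ++ x :: st2 /\ size st1 = a.
  move=> la; exists (take a st), (nth true st a), (drop a.+1 st).
  by rewrite -drop_nth // cat_take_drop size_takel // ltnW.
have right a : (a < size st)%N -> exists2 W,
    tiso st [:: (a, Cup true)] ((a.+1, Cup true) :: W) & goodX false (ins a.+1 st) W.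
  move=> /split_at[st1 [x [st2 [-> <-]]]].
  exists (shift (size st1) [:: (0, Cross (~~ x)); (1, Cross (~~ x))]%N).
    exact: (tiso_local st1 st2 (slide_cup_right x)).
  rewrite (ins_split _ _ _).2; apply: goodX_shift.
  by apply: (@goodX_extend _ [:: x; true; false]); case: (x).
have left a : (a < size st)%N -> exists2 W,
    tiso st [:: (a.+1, Cup true)] ((a, Cup true) :: W) & goodX false (ins a st) W.
  move=> /split_at[st1 [x [st2 [-> <-]]]].
  exists (shift (size st1) [:: (1, Cross x); (0, Cross x)]%N).
    exact: (tiso_local st1 st2 (slide_cup_left x)).
  rewrite (ins_split _ _ _).1; apply: goodX_shift.
  by apply: (@goodX_extend _ [:: true; false; x]); case: (x).
have up a n : (a + n <= size st)%N -> exists2 W,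
    tiso st [:: (a, Cup true)] (((a + n)%N, Cup true) :: W) & goodX false (ins (a + n) st) W.
  elim: n => [|n IH] le; first by rewrite addn0; exists [::].
  have [|W t1 g1] := IH; first by lia.
  have [|W' t2 g2] := right (a + n)%N; first by lia.
  rewrite addnS; have [||t g] := trans _ _ _ _ _ _ _ t1 g1 t2 g2; try lia.
  by exists (W' ++ W).
have down a n : (a + n <= size st)%N -> exists2 W,
    tiso st [:: ((a + n)%N, Cup true)] ((a, Cup true) :: W) & goodX false (ins a st) W.
  elim: n => [|n IH] le; first by rewrite addn0; exists [::].
  have [|W t1 g1] := IH; first by lia.
  have [|W' t2 g2] := left (a + n)%N; first by lia.
  rewrite addnS; have [||t g] := trans _ _ _ _ _ _ _ t2 g2 t1 g1; try lia.
  by exists (W ++ W').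
move=> li lj; case: (leqP i j) => le.
  have e : (i + (j - i) = j)%N by lia.
  by have := up i (j - i)%N; rewrite e => /(_ lj).
have e : (j + (i - j) = i)%N by lia.
by have := down j (i - j)%N; rewrite e => /(_ li).
Qed.

Lemma cap_to st i j : (i <= size st)%N -> (j <= size st)%N ->
  exists W, [/\ tiso (ins i st) [:: (i, Cap)] (W ++ [:: (j, Cap)]),
    goodX false (ins i st) W & run (ins i st) W = Some (ins j st)].
Proof.
have trans a b c W W' : tiso (ins a st) [:: (a, Cap)] (W ++ [:: (b, Cap)]) ->
    goodX false (ins a st) W -> run (ins a st) W = Some (ins b st) ->
    tiso (ins b st) [:: (b, Cap)] (W' ++ [:: (c, Cap)]) -> goodX false (ins b st) W' ->
    run (ins b st) W' = Some (ins c st) ->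
    [/\ tiso (ins a st) [:: (a, Cap)] ((W ++ W') ++ [:: (c, Cap)]),
      goodX false (ins a st) (W ++ W') & run (ins a st) (W ++ W') = Some (ins c st)].
  move=> t1 g1 r t2 g2 r2; split; first last.
  - by rewrite run_cat r.
  - by rewrite (goodX_cat _ _ r) g1.
  rewrite -catA; apply: tiso_trans t1 _; exact: (tiso_catl r t2).
have split_at a : (a < size st)%N -> exists st1 x st2,
    st = st1 ++ x :: st2 /\ size st1 = a.
  move=> la; exists (take a st), (nth true st a), (drop a.+1 st).
  by rewrite -drop_nth // cat_take_drop size_takel // ltnW.
have right a : (a < size st)%N -> exists W,
    [/\ tiso (ins a st) [:: (a, Cap)] (W ++ [:: (a.+1, Cap)]),
        goodX false (ins a st) W & run (ins a st) W = Some (ins a.+1 st)].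
  move=> /split_at[st1 [x [st2 [-> <-]]]].
  exists (shift (size st1) [:: (1, Cross x); (0, Cross x)]%N).
  rewrite (ins_split _ _ _).1 (ins_split _ _ _).2; split.
  - exact: (tiso_local st1 st2 (slide_cap_right x)).
  - by apply: goodX_shift; apply: (@goodX_extend _ [:: true; false; x]); case: (x).
  - by rewrite run_shift; have -> := @run_catr [:: true; false; x] st2
      [:: (1, Cross x); (0, Cross x)]%N _ erefl.
have left a : (a < size st)%N -> exists W,
    [/\ tiso (ins a.+1 st) [:: (a.+1, Cap)] (W ++ [:: (a, Cap)]),
        goodX false (ins a.+1 st) W & run (ins a.+1 st) W = Some (ins a st)].
  move=> /split_at[st1 [x [st2 [-> <-]]]].
  exists (shift (size st1) [:: (0, Cross (~~ x)); (1, Cross (~~ x))]%N).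
  rewrite (ins_split _ _ _).1 (ins_split _ _ _).2; split.
  - exact: (tiso_local st1 st2 (slide_cap_left x)).
  - by apply: goodX_shift; apply: (@goodX_extend _ [:: x; true; false]); case: (x).
  - by rewrite run_shift; have -> := @run_catr [:: x; true; false] st2
      [:: (0, Cross (~~ x)); (1, Cross (~~ x))]%N _ erefl.
have up a n : (a + n <= size st)%N -> exists W,
    [/\ tiso (ins a st) [:: (a, Cap)] (W ++ [:: ((a + n)%N, Cap)]),
      goodX false (ins a st) W & run (ins a st) W = Some (ins (a + n) st)].
  elim: n a => [|n IH] a le; first by rewrite addn0; exists [::].
  have [|W [t1 g1 r1]] := right a; first by lia.
  have [|W' [t2 g2 r2]] := IH a.+1; first by lia.
  rewrite addSnnS in t2 r2; have [t g r] := trans _ _ _ _ _ t1 g1 r1 t2 g2 r2.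
  by exists (W ++ W').
have down a n : (a + n <= size st)%N -> exists W,
    [/\ tiso (ins (a + n) st) [:: ((a + n)%N, Cap)] (W ++ [:: (a, Cap)]),
      goodX false (ins (a + n) st) W & run (ins (a + n) st) W = Some (ins a st)].
  elim: n => [|n IH] le; first by rewrite addn0; exists [::].
  have [|W [t1 g1 r1]] := IH; first by lia.
  have [|W' [t2 g2 r2]] := left (a + n)%N; first by lia.
  rewrite addnS; have [t g r] := trans _ _ _ _ _ t2 g2 r2 t1 g1 r1.
  by exists (W' ++ W).
move=> li lj; case: (leqP i j) => le.
  have e : (i + (j - i) = j)%N by lia.
  by have := up i (j - i)%N; rewrite e => /(_ lj).
have e : (j + (i - j) = i)%N by lia.
by have := down j (i - j)%N; rewrite e => /(_ li).
Qed.

(** Double induction: each event of [W] is carried past all of [E], one distant move at a time. *)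
Lemma interchange sa sa1 sb sb1 W E : run sa W = Some sa1 -> run sb E = Some sb1 ->
  tiso (sa ++ sb) (W ++ shift (size sa1) E) (shift (size sa) E ++ W).
Proof.
have one i e j e' s1 s1' s2 s2' : step s1 (i, e) = Some s1' -> step s2 (j, e') = Some s2' ->
    tiso (s1 ++ s2) [:: (i, e); (j + size s1', e')%N] [:: (j + size s1, e')%N; (i, e)].
  move=> h1 h2; have [le sz] := step_size h1.
  apply: tiso_distant; try lia.
  by rewrite run_cons (step_catr _ h1) /= run_cons step_shift h2.
elim: W sa => [|[i e] W IH] sa /=; first by case=> -> _; rewrite cats0.
rewrite run_cons; case h: step => [s1|] //= rW rE.
apply: tiso_trans (tiso_cons (step_catr _ h) (IH _ rW rE)) _.
elim: E sb rE {IH} => [|[j e'] E IHE] sb //.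
rewrite run_cons; case h2: step => [s2|] //= rE.
apply: tiso_trans (tiso_catr _ (one _ _ _ _ _ _ _ _ h h2)) _.
have st2 : step (sa ++ sb) ((j + size sa)%N, e') = Some (sa ++ s2).
  by rewrite step_shift h2.
exact: (tiso_cons st2 (IHE _ rE)).
Qed.

(** * Gathering the minima at the bottom *)

Lemma ncups_shift n k : ncups n k = shift n (ncups 0 k).
Proof.
rewrite /ncups /shift -map_comp -{1}[n]addn0 iotaDl -map_comp.
by apply: eq_map => i /=; rewrite addnC.
Qed.

Lemma run_ncups_end st k : run st (ncups (size st) k) = Some (st ++ band k).
Proof.
by rewrite ncups_shift -{1}[st]cats0 run_shift (run_ncups 0).
Qed.

(** The minima open to the right of all strands present, so the events with which they are exchanged
    keep their positions. *)
Definition cups_first (st : seq bool) (D : diagram) : Prop :=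
  exists k X, tiso st D (ncups (size st) k ++ X) /\ goodX true (st ++ band k) X.

Lemma cups_first_iso st D D' : tiso st D D' -> cups_first st D' -> cups_first st D.
Proof.
by move=> t [k [X [t' g]]]; exists k, X; split=> //; apply: tiso_trans t t'.
Qed.

Lemma cups_first_step st i e st1 D : step st (i, e) = Some st1 ->
  match e with Cup _ => false | Cap => true | Cross b => good st i b end ->
  cups_first st1 D -> cups_first st ((i, e) :: D).
Proof.
move=> h ge [k [X [t g]]]; exists k, ((i, e) :: X); split.
  apply: tiso_trans (tiso_cons h t) _.
  have r1 : run st [:: (i, e)] = Some st1 by rewrite run_cons h.
  have := interchange r1 (run_ncups_end [::] k).
  rewrite cats0 -!ncups_shift => /(tiso_catr X); rewrite -!catA; exact.
rewrite /= (step_catr _ h) g andbT; case: e ge h => // b; rewrite /good => gb h.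
by have [/= le _] := step_size h; rewrite !nth_cat !ifT //; lia.
Qed.

Lemma ins_size st : ins (size st) st = st ++ [:: true; false].
Proof. by rewrite /ins take_size drop_size. Qed.

Lemma ins_band st k : ins (size st + k) (st ++ band k) = st ++ band k.+1.
Proof.
have z : size (st ++ nseq k true) = (size st + k)%N by rewrite size_cat size_nseq.
have -> : st ++ band k = (st ++ nseq k true) ++ nseq k false by rewrite /band catA.
by rewrite /ins -z take_size_cat // drop_size_cat // /band nseqSr -cats1 -!catA.
Qed.

(** The new minimum is moved to the right end of the row, exchanged there with the other minima, and
    pushed into the centre of their nest. Only good crossings are created on the way. *)
Lemma cups_first_cup st i D : (i <= size st)%N ->
  cups_first (ins i st) D -> cups_first st ((i, Cup true) :: D).
Proof.
move=> le [k [X [t g]]]; have h := step_cup le.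
have [W tW gW] := cup_to le (leqnn (size st)).
have rW : run (st ++ [:: true; false]) W = Some (ins i st).
  by have := tiso_run tW; rewrite !run_cons h step_cup // ins_size /= => <-.
have lb : (size st + k <= size (st ++ band k))%N.
  by rewrite size_cat /band size_cat !size_nseq; lia.
have [W1 t1 g1] := cup_to (leq_trans (leq_addr _ _) lb) lb.
exists k.+1, (W1 ++ W ++ X); split.
  have -> : ncups (size st) k.+1 = ncups (size st) k ++ [:: ((size st + k)%N, Cup true)].
    by rewrite /ncups -addn1 iotaD map_cat.
  apply: tiso_trans (tiso_cons h t) _.
  rewrite -[_ :: _]/([:: (i, Cup true)] ++ _).
  apply: tiso_trans (tiso_catr _ tW) _.
  have := interchange rW (run_ncups_end [::] k); rewrite cats0 -!ncups_shift => t2.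
  have hn := step_cup (leqnn (size st)); rewrite ins_size in hn.
  rewrite catA -[((_ :: W) ++ _) ++ X]/((_ :: W ++ _) ++ X).
  apply: tiso_trans (tiso_catr X (tiso_cons hn t2)) _.
  have r1 : run st [:: (size st, Cup true)] = Some (st ++ [:: true; false]).
    by rewrite run_cons hn.
  have := interchange r1 (run_ncups_end [::] k); rewrite cats0 -!ncups_shift => t3.
  rewrite /= -catA -cat_cons -cat1s.
  apply: tiso_trans (tiso_catr _ t3) _; rewrite -catA.
  have := tiso_catl (run_ncups_end st k) t1 => /(tiso_catr (W ++ X)).
  rewrite -catA => t4; apply: tiso_trans t4 _.
  by rewrite -!catA.
rewrite ins_band in g1.
have r1 : run (st ++ band k.+1) W1 = Some ((st ++ [:: true; false]) ++ band k).
  have := tiso_run t1; rewrite !run_cons step_cup ?(leq_trans (leq_addr _ _) lb) //.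
  rewrite step_cup // ins_band /= => <-.
  by rewrite /ins take_size_cat // drop_size_cat // -catA.
rewrite (goodX_cat _ _ r1) goodX_weak //= (goodX_cat _ _ (run_catr _ rW)) g andbT.
by rewrite ins_size in gW; apply: goodX_extend; apply: goodX_weak.
Qed.

(** Of the two possible kinks this is the one whose crossing is good. *)
Lemma flip_cup st i : (i <= size st)%N ->
  tiso st [:: (i, Cup false)] [:: (i, Cup true); (i, Cross false)].
Proof.
move=> le; rewrite -{1}(cat_take_drop i st) -{3 4 5}(size_takel le).
apply: (tiso_shift (take i st) (D := [:: (0, Cup false)]%N)
  (D' := [:: (0, Cup true); (0, Cross false)]%N)).
apply: (@tiso_extend [::] (drop i st)); apply: tiso_sym.
exact: (@tmove [::] [::] [::] _ _ _ _ (move_R1_cup 0 true false) erefl erefl erefl).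
Qed.

Lemma cups_first_any st i o st1 D : step st (i, Cup o) = Some st1 ->
  cups_first st1 D -> cups_first st ((i, Cup o) :: D).
Proof.
move=> h IH; have [le _] := step_size h; rewrite addn0 in le.
case: o h => h; first by apply: cups_first_cup; move: h; rewrite step_cup // => -[->].
apply: cups_first_iso (tiso_catr D (flip_cup le)) _.
apply: cups_first_cup => //; apply: cups_first_step IH.
  move: h; rewrite /step le /ins drop_size_cat ?size_takel // => -[<-] /=.
  by rewrite take_size_cat ?size_takel.
have z : size (take i st) = i by rewrite size_takel.
have nt k s1 : nth true (take i st ++ s1) (k + i) = nth true s1 k.
  by rewrite nth_cat z ltnNge leq_addl addnK.
by rewrite /good (nt 0%N) (nt 1%N).
Qed.

(** A bad crossing is traded by [bad_crossing] for a minimum, a crossing of parallel strands and a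
    maximum; the new minimum is gathered like any other. *)
Lemma cups_firstP st D st' : run st D = Some st' -> cups_first st D.
Proof.
elim: D st => [|[i e] D IH] st.
  by move=> _; exists 0%N, [::]; split; first exact: tiso_refl.
rewrite run_cons; case h: step => [st1|] //= /IH {}IH.
case: e h => [o||b] h.
- exact: cups_first_any h IH.
- exact: cups_first_step h _ IH.
case gb: (good st i b); first exact: cups_first_step h gb IH.
have [st2 [a [c [st3 [es zi]]]]] : exists st2 a c st3,
    st = st2 ++ [:: a, c & st3] /\ size st2 = i.
  have [/= le _] := step_size h; exists (take i st), (nth true st i), (nth true st i.+1).
  exists (drop i.+2 st); rewrite -!drop_nth ?cat_take_drop ?size_takel //; lia.
subst st i; have nt k s1 : nth true (st2 ++ s1) (k + size st2) = nth true s1 k.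
  by rewrite nth_cat ltnNge leq_addl addnK.
move: gb; rewrite /good (nt 0%N) (nt 1%N) /=.
case: eqP => //= /eqP ac /negbT bc.
have {ac bc} [ca ba] : c = ~~ a /\ b = a by case: (a) (b) (c) ac bc => -[] [].
subst c b.
have t := tiso_local st2 st3 (bad_crossing a).
apply: cups_first_iso (tiso_catr D t) _.
have st1E : st1 = st2 ++ [:: ~~ a, a & st3].
  by move: h; rewrite /step drop_size_cat // take_size_cat // => -[<-].
apply: (@cups_first_any _ _ _ (st2 ++ [:: ~~ a, a, a, ~~ a & st3])).
  by rewrite step_shift /step take0 drop0 /= negbK.
apply: (@cups_first_step _ _ _ (st2 ++ [:: ~~ a, a, a, ~~ a & st3])).
- by rewrite step_shift.
- by rewrite /good (nt 1%N) (nt 2) eqxx.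
apply: (@cups_first_step _ _ _ st1) => //.
by rewrite st1E step_shift /step /=; case: (a).
Qed.

(** * Gathering the maxima at the top *)

Definition caps_last (st : seq bool) (X : diagram) (st' : seq bool) : Prop :=
  exists k Z, [/\ tiso st X (Z ++ shift (size st') (ncaps k)),
    goodX false st Z & run st Z = Some (st' ++ band k)].

Lemma caps_last_iso st X Y st' : tiso st X Y -> caps_last st Y st' -> caps_last st X st'.
Proof.
by move=> t [k [Z [t' g r]]]; exists k, Z; split=> //; apply: tiso_trans t t'.
Qed.

Lemma caps_last_cross st i b st1 X st' : step st (i, Cross b) = Some st1 ->
  good st i b -> caps_last st1 X st' -> caps_last st ((i, Cross b) :: X) st'.
Proof.
move=> h gb [k [Z [t g r]]]; exists k, ((i, Cross b) :: Z); split.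
- exact: (tiso_cons h t).
- by rewrite /= h gb.
- by rewrite run_cons h.
Qed.

Lemma caps_last_cap st i X st' : (i <= size st)%N ->
  caps_last st X st' -> caps_last (ins i st) ((i, Cap) :: X) st'.
Proof.
move=> le [k [Z [t g r]]].
have [W [tW gW rW]] := cap_to le (leqnn (size st)).
have zS := goodX_size g r.
have lb : (size st' + k <= size (st' ++ band k))%N.
  by rewrite size_cat /band size_cat !size_nseq; lia.
have [V [tV gV rV]] := cap_to (leqnn (size (st' ++ band k))) lb.
rewrite ins_size in rW gV tV rV; rewrite ins_size in gV tV rV.
exists k.+1, (W ++ Z ++ V); split.
- apply: tiso_trans (tiso_cons (step_ins le) t) _.
  rewrite -[_ :: _]/([:: (i, Cap)] ++ _).
  apply: tiso_trans (tiso_catr _ tW) _; rewrite -!catA; apply: (tiso_catl rW).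
  have rc : run [:: true; false] [:: (0%N, Cap)] = Some [::] by [].
  have := interchange r rc; rewrite /shift /= !add0n => /tiso_sym.
  move/(tiso_catr (shift (size st') (ncaps k))) => t2; apply: tiso_trans t2 _.
  rewrite -catA; apply: (tiso_catl (run_catr _ r)).
  apply: tiso_trans (tiso_catr _ tV) _; rewrite -catA ncapsS /shift /=.
  by rewrite [(k + _)%N]addnC -catA; exact: tiso_refl.
- rewrite (goodX_cat _ _ rW) gW (goodX_cat _ _ (run_catr _ r)) gV andbT.
  exact: goodX_extend.
- by rewrite run_cat rW /= run_cat (run_catr _ r) /= rV ins_band.
Qed.

Lemma caps_lastP st X st' : goodX true st X -> run st X = Some st' ->
  caps_last st X st'.
Proof.
elim: X st => [|[i e] X IH] st.
  by move=> _ [<-]; exists 0%N, [::]; rewrite /= cats0; split=> //; exact: tiso_refl.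
rewrite run_cons /=; case h: step => [st1|] //= /andP[ge gX] /(IH _ gX) {}IH.
case: e h ge => [o||b] // h gb; last exact: caps_last_cross h gb IH.
have [a [c [s1 [s2 [es zi ac]]]]] : exists a c s1 s2,
    [/\ st = s1 ++ [:: a, c & s2], size s1 = i & a != c].
  move: h; rewrite /step; case d : (drop i st) => [|a [|c l]] //; case: ifP => // ac _.
  have le : (i <= size st)%N.
    by have := size_drop i st; rewrite d /=; lia.
  by exists a, c, (take i st), l; rewrite -d cat_take_drop size_takel.
have st1E : st1 = s1 ++ s2.
  move: h; rewrite es /step -zi drop_size_cat // take_size_cat // ac.
  by case.
have [a1|a0] := boolP a.
  have -> : st = ins i st1.
    rewrite st1E /ins -zi take_size_cat // drop_size_cat // es.
    by case: a c a1 ac {es} => -[].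
  by apply: caps_last_cap => //; rewrite st1E -zi size_cat leq_addr.
have [ea ec] : a = false /\ c = true by case: a c a0 ac {es} => -[].
subst a c; have sw : step st (i, Cross true) = Some (ins i st1).
  rewrite es st1E /step /ins -zi !drop_size_cat // !take_size_cat //.
have t : tiso st [:: (i, Cap)] [:: (i, Cross true); (i, Cap)].
  rewrite es -zi; apply: tiso_sym.
  apply: (tiso_local s1 s2 (st := [:: false; true])
    (D := [:: (0, Cross true); (0, Cap)]%N) (D' := [:: (0, Cap)]%N)).
  exact: (@tmove [:: false; true] [::] [::] _ _ _ _ (move_R1_cap 0 true) erefl erefl erefl).
apply: caps_last_iso (tiso_catr X t) _.
apply: caps_last_cross sw _ _.
  rewrite /good es -zi; have nt k s3 : nth true (s1 ++ s3) (k + size s1) = nth true s3 k.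
    by rewrite nth_cat ltnNge leq_addl addnK.
  by rewrite (nt 0%N) (nt 1%N).
by apply: caps_last_cap => //; rewrite st1E -zi size_cat leq_addr.
Qed.

Lemma shift0 D : shift 0 D = D.
Proof. by elim: D => //= -[j e] D ->; rewrite addn0. Qed.

Lemma size_band k : size (band k) = k.*2.
Proof. by rewrite size_cat !size_nseq addnn. Qed.

Lemma plat_form D : link_diagram D -> exists k Z,
  [/\ tiso [::] D (ncups 0 k ++ Z ++ ncaps k), goodX false (band k) Z
    & run (band k) Z = Some (band k)].
Proof.
move=> l; have [k [X [t g]]] := cups_firstP l.
have rX : run (band k) X = Some [::].
  have := tiso_run t; rewrite [run _ D]l run_cat (run_ncups 0) add0n => ->.
  by [].
have [k' [Z [t' g' r']]] := caps_lastP g rX.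
(* Crossings keep the number of strands, so the nests of minima and of maxima have the same
   depth. *)
have kk : k' = k.
  have := goodX_size g' r'; rewrite !size_band => /eqP.
  by rewrite eqn_leq !leq_double -eqn_leq => /eqP.
exists k, Z; rewrite kk shift0 in t' r' *; split=> //.
apply: tiso_trans t _; exact: (tiso_catl (run_ncups 0 k) t').
Qed.

(** * Separating the upward from the downward strands *)

Lemma R3_left e : tiso [:: true; true; false]
  [:: (1, Cross false); (0, Cross false); (1, Cross e)]%N
  [:: (0, Cross e); (1, Cross false); (0, Cross false)]%N.
Proof.
pose f i := (i, Cross false) : nat * event; pose p i := (i, Cross true) : nat * event.
have r3 := @tmove [:: true; true; false] _ _ _ _ [:: true; true; false] _ (move_R3 0 false) _ erefl erefl.
(* [move_R3] has three equal signs. For the other sign a cancelling pair is inserted at the bottom,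
   after which that move applies and a pair cancels at the top. *)
case: e; last exact: tiso_sym (r3 [::] [::] erefl).
apply: (tiso_trans (D' := [:: p 0; f 0; f 1; f 0; p 1]%N)).
  apply: tiso_sym; exact: (@tmove [:: true; true; false] [::] [:: f 1; f 0; p 1]%N
    _ _ _ _ (move_R2 0 true) erefl erefl erefl).
apply: (tiso_trans (D' := [:: p 0; f 1; f 0; f 1; p 1]%N)).
  exact: (r3 [:: p 0]%N [:: p 1]%N erefl).
exact: (@tmove [:: true; true; false] [:: p 0; f 1; f 0]%N [::]
  _ _ _ _ (move_R2 1 false) erefl erefl erefl).
Qed.

Lemma R3_right e : tiso [:: true; false; false]
  [:: (0, Cross false); (1, Cross false); (0, Cross e)]%N
  [:: (1, Cross e); (0, Cross false); (1, Cross false)]%N.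
Proof.
pose f i := (i, Cross false) : nat * event; pose p i := (i, Cross true) : nat * event.
have r3 := @tmove [:: true; false; false] _ _ _ _ [:: true; false; false] _ (move_R3 0 false) _ erefl erefl.
case: e; last exact: (r3 [::] [::] erefl).
apply: (tiso_trans (D' := [:: p 1; f 1; f 0; f 1; p 0]%N)).
  apply: tiso_sym; exact: (@tmove [:: true; false; false] [::] [:: f 0; f 1; p 0]%N
    _ _ _ _ (move_R2 1 true) erefl erefl erefl).
apply: (tiso_trans (D' := [:: p 1; f 0; f 1; f 0; p 0]%N)).
  apply: tiso_sym; exact: (r3 [:: p 1]%N [:: p 0]%N erefl).
exact: (@tmove [:: true; false; false] [:: p 1; f 0; f 1]%N [::]
  _ _ _ _ (move_R2 0 false) erefl erefl erefl).
Qed.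

(* Moves a downward strand to the left, over a upward strands. *)
Fixpoint mover (a : nat) : diagram :=
  if a is a'.+1 then (a', Cross false) :: mover a' else [::].

Lemma moverSr a : mover a.+1 = shift 1 (mover a) ++ [:: (0%N, Cross false)].
Proof. by elim: a => //= a ->; rewrite addn1. Qed.

Lemma step_cross_at s1 a b s2 c : step (s1 ++ [:: a, b & s2]) (size s1, Cross c)
  = Some (s1 ++ [:: b, a & s2]).
Proof. by rewrite /step take_size_cat // drop_size_cat. Qed.

Lemma step_cross_n k x a b s2 c : step (nseq k x ++ [:: a, b & s2]) (k, Cross c)
  = Some (nseq k x ++ [:: b, a & s2]).
Proof. by have := step_cross_at (nseq k x) a b s2 c; rewrite size_nseq. Qed.

Lemma nseqS_cat (T : Type) n (x : T) s : nseq n.+1 x ++ s = nseq n x ++ x :: s.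
Proof. by rewrite nseqSr cat_rcons. Qed.

Lemma run_mover a s : run (nseq a true ++ false :: s) (mover a)
  = Some (false :: nseq a true ++ s).
Proof.
elim: a s => // a IH s; rewrite nseqS_cat run_cons step_cross_n [obind _ _]IH.
by rewrite nseqS_cat.
Qed.

Lemma tiso_at k D D' st s2 : tiso st D D' ->
  tiso (nseq k true ++ st ++ s2) (shift k D) (shift k D').
Proof. by move/(tiso_local (nseq k true) s2); rewrite size_nseq. Qed.

Lemma mover_interchange a sb sb1 E : run sb E = Some sb1 ->
  tiso (nseq a true ++ false :: sb) (mover a ++ shift a.+1 E) (shift a.+1 E ++ mover a).
Proof.
move=> r; have := interchange (sa := nseq a true ++ [:: false]) (run_mover a [::]) r.
by rewrite -catA /= !size_cat /= !size_nseq addn0 addn1.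
Qed.

(** The downward strand passes over both upward strands, so their crossing slides below it by the
    third Reidemeister move and is one place further left there. *)
Lemma mover_up a j e : (j.+1 < a)%N ->
  tiso (nseq a true ++ [:: false]) (mover a ++ [:: (j.+1, Cross e)])
       ((j, Cross e) :: mover a).
Proof.
elim: a => // a IH; rewrite ltnS leq_eqVlt => /orP[/eqP <-|lt].
  rewrite !nseqS_cat [mover _]/=.
  have r : run [:: true; true] [:: (0%N, Cross e)] = Some [:: true; true] by [].
  have := mover_interchange j r; rewrite /shift /= add0n => t.
  have r2 : run (nseq j true ++ [:: true; true; false])
      [:: (j.+1, Cross false); (j, Cross false)] = Some (nseq j true ++ [:: false; true; true]).
    rewrite run_cons -nseqS_cat step_cross_n.
    change (run (nseq j.+1 true ++ [:: false; true]) [:: (j, Cross false)]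
      = Some (nseq j true ++ [:: false; true; true])).
    by rewrite nseqS_cat run_cons step_cross_n.
  apply: tiso_trans (tiso_catl r2 t) _.
  have := tiso_at j [::] (R3_left e); rewrite cats0 /shift /= add0n add1n.
  exact: (@tiso_catr _ _ _ (mover j)).
rewrite nseqS_cat [mover _]/=; have t := tiso_extend [:: true] (IH lt); rewrite -catA in t.
have st := step_cross_n a true true false [::] false.
apply: tiso_trans (tiso_cons st t) _.
apply: tiso_distant' => //=; try lia.
rewrite run_cons st /=; have -> : nseq a true ++ [:: false; true]
    = nseq j true ++ [:: true, true & nseq (a - j - 2) true ++ [:: false; true]].
  rewrite -!nseqS_cat catA -nseqD; congr (nseq _ _ ++ _); lia.
by rewrite run_cons step_cross_n.
Qed.

Lemma mover_down a e :
  tiso (nseq a true ++ [:: false; false]) (mover a ++ shift 1 (mover a) ++ [:: (0%N, Cross e)])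
       ((a, Cross e) :: mover a ++ shift 1 (mover a)).
Proof.
elim: a => [|a IH]; first exact: tiso_refl.
have st := step_cross_n a true true false [:: false] false.
have r : run [:: true; false] [:: (0%N, Cross false)] = Some [:: false; true] by [].
have t : tiso (nseq a true ++ [:: false; true; false])
    (mover a ++ [:: (a.+1, Cross false)]) ((a.+1, Cross false) :: mover a).
  by have := mover_interchange a r; rewrite /shift /= add0n.
have r2 : run (nseq a true ++ [:: true; false; false])
    [:: (a, Cross false); (a.+1, Cross false)] = Some (nseq a true ++ [:: false; false; true]).
  have e2 s : nseq a true ++ false :: s = (nseq a true ++ [:: false]) ++ s by rewrite -catA.
  rewrite run_cons st /= run_cons e2.
  have z : size (nseq a true ++ [:: false]) = a.+1 by rewrite size_cat size_nseq addn1.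
  by rewrite -z step_cross_at -catA.
rewrite nseqS_cat [mover _]/= [shift 1 (_ :: _)]/= addn1.
have t1 := tiso_cons st (tiso_catr (shift 1 (mover a) ++ [:: (0%N, Cross e)]) t).
rewrite -!catA /= in t1; apply: tiso_trans t1 _.
have t2 : tiso (nseq a true ++ [:: true; false; false])
  [:: (a, Cross false), (a.+1, Cross false) & mover a ++ shift 1 (mover a) ++ [:: (0%N, Cross e)]]
  [:: (a, Cross false), (a.+1, Cross false), (a, Cross e) & mover a ++ shift 1 (mover a)].
  apply: (tiso_catl r2); have := tiso_extend [:: true] IH; rewrite -catA; exact.
apply: tiso_trans t2 _.
have := tiso_at a [::] (R3_right e).
rewrite cats0 => /(tiso_catr (mover a ++ shift 1 (mover a))) => t3.
apply: tiso_trans t3 _.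
have st3 : step (nseq a true ++ [:: true; false; false]) (a.+1, Cross e)
    = Some (nseq a true ++ [:: true; false; false]).
  by rewrite -nseqS_cat step_cross_n.
apply: (tiso_cons st3); apply: (tiso_cons st); apply: tiso_sym.
have := tiso_catr (shift 1 (mover a)) t; rewrite -!catA; exact.
Qed.

(* Sorts the strands: starts with the upward strands on the left, ends at st. *)
Fixpoint sortw (st : seq bool) : diagram :=
  match st with
  | [::] => [::]
  | true :: st' => shift 1 (sortw st')
  | false :: st' => mover (count id st') ++ shift 1 (sortw st')
  end.

Definition sorted_st (st : seq bool) : seq bool :=
  nseq (count id st) true ++ nseq (count negb st) false.

Lemma shift_shift i j D : shift i (shift j D) = shift (j + i) D.
Proof. by rewrite /shift -map_comp; apply: eq_map => x /=; rewrite addnA. Qed.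

Lemma shift_cat i A B : shift i (A ++ B) = shift i A ++ shift i B.
Proof. exact: map_cat. Qed.

Lemma sorted_false st : sorted_st (false :: st)
  = nseq (count id st) true ++ false :: nseq (count negb st) false.
Proof. by []. Qed.

Lemma run_shift1 x st D st' : run st D = Some st' ->
  run (x :: st) (shift 1 D) = Some (x :: st').
Proof. by move=> r; rewrite (run_shift [:: x]) r. Qed.

Lemma tiso_shift1 x st D D' : tiso st D D' ->
  tiso (x :: st) (shift 1 D) (shift 1 D').
Proof. exact: (@tiso_shift [:: x]). Qed.

Lemma run_sortw st : run (sorted_st st) (sortw st) = Some st.
Proof.
elim: st => // -[] st IH; first exact: (run_shift1 true IH).
by rewrite sorted_false /= run_cat run_mover /= (run_shift1 false IH).
Qed.

(* Crossings of parallel strands among a upward strands followed by downward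
   strands, n strands in all. *)
Definition parallel_word (a n : nat) (P : diagram) : bool :=
  all (fun x => (if x.2 is Cross _ then true else false) &&
    ((x.1.+1 < a) || (a <= x.1) && (x.1.+1 < n))%N) P.

Lemma mover_parallel a b P : parallel_word a (a + b) P ->
  exists2 P', parallel_word a (a + b.+1) P' &
    tiso (nseq a true ++ nseq b.+1 false) (mover a ++ shift 1 P) (P' ++ mover a).
Proof.
elim: P => [|[i e] P IH]; first by exists [::]; rewrite // cats0; exact: tiso_refl.
case: e => [//|//|c] /andP[/= hi /IH[P' hP' t]].
have -> : mover a ++ shift 1 ((i, Cross c) :: P)
    = (mover a ++ [:: (i.+1, Cross c)]) ++ shift 1 P by rewrite -catA /= addn1.
suff [j hj t2] : exists2 j, ((j.+1 < a) || (a <= j) && (j.+1 < a + b.+1))%N &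
    tiso (nseq a true ++ nseq b.+1 false) (mover a ++ [:: (i.+1, Cross c)])
      ((j, Cross c) :: mover a).
  exists ((j, Cross c) :: P'); first by rewrite /= hj.
  apply: tiso_trans (tiso_catr _ t2) _.
  have st : step (nseq a true ++ nseq b.+1 false) (j, Cross c)
      = Some (nseq a true ++ nseq b.+1 false).
    case/orP: hj => [lt|/andP[ge lt]].
      have e : nseq a true = nseq j true ++ [:: true, true & nseq (a - j - 2) true].
        by rewrite -!nseqS_cat -nseqD; congr nseq; lia.
      by rewrite {1}e -catA step_cross_n /= e -catA.
    have e : nseq b.+1 false = nseq (j - a) false
        ++ [:: false, false & nseq (b.+1 - (j - a) - 2) false].
      by rewrite -!nseqS_cat -nseqD; congr nseq; lia.
    have z : size (nseq a true ++ nseq (j - a) false) = j.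
      by rewrite size_cat !size_nseq; lia.
    have := step_cross_at (nseq a true ++ nseq (j - a) false) false false
      (nseq (b.+1 - (j - a) - 2) false) c.
    by rewrite z -catA -e.
  exact: (tiso_cons st t).
case/orP: hi => [lt|/andP[ge lt]].
  exists i; first by rewrite lt.
  have := tiso_extend (nseq b false) (mover_up c lt); rewrite -catA; exact.
exists i.+1; first by apply/orP; right; lia.
have r : run (nseq b false) [:: (i - a, Cross c)%N] = Some (nseq b false).
  have e : nseq b false = nseq (i - a) false
      ++ [:: false, false & nseq (b - (i - a) - 2) false].
    by rewrite -!nseqS_cat -nseqD; congr nseq; lia.
  by rewrite e run_cons step_cross_n.
have := mover_interchange a r; rewrite /shift [map _ _]/=.
by have -> : (i - a + a.+1 = i.+1)%N by lia.
Qed.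

Lemma parallel_shift a n P : parallel_word a n P -> parallel_word a.+1 n.+1 (shift 1 P).
Proof.
rewrite /parallel_word all_map; apply: sub_all => -[i e] /= /andP[-> h] /=; lia.
Qed.

(** A crossing of parallel strands slides down through the sorting word. A good crossing of
    antiparallel strands is absorbed by it: with the downward strand on the right it prolongs a
    [mover], with the downward strand on the left it cancels the last crossing of one. *)
Lemma sort_step st i c st' : step st (i, Cross c) = Some st' -> good st i c ->
  [/\ count id st' = count id st, count negb st' = count negb st &
   exists2 P, parallel_word (count id st) (count id st + count negb st) P &
    tiso (sorted_st st) (sortw st ++ [:: (i, Cross c)]) (P ++ sortw st')].
Proof.
elim: i st st' => [|i IH] [|x st] st' //.
  case: st => [|y st] //; rewrite /step /= => -[<-] gc /=.
  have rS := run_sortw st; have r1 := run_shift1 true rS.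
  split; [lia|lia|].
  have rc u v : run [:: u; v] [:: (0%N, Cross c)] = Some [:: v; u] by [].
  have := gc; rewrite /good /=; case: x y gc => -[] gc /=.
  - move=> _; exists [:: (0%N, Cross c)]; first by rewrite /=; lia.
    rewrite !shift_shift; apply: tiso_sym.
    exact: (interchange (rc true true) rS).
  - rewrite eqbF_neg => /negPf cF; rewrite cF; exists [::] => //.
    change (tiso (sorted_st [:: true, false & st])
      (shift 1 (mover (count id st) ++ shift 1 (sortw st)) ++ [:: (0%N, Cross false)])
      (mover (count id st).+1 ++ shift 1 (shift 1 (sortw st)))).
    rewrite moverSr.
    rewrite shift_cat !shift_shift -!catA.
    have r : run (true :: nseq (count id st) true ++ false :: nseq (count negb st) false)
        (shift 1 (mover (count id st))) = Some [:: true, false & sorted_st st].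
      by apply: run_shift1; rewrite run_mover.
    apply: (tiso_catl r); apply: tiso_sym.
    by have := interchange (rc true false) rS; rewrite cF.
  - rewrite eqb_id => cT; rewrite cT; exists [::] => //.
    change (tiso (sorted_st [:: false, true & st])
      ((mover (count id st).+1 ++ shift 1 (shift 1 (sortw st))) ++ [:: (0%N, Cross true)])
      (shift 1 (mover (count id st) ++ shift 1 (sortw st)))).
    rewrite moverSr.
    rewrite shift_cat !shift_shift -!catA.
    have r : run (true :: nseq (count id st) true ++ false :: nseq (count negb st) false)
        (shift 1 (mover (count id st))) = Some [:: true, false & sorted_st st].
      by apply: run_shift1; rewrite run_mover.
    apply: (tiso_catl r); apply: (tiso_trans (D' := [:: (0, Cross false), (0, Cross true) & shift 2 (sortw st)]%N)).
      apply: (@tiso_cons _ _ [:: false, true & sorted_st st]) => //.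
      apply: tiso_sym; have := interchange (rc false true) rS; rewrite cT; exact.
    exact: (@tmove [:: true, false & sorted_st st] [::] (shift 2 (sortw st)) _ _ _ _
      (move_R2 0 false) erefl erefl erefl).
  - move=> _; exists [:: (count id st, Cross c)]; first by rewrite /=; lia.
    rewrite add0n shift_cat !shift_shift -!catA /=.
    have r : run (nseq (count id st) true ++ [:: false, false & nseq (count negb st) false])
       (mover (count id st) ++ shift 1 (mover (count id st)))
        = Some [:: false, false & sorted_st st].
      rewrite run_cat run_mover /=; apply: run_shift1; exact: run_mover.
    apply: (tiso_trans (D' := mover (count id st) ++ shift 1 (mover (count id st))
       ++ (0%N, Cross c) :: shift 2 (sortw st))).
      rewrite !catA -[_ ++ _ :: _]/(_ ++ ([:: _] ++ _)) -!catA catA [X in tiso _ _ X]catA.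
      apply: (tiso_catl r); apply: tiso_sym.
      exact: (interchange (rc false false) rS).
    have := tiso_extend (nseq (count negb st) false) (mover_down (count id st) c).
    rewrite -catA => /(tiso_catr (shift 2 (sortw st))); rewrite -!catA /= -!catA; exact.
rewrite -[i.+1]addn1 (step_shift [:: x]); case h: step => [s'|] //= [<-] gc.
have gc' : good st i c by move: gc; rewrite /good addn1.
have [c1 c2 [P hP t]] := IH _ _ h gc'.
split; [by rewrite /= c1|by rewrite /= c2|].
case: x {gc} => /=.
  exists (shift 1 P); first by rewrite add1n addSn; apply: parallel_shift.
  have := tiso_shift1 true t; rewrite !shift_cat; exact.
rewrite add0n add1n c1; have [P' hP' t'] := mover_parallel hP.
exists P' => //; rewrite addn1 in gc' *.
have r := run_mover (count id st) (nseq (count negb st) false).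
have e : shift 1 [:: (i, Cross c)] = [:: (i.+1, Cross c)] by rewrite /= addn1.
have := tiso_catl r (tiso_shift1 false t); rewrite !shift_cat e !catA => t1.
apply: tiso_trans t1 _; exact: (tiso_catr (shift 1 (sortw s')) t').
Qed.

Lemma parallel_run a b P : parallel_word a (a + b) P ->
  run (nseq a true ++ nseq b false) P = Some (nseq a true ++ nseq b false).
Proof.
elim: P => // -[i [//|//|c]] P IH /= /andP[hj /IH {}IH]; rewrite run_cons.
suff -> : step (nseq a true ++ nseq b false) (i, Cross c)
    = Some (nseq a true ++ nseq b false) by [].
case/orP: hj => [lt|/andP[ge lt]].
  have e : nseq a true = nseq i true ++ [:: true, true & nseq (a - i - 2) true].
    by rewrite -!nseqS_cat -nseqD; congr nseq; lia.
  by rewrite {1}e -catA step_cross_n /= e -catA.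
have e : nseq b false = nseq (i - a) false ++ [:: false, false & nseq (b - (i - a) - 2) false].
  by rewrite -!nseqS_cat -nseqD; congr nseq; lia.
have z : size (nseq a true ++ nseq (i - a) false) = i.
  by rewrite size_cat !size_nseq; lia.
have := step_cross_at (nseq a true ++ nseq (i - a) false) false false
  (nseq (b - (i - a) - 2) false) c.
by rewrite z -catA -e.
Qed.

(** If both rows have the form [band k], their sorting words are empty ([sortw_band]) and only
    crossings of parallel strands are left. *)
Lemma sort_word st Z st' : goodX false st Z -> run st Z = Some st' ->
  [/\ count id st' = count id st, count negb st' = count negb st &
   exists2 P, parallel_word (count id st) (count id st + count negb st) P &
    tiso (sorted_st st) (sortw st ++ Z) (P ++ sortw st')].
Proof.
elim: Z st => [|[i e] Z IH] st.
  by move=> _ [<-]; split=> //; exists [::] => //; rewrite cats0; exact: tiso_refl.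
rewrite run_cons /=; case h: step => [st1|] //= /andP[ge gZ] /(IH _ gZ)[c1 c2 [P hP t]].
case: e h ge => [//|//|c] h gc.
have [c1' c2' [P1 hP1 t1]] := sort_step h gc.
rewrite c1' c2' in hP c1 c2; split=> //; exists (P1 ++ P).
  by rewrite /parallel_word all_cat; apply/andP.
have := tiso_catr Z t1; rewrite -catA => t1'; apply: tiso_trans t1' _.
rewrite -!catA; apply: (tiso_catl (parallel_run hP1)).
by move: t; rewrite /sorted_st c1' c2'.
Qed.

Lemma count_band k : count id (band k) = k /\ count negb (band k) = k.
Proof. by rewrite !count_cat !count_nseq /= !mul1n !mul0n addn0. Qed.

Lemma sortw_band k : sortw (band k) = [::].
Proof.
rewrite /band; have e : sortw (nseq k false) = [::].
  elim: k => //= k ->; rewrite cats0.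
  by have -> : count id (nseq k false) = 0%N by rewrite count_nseq.
by elim: {1}k => //= n ->.
Qed.

Lemma sorted_band k : sorted_st (band k) = band k.
Proof. by rewrite /sorted_st; have [-> ->] := count_band k. Qed.

(** * Crossings of downward strands turned into crossings of upward strands *)

Lemma flip_core e : tiso [::]
  [:: (0, Cup true); (1, Cup true); (2, Cross e)]%N
  [:: (0, Cup true); (1, Cup true); (0, Cross e)]%N.
Proof.
apply: (tiso_trans (D' := [:: (0, Cup true); (2, Cup true); (1, Cross (~~ e))]%N)).
  exact: (@tmove [::] [:: (0, Cup true)]%N [::] _ _ _ _
    (move_slide_cup 1 true e) erefl erefl erefl).
apply: (tiso_trans (D' := [:: (0, Cup true); (0, Cup true); (1, Cross (~~ e))]%N)).
  exact: (@tmove [::] [::] [:: (1, Cross (~~ e))]%N _ _ _ _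
    (move_distant 0 0 (Cup true) (Cup true)) erefl erefl erefl).
have := @tmove [::] [:: (0, Cup true)]%N [::] _ _ _ _
  (move_slide_cup 0 true (~~ e)) erefl erefl erefl.
by rewrite negbK.
Qed.

Lemma ncups_split j n : ncups 0 (j + 2 + n)
  = ncups 0 j ++ [:: (j, Cup true); (j.+1, Cup true)] ++ ncups j.+2 n.
Proof. by rewrite /ncups -addnA !iotaD !map_cat add0n addn2. Qed.

(* A crossing of downward strands slides through the minima. *)
Lemma ncups_flip j n e : tiso [::]
  (ncups 0 (j + 2 + n) ++ [:: (j + 2 + n + n, Cross e)%N])
  (ncups 0 (j + 2 + n) ++ [:: (j, Cross e)]).
Proof.
rewrite ncups_split -!catA; apply: (tiso_catl (run_ncups 0 j)); rewrite add0n.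
have r2 : run (band j) [:: (j, Cup true); (j.+1, Cup true)] = Some (band j.+2).
  by rewrite run_cons step_cup_band /= run_cons step_cup_band.
have rFF : run (nseq j.+2 false) [:: (0%N, Cross e)] = Some (nseq j.+2 false) by [].
have := interchange (run_ncups_end (nseq j.+2 true) n) rFF.
rewrite size_cat size_band size_nseq /shift [map _ [:: (0%N, _)]]/= [map _ [:: (0%N, _)]]/=.
have -> : (0 + (j.+2 + n.*2) = j + 2 + n + n)%N by rewrite -addnn; lia.
rewrite add0n => t1; apply: tiso_trans (tiso_catl r2 t1) _.
have := tiso_local (nseq j true) (nseq j false) (flip_core e).
rewrite size_nseq => /(tiso_catr (ncups j.+2 n)) t2.
apply: (tiso_trans (D' := [:: (j, Cup true), (j.+1, Cup true), (j, Cross e) & ncups j.+2 n])).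
  by move: t2; rewrite /shift /= !add0n.
have rTT : run (nseq j.+2 true) [:: (j, Cross e)] = Some (nseq j.+2 true).
  have -> : nseq j.+2 true = nseq j true ++ [:: true; true] by rewrite -!nseqS_cat cats0.
  by rewrite run_cons step_cross_n.
have := interchange rTT (run_catr (nseq j.+2 false) (run_ncups 0 n)).
rewrite size_nseq -ncups_shift; exact: (tiso_catl r2).
Qed.

Definition up_word (k : nat) (B : diagram) : bool :=
  all (fun x => (if x.2 is Cross _ then true else false) && (x.1.+1 < k)%N) B.

Lemma up_word_parallel k B : up_word k B -> parallel_word k (k + 0) B.
Proof. by apply: sub_all => -[i e] /= /andP[-> ->]. Qed.

Lemma run_up_word k B : up_word k B -> run (nseq k true) B = Some (nseq k true).
Proof. by move/up_word_parallel/parallel_run; rewrite cats0. Qed.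

(** An upward crossing is appended to [B]. A downward one sinks past [B], goes round through the
    nested minima to its mirror position, and becomes the lowest crossing, so [B] grows at both
    ends. *)
Lemma flip_down k P B : parallel_word k (k + k) P -> up_word k B ->
  exists2 B', up_word k B' & tiso [::] (ncups 0 k ++ B ++ P) (ncups 0 k ++ B').
Proof.
elim: P B => [|[i [//|//|c]] P IH] B /=.
  by move=> _ hB; exists B; rewrite // cats0; exact: tiso_refl.
case/andP=> hi hP hB; case/orP: hi => [lt|/andP[ge lt]].
  have [|B' hB' t] := IH (B ++ [:: (i, Cross c)]) hP.
    by rewrite /up_word all_cat; apply/andP; split; rewrite //= lt.
  by exists B'; rewrite // -catA in t *.
have [n [j [ek ei]]] : exists n j, k = (j + 2 + n)%N /\ i = (k + n)%N.
  by exists (i - k)%N, (k - 2 - (i - k))%N; lia.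
have [|B' hB' t] := IH ((j, Cross c) :: B) hP.
  by rewrite /= hB andbT; lia.
exists B' => //; apply: tiso_trans t.
have r : run (nseq k false) [:: (n, Cross c)] = Some (nseq k false).
  have -> : nseq k false = nseq n false ++ [:: false, false & nseq j false].
    by rewrite -!nseqS_cat -nseqD ek; congr nseq; lia.
  by rewrite run_cons step_cross_n.
have := interchange (run_up_word hB) r; rewrite size_nseq /shift /= addnC -ei => t1.
have := tiso_catl (run_ncups 0 k) (tiso_catr P t1); rewrite -!catA => t2.
apply: tiso_trans t2 _.
have := ncups_flip j n c; rewrite -ek -ei => /(tiso_catr (B ++ P)).
by rewrite -!catA.
Qed.

Lemma up_word_braid k B : up_word k.+1 B -> exists b : braid k, braid_events b = B.
Proof.
elim: B => [|[i [//|//|c]] B IH] /=; first by exists [::].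
rewrite ltnS => /andP[lt /IH[b <-]].
by exists ((Ordinal lt, c) :: b).
Qed.

Lemma move_nil i e D : run [::] ((i, e) :: D) <> None ->
  ~ move [::] ((i, e) :: D) /\ ~ move ((i, e) :: D) [::].
Proof.
move=> r; have [i0 [o eo]] := run_first r; subst i e.
by split=> m; inversion m; subst.
Qed.

(** Closed braids have at least one strand, so a form without any minimum has to be excluded: no
    move between link diagrams makes a nonempty word empty, because the words that cancel completely
    cannot start from the empty row. *)
Lemma isotopic_nil D D' : isotopic D D' -> nilp D = nilp D'.
Proof.
elim=> {D D'} [D D' [A B E E' m l l']|//|D D' _ -> //|D D' D'' _ -> _ -> //].
case: A l l' => [|//] l l'; case: B l l' => [|x B] l l'; last by case: (E); case: (E').
rewrite /= !cats0 in l l' *.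
case: E E' m l l' => [|[i e] E] [|[i' e'] E'] // m l l'.
  have [|h _] := @move_nil i' e' E'; first by rewrite [run _ _]l'.
  by case: h.
have [|_ h] := @move_nil i e E; first by rewrite [run _ _]l.
by case: h.
Qed.

Theorem alexander D : link_diagram D -> D <> [::] ->
  exists k (b : braid k), isotopic (closure b) D.
Proof.
move=> l nD; have [k [Z [t g r]]] := plat_form l.
have [c1 c2 [P hP tP]] := sort_word g r.
rewrite sorted_band sortw_band cats0 /= in tP; rewrite !(count_band k).1 (count_band k).2 in hP.
have [B hB tB] := flip_down hP (isT : up_word k [::]).
have tD : tiso [::] D (ncups 0 k ++ B ++ ncaps k).
  apply: tiso_trans t _.
  apply: tiso_trans (tiso_ctx (ncaps k) (run_ncups 0 k) tP) _.
  by have := tiso_catr (ncaps k) tB; rewrite /= -!catA.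
case: k hB tD {t g r P hP tP c1 c2 tB Z} => [|k] hB tD.
  case: nD; apply/nilP; rewrite (isotopic_nil (tiso_isotopic l tD)).
  by case: B hB {tD} => // -[i [//|//|e]] B /andP[/andP[]].
have [b eb] := up_word_braid hB; exists k, b.
by apply: rst_sym; apply: tiso_isotopic => //; rewrite closureE eb.
Qed.

(** * The Links-Gould invariant as a state sum *)

Lemma tofrac_neq0 (P : {poly {poly rat}}) (a : {poly rat}) b :
  P.[a].[b] != 0 -> tofrac P != 0 :> K.
Proof.
by apply: contraNneq => /eqP; rewrite tofrac_eq0 => /eqP ->; rewrite !horner0.
Qed.

Lemma sK0 : sK != 0.
Proof. by apply: (@tofrac_neq0 _ 1 0); rewrite hornerX hornerC oner_eq0. Qed.

Lemma qK0 : qK != 0.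
Proof. by apply: (@tofrac_neq0 _ 1 1); rewrite hornerC hornerX oner_eq0. Qed.

Lemma qK2 : qK ^+ 2 != 1.
Proof.
rewrite -subr_eq0 -tofrac1 /qK -tofracXn -tofracB.
by apply: (@tofrac_neq0 _ 0 0); rewrite !hornerE.
Qed.

Lemma int_of_Z_nat i : int_of_Z (Z.of_nat i) = i.
Proof. by case: i => //= i; rewrite SuccNat2Pos.id_succ. Qed.

Lemma binomial_neq0 (e : bool) (i j : nat) : (if e then true else 0 < j)%N ->
  lval qK sK [:: (if e then 1 else -1, (0, 0)); (1, (Z.of_nat i, Z.of_nat j))]%bZ != 0.
Proof.
move=> h; have -> : lval qK sK
    [:: (if e then 1 else -1, (0, 0)); (1, (Z.of_nat i, Z.of_nat j))]%bZ
  = tofrac ((if e then 1 else -1) + ('X^i)%:P * 'X^j : {poly {poly rat}}).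
  have z1 : zval K 1%bZ = 1 by []; have zN : zval K (-1)%bZ = -1 by [].
  rewrite /= /tval [int_of_Z 0]/= !int_of_Z_nat !expr0z !mulr1 addr0 z1 mul1r.
  rewrite tofracD tofracM tofracXn rmorphXn tofracXn -!exprnP.
  by case: (e); rewrite ?z1 ?zN ?tofracN tofrac1.
(* Evaluation at s = 2 and q = 1. *)
apply: (@tofrac_neq0 _ 2%:R%:P 1); rewrite !hornerE.
case: e h => [_|h]; rewrite !hornerE expr1n mul1r -natrX.
  by have := pnatr_eq0 rat (1 + 2 ^ j); rewrite natrD => ->.
rewrite addrC subr_eq0 -[X in _ == X]/(1%:R) eqr_nat.
by case: j h => //= j _; rewrite expnS; lia.
Qed.

Lemma den_s0 : lval qK sK den_s != 0.
Proof. exact: (@binomial_neq0 false 0 2). Qed.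

Lemma den_qs0 : lval qK sK den_qs != 0.
Proof. exact: (@binomial_neq0 false 2 2). Qed.

Lemma gen_den0 : lval qK sK gen_den != 0.
Proof.
have e : lval qK sK (lmul [:: (1, (0, 0)); (1, (0, 2))]%bZ
    (lmul [:: (-1, (0, 0)); (1, (2, 4))]%bZ [:: (1, (0, 0)); (1, (2, 2))]%bZ))
  = lval qK sK gen_den by apply: lval_eqb; vm_compute.
rewrite -e !(lval_mul qK0 sK0) !mulf_neq0 //.
- exact: (@binomial_neq0 true 0 2).
- exact: (@binomial_neq0 false 2 4).
- exact: (@binomial_neq0 true 2 2).
Qed.

Lemma is_LG_Phi L P : is_LG L P -> P = Phi qK sK L.
Proof.
case=> k [b [iso e]]; rewrite -(Phi_isotopic qK0 sK0 den_s0 den_qs0 iso).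
rewrite (ptrace_closure qK0 sK0 qK2 den_s0 den_qs0 gen_den0) in e.
by have := congr1 (fun M : 'M_4 => M 0 0) e; rewrite !mxE !mulr1n.
Qed.

Lemma LG_Phi L : link_diagram L -> L <> [::] -> LG L = Phi qK sK L.
Proof.
move=> l n0; have [k [b iso]] := alexander l n0.
apply: is_LG_Phi; apply: (epsilon_spec (inhabits 0) (is_LG L)).
exists (Phi qK sK L); exists k, b; split=> //.
rewrite -(Phi_isotopic qK0 sK0 den_s0 den_qs0 iso).
exact: (ptrace_closure qK0 sK0 qK2 den_s0 den_qs0 gen_den0).
Qed.

(** * The algebra of two-strand tangles under horizontal concatenation *)

(* [[:: r0; r1; ...]] stands for r0(v) + r1(v) c + ..., where v = q^-2 and
   c = s^2 + q^-2 s^-2. *)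
Definition cvpoly := seq (seq Z).

Definition v_l : lpoly := [:: (1, (-2, 0))]%bZ.
Definition c_l : lpoly := [:: (1, (-2, -2)); (1, (0, 2))]%bZ.

Definition row_l (r : seq Z) : lpoly :=
  foldr (fun a p => ladd (if Z.eqb a 0 then [::] else [:: (a, (0, 0)%bZ)])
                         (lmul v_l p)) [::] r.
Definition cv_l (l : cvpoly) : lpoly :=
  foldr (fun r p => ladd (row_l r) (lmul c_l p)) [::] l.

(* The identity tangle is the nilpotent element, the cut one is the unit. *)
Definition basis_tangle (i : nat) : diagram :=
  match i with
  | 0%N => [::]
  | 1%N => [:: (0, Cap); (0, Cup true)]%N
  | _ => clasp true
  end.

Definition tangle_check (f : diagram) (C : seq lpoly) : bool :=
  all (fun w => teqb (tev [:: true; false] f (tword w))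
    (tsum [seq tscale (nth [::] C i) (tev [:: true; false] (basis_tangle i) (tword w))
          | i <- iota 0 3])) (words 2).

(* The coordinates x - c z, y, z, of x E + y + z (T - c E). *)
Definition coords_l (x y z : lpoly) : seq lpoly :=
  [:: ladd x (lmul lneg1 (lmul c_l z)); y; z].

(* TT^+ is given by these coordinates, TT^- by the next ones multiplied by q^2. *)
Definition TT_pos_x : seq (seq Z) :=
  [:: [:: 0; -4; 0; 0; 4; 4; -4];
   [:: 1; 2; 0; 0; -2; -2; 2]]%bZ.
Definition TT_pos_y : seq (seq Z) :=
  [:: [:: 2; 6; -6; -2; -12; 8; 4];
   [:: -4; -4; 6; 6; 6; -8; -2];
   [:: 2; 0; -2; -2; 0; 2]]%bZ.
Definition TT_pos_z : seq (seq Z) :=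
  [:: [:: 1; -4; 4; -4; 8; -4];
   [:: 0; 2; -2; 2; -4; 2]]%bZ.
Definition TT_neg_x : seq (seq Z) :=
  [:: [:: -2; -2; -4; 0; 0; 4; 4; -4];
   [:: 1; 2; 0; 0; -2; -2; 2]]%bZ.
Definition TT_neg_y : seq (seq Z) :=
  [:: [:: 3; 7; 6; -10; -4; -12; 8; 4];
   [:: -4; -8; 6; 6; 10; -4; -6];
   [:: 2; 0; -2; -2; 0; 2]]%bZ.
Definition TT_neg_z : seq (seq Z) :=
  [:: [:: -1; 0; -4; 4; -4; 8; -4];
   [:: 0; 2; -2; 2; -4; 2]]%bZ.
(** [closure_id], [closure_cut] and [closure_clasp] are the values of the link when E, 1 or T - c E
    replaces the inner tangle. The second is (c - 1 - v)^2, the square of the value of the positive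
    Hopf link. *)
Definition closure_id : seq (seq Z) :=
  [:: [:: -1; 0; 1];
   [:: 1; -1];
   [:: -1; -1];
   [:: 1]]%bZ.
Definition closure_cut : seq (seq Z) :=
  [:: [:: 1; 2; 1];
   [:: -2; -2];
   [:: 1]]%bZ.
Definition closure_clasp : seq (seq Z) :=
  [:: [:: 1; 2; 1];
   [:: 0; 2; 2];
   [:: -1; -2]]%bZ.

Lemma TT_pos_check : tangle_check (TT true)
  (coords_l (cv_l TT_pos_x) (cv_l TT_pos_y) (cv_l TT_pos_z)).
Proof. by vm_compute. Qed.

Definition q2_l : lpoly := [:: (1, (2, 0))]%bZ.

Lemma TT_neg_check : tangle_check (TT false)
  (coords_l (lmul q2_l (cv_l TT_neg_x)) (lmul q2_l (cv_l TT_neg_y))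
            (lmul q2_l (cv_l TT_neg_z))).
Proof. by vm_compute. Qed.

(** E with E contains a free circle, which has value 0. The cut tangle is neutral. Closing one side
    of the clasp leaves an unknotted arc, so E with T is E. The last line is the one relation
    without such a picture. *)
Definition basis_prod (i j : nat) : seq lpoly :=
  match i, j with
  | 0, 0 => [:: [::]; [::]; [::]]
  | 0, _ | _, 0 => [:: lone; [::]; [::]]
  | 1, 1 => [:: [::]; lone; [::]]
  | 1, _ | _, 1 => [:: [::]; [::]; lone]
  | _, _ => [:: cv_l [:: [:: -2; -2]; [:: 2]]%bZ; cv_l [:: [:: 0; -1]]%bZ;
                cv_l [:: [:: 1; 1]]%bZ]
  end%N.

Lemma basis_prod_check i j : (i < 3)%N -> (j < 3)%N ->
  tangle_check (box (basis_tangle i) (basis_tangle j)) (basis_prod i j).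
Proof. by case: i j => [|[|[|//]]] [|[|[|//]]] _ _; vm_compute. Qed.

Section TangleAlgebra.
Variables (F : fieldType) (q s : F).
Hypotheses (q0 : q != 0) (s0 : s != 0).
Local Notation lv := (lval q s).
Local Notation ev := (ev q s).
Local Notation up_down := [:: true; false].

Definition tangle_comb (f : diagram) (a : nat -> F) : Prop :=
  run up_down f = Some up_down /\ forall g w, size w = 2 ->
  ev up_down f g w = \sum_(i < 3) a i * ev up_down (basis_tangle i) g w.

Lemma tangle_checkP f C : run up_down f = Some up_down -> tangle_check f C ->
  tangle_comb f (fun i => lv (nth [::] C i)).
Proof.
move=> r h; split=> // g w sw; rewrite -(teval_word q s w) -teval_tev //.
have /allP/(_ w) := h; rewrite words_size sw => /(_ isT) e.
rewrite (teval_eqb q0 s0 _ e) tsum_eval // big_map -[iota 0 3]/(index_iota 0 3) big_mkord.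
by apply: eq_bigr => i _; rewrite teval_scale // teval_tev // teval_word.
Qed.

Lemma ev_sum (I : Type) (r : seq I) st D (a : I -> F) (g : I -> word -> F) w :
  ev st D (fun x => \sum_(i <- r) a i * g i x) w = \sum_(i <- r) a i * ev st D (g i) w.
Proof.
elim: r => [|i r IH].
  rewrite big_nil -[RHS](ev_0 q s st D w).
  elim: D st w => [|x D IHD] st w /=; first by rewrite big_nil.
  by case: step => // st'; apply: eq_sapply_at => y; apply: IHD.
rewrite big_cons -IH -ev_lin; elim: D st w {IH} => [|x D IHD] st w /=.
  by rewrite big_cons.
by case: step => // st'; apply: eq_sapply_at => y; apply: IHD.
Qed.

Lemma eq_ev_all st D g h w : g =1 h -> ev st D g w = ev st D h w.
Proof.
move=> e; elim: D st w => [|x D IH] st w //=.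
by case: step => // st'; apply: eq_sapply_at => y; apply: IH.
Qed.

Lemma run_box f g : run up_down f = Some up_down -> run up_down g = Some up_down ->
  run up_down (box f g) = Some up_down.
Proof.
move=> rf rg; rewrite /box run_cons /= /step /= run_cat.
by rewrite (run_catr up_down rf) /= run_cat (run_shift up_down up_down) rg.
Qed.

Lemma ev_box f g G a b : run up_down f = Some up_down ->
  run up_down g = Some up_down ->
  ev up_down (box f g) G [:: a; b] = \sum_(c <- colors) lv (muV_l c) *
    ev up_down f (fun u => ev up_down g (fun v =>
      ev (up_down ++ up_down) [:: (1%N, Cap)] G (u ++ v)) [:: c; b]) [:: a; c].
Proof.
move=> rf rg; have st : step up_down (1%N, Cup false) = Some (up_down ++ up_down) by [].
rewrite /box (ev_cons _ _ _ _ _ st) [sapply_at _ _ _ _ _ _]/= !big_cons big_nil.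
have e c : ev (up_down ++ up_down) (f ++ shift 2 g ++ [:: (1%N, Cap)]) G [:: a; c; c; b]
  = ev up_down f (fun u => ev up_down g (fun v =>
      ev (up_down ++ up_down) [:: (1%N, Cap)] G (u ++ v)) [:: c; b]) [:: a; c].
  rewrite (ev_cat _ _ _ _ _ (run_catr _ rf)) -[[:: a; c; c; b]]/([:: a; c] ++ [:: c; b]).
  rewrite (ev_catr q0 s0 _ _ _ _ rf) //; apply: (eq_ev q0 s0 rf) => // u su.
  have rg' : run (up_down ++ up_down) (shift 2 g) = Some (up_down ++ up_down).
    by rewrite (run_shift up_down up_down) rg.
  by rewrite (ev_cat _ _ _ _ _ rg') (ev_catl q s up_down g _ _ su).
by rewrite -!e.
Qed.

Lemma comb_box f g a b : tangle_comb f a -> tangle_comb g b ->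
  tangle_comb (box f g) (fun k => \sum_(i < 3) \sum_(j < 3)
    a i * b j * lv (nth [::] (basis_prod i j) k)).
Proof.
move=> [rf cf] [rg cg]; split; first exact: run_box.
move=> G [|x [|y [|]]] // _.
have rb i : run up_down (basis_tangle i) = Some up_down by case: i => [|[|i]].
have -> : ev up_down (box f g) G [:: x; y] = \sum_(i < 3) \sum_(j < 3)
    a i * b j * ev up_down (box (basis_tangle i) (basis_tangle j)) G [:: x; y].
  rewrite ev_box //; under eq_bigr => c _.
    rewrite cf // mulr_sumr; under eq_bigr => i _.
      rewrite (eq_ev_all _ _ (h := fun u => \sum_(j < 3) b j *
        ev up_down (basis_tangle j) (fun v => ev (up_down ++ up_down) [:: (1%N, Cap)] G (u ++ v))
          [:: c; y])); last by move=> u; rewrite cg.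
      rewrite ev_sum mulr_sumr mulr_sumr; over.
    over.
  rewrite exchange_big; apply: eq_bigr => i _; rewrite exchange_big; apply: eq_bigr => j _.
  by rewrite ev_box // mulr_sumr; apply: eq_bigr => c _ /=; ring.
transitivity (\sum_(i < 3) \sum_(j < 3) \sum_(k < 3)
    a i * b j * lv (nth [::] (basis_prod i j) k) * ev up_down (basis_tangle k) G [:: x; y]).
  apply: eq_bigr => i _; apply: eq_bigr => j _.
  have [_ ->] // := tangle_checkP (run_box (rb i) (rb j))
    (basis_prod_check (ltn_ord i) (ltn_ord j)).
  by rewrite mulr_sumr; apply: eq_bigr => k _; rewrite mulrA.
under eq_bigr => i _ do rewrite exchange_big.
rewrite exchange_big; apply: eq_bigr => k _ /=.
rewrite mulr_suml; apply: eq_bigr => i _.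
by rewrite mulr_suml.
Qed.

Lemma comb_context st1 st2 A B f a g w : tangle_comb f a ->
  forall st, run st A = Some (st1 ++ up_down ++ st2) -> size w = size st ->
  ev st (A ++ shift (size st1) f ++ B) g w
  = \sum_(i < 3) a i * ev st (A ++ shift (size st1) (basis_tangle i) ++ B) g w.
Proof.
move=> [rf cf] st rA sw.
have rb i : run up_down (basis_tangle i) = Some up_down by case: i => [|[|i]].
have e D u : run up_down D = Some up_down -> size u = size (st1 ++ up_down ++ st2) ->
    ev (st1 ++ up_down ++ st2) (shift (size st1) D ++ B) g u
    = ev up_down D (fun x => ev (st1 ++ up_down ++ st2) B g
        (take (size st1) u ++ x ++ drop (size st1 + 2) u))
       (take 2 (drop (size st1) u)).
  move=> rD su; rewrite (ev_cat _ _ _ _ _ (st' := st1 ++ up_down ++ st2)); last first.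
    by rewrite run_shift (run_catr _ rD).
  rewrite -{1}(cat_take_drop (size st1) u) ev_catl; last first.
    by rewrite size_takel // su size_cat leq_addr.
  rewrite -{1}(cat_take_drop 2 (drop (size st1) u)) (ev_catr q0 s0 _ _ _ _ rD).
    by apply: eq_ev_all => x; rewrite drop_drop addnC.
  by rewrite size_takel // size_drop su !size_cat /= addKn.
rewrite (ev_cat _ _ _ _ _ rA).
rewrite (eq_ev q0 s0 rA (h := fun u => \sum_(i < 3) a i *
   ev (st1 ++ up_down ++ st2) (shift (size st1) (basis_tangle i) ++ B) g u)) //.
  by rewrite ev_sum; apply: eq_bigr => i _; rewrite (ev_cat _ _ _ _ _ rA).
move=> u su; rewrite e // cf; last first.
  by rewrite size_takel // size_drop su !size_cat /= addKn.
by apply: eq_bigr => i _; rewrite e.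
Qed.

End TangleAlgebra.

(** * The invariant of AS(n) as a polynomial in c and v *)

Section PolynomialValues.
Variable F : fieldType.

Definition eval1 (v : F) : {rmorphism {poly int} -> F} :=
  horner_eval v \o map_poly intr.
Definition eval2 (v c : F) : {rmorphism {poly {poly int}} -> F} :=
  horner_eval c \o map_poly (eval1 v).

Lemma eval1C v a : eval1 v a%:P = a%:~R.
Proof. by rewrite -[LHS]/((map_poly intr a%:P).[v]) map_polyC hornerC. Qed.
Lemma eval1X v : eval1 v 'X = v.
Proof. by rewrite -[LHS]/((map_poly intr 'X).[v]) map_polyX hornerX. Qed.
Lemma eval2C v c p : eval2 v c p%:P = eval1 v p.
Proof. by rewrite -[LHS]/((map_poly (eval1 v) p%:P).[c]) map_polyC hornerC. Qed.
Lemma eval2X v c : eval2 v c 'X = c.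
Proof. by rewrite -[LHS]/((map_poly (eval1 v) 'X).[c]) map_polyX hornerX. Qed.

Lemma eval1E v n (p : {poly int}) : (size p <= n)%N ->
  eval1 v p = \sum_(j < n) (p`_j)%:~R * v ^+ j.
Proof.
move=> sp; rewrite -[LHS]/((map_poly intr p).[v]) (@horner_coef_wide _ n); last first.
  exact: leq_trans (size_poly _ _) sp.
by apply: eq_bigr => j _; rewrite coef_map.
Qed.

Lemma eval2E v c n (p : {poly {poly int}}) : (size p <= n)%N ->
  eval2 v c p = \sum_(j < n) eval1 v p`_j * c ^+ j.
Proof.
move=> sp; rewrite -[LHS]/((map_poly (eval1 v) p).[c]) (@horner_coef_wide _ n); last first.
  exact: leq_trans (size_poly _ _) sp.
by apply: eq_bigr => j _; rewrite coef_map.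
Qed.

End PolynomialValues.

Arguments eval1 : simpl never.
Arguments eval2 : simpl never.

Definition row_poly (r : seq Z) : {poly int} :=
  foldr (fun a p => (int_of_Z a)%:P + 'X * p) 0 r.
Definition cv_poly (l : cvpoly) : {poly {poly int}} :=
  foldr (fun r p => (row_poly r)%:P + 'X * p) 0 l.

(** * Top coefficients in c, taken at v = 0 *)

Section TopCoefficient.
Variable R : comNzRingType.

Lemma top_sizeM (p r : {poly R}) m n : (size p <= m.+1)%N -> (size r <= n.+1)%N ->
  (size (p * r)%R <= (m + n).+1)%N.
Proof.
move=> hp hr; apply: leq_trans (size_polyMleq _ _) _.
by rewrite -subn1 leq_subLR add1n -addSn -addnS leq_add.
Qed.

Lemma top_coefM (p r : {poly R}) m n : (size p <= m.+1)%N -> (size r <= n.+1)%N ->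
  (p * r)`_(m + n) = p`_m * r`_n.
Proof.
move=> hp hr; have mn : (m < (m + n).+1)%N by lia.
rewrite coefM (bigD1 (Ordinal mn)) //= addKn big1 ?addr0 // => j.
rewrite -val_eqE /= => jm; case: (ltngtP j m) jm => // h _.
  by rewrite [r`_ _]nth_default ?mulr0 //; apply: leq_trans hr _; lia.
by rewrite [p`_ _]nth_default ?mul0r //; apply: leq_trans hp _; lia.
Qed.

Lemma top_sizeX (p : {poly R}) m k : (size p <= m.+1)%N ->
  (size (p ^+ k)%R <= (m * k).+1)%N.
Proof.
move=> hp; elim: k => [|k IH]; first by rewrite expr0 muln0 size_poly1.
by rewrite exprS mulnS; apply: top_sizeM.
Qed.

Lemma top_coefX (p : {poly R}) m k : (size p <= m.+1)%N ->
  (p ^+ k)`_(m * k) = p`_m ^+ k.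
Proof.
move=> hp; elim: k => [|k IH]; first by rewrite expr0 muln0 coef1.
by rewrite !exprS mulnS top_coefM ?IH // top_sizeX.
Qed.

End TopCoefficient.

(** Only a bound on the degree in c: [a] may be 0, so a summand of lower degree counts as one with
    coefficient 0 ([top_at_lt]). *)
Definition top_at (m : nat) (p : {poly {poly int}}) (a : int) : Prop :=
  (size p <= m.+1)%N /\ p`_m`_0 = a.

Lemma top_atM m n p r a b : top_at m p a -> top_at n r b ->
  top_at (m + n) (p * r) (a * b).
Proof.
move=> [hp <-] [hr <-]; split; first exact: top_sizeM.
by rewrite top_coefM // coef0M.
Qed.

Lemma top_atD m p r a b : top_at m p a -> top_at m r b -> top_at m (p + r) (a + b).
Proof.
move=> [hp <-] [hr <-]; split; last by rewrite !coefD.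
by rewrite (leq_trans (size_polyD _ _)) // geq_max hp.
Qed.

Lemma top_atN m p a : top_at m p a -> top_at m (- p) (- a).
Proof. by move=> [hp <-]; split; rewrite ?size_polyN ?coefN. Qed.

Lemma top_at_lt m n p a : top_at m p a -> (m < n)%N -> top_at n p 0.
Proof.
move=> [hp _] mn; have hn := leq_trans hp mn; split; first exact: leqW.
by rewrite [p`_ _]nth_default ?coef0.
Qed.

Lemma top_atC p : top_at 0 p%:P p`_0.
Proof. by split; rewrite ?size_polyC_leq1 // coefC. Qed.

Lemma top_atX : top_at 1 'X 1.
Proof. by split; rewrite ?size_polyX // coefX coef1. Qed.

Lemma cv_poly_coef l m : (cv_poly l)`_m = row_poly (nth [::] l m).
Proof.
elim: l m => [|r l IH] m; first by rewrite coef0 nth_nil.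
by rewrite /= coefD coefC coefXM; case: m => [|m] /=; rewrite ?addr0 ?add0r ?IH.
Qed.

Lemma cv_poly_top l m a : (size l <= m.+1)%N ->
  int_of_Z (head 0%bZ (nth [::] l m)) = a -> top_at m (cv_poly l) a.
Proof.
move=> sl <-; split.
  apply/leq_sizeP => j hj; rewrite cv_poly_coef nth_default //; lia.
rewrite cv_poly_coef; case: (nth _ l m) => [|b r] /=; first by rewrite coef0.
by rewrite coefD coefC coefXM addr0.
Qed.

(* [(x, y, z)] stands for x E + y + z (T - c E), where E is the identity tangle
   and T the positive clasp; E^2 = 0, E T = E and
   T^2 = (2 c - 2 - 2 v) E - v + (1 + v) T. *)
Definition triple := ({poly {poly int}} * {poly {poly int}} * {poly {poly int}})%type.

Definition vP : {poly {poly int}} := 'X%:P.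

Definition tmul (t t' : triple) : triple :=
  let: (x, y, z) := t in let: (x', y', z') := t' in
  (x * y' + y * x' + x * z' + z * x' + ((1 + vP) * 'X - 2 - 2 * vP) * (z * z'),
   y * y' - vP * (z * z'),
   y * z' + z * y' + (1 + vP) * (z * z')).

(** In top degree at v = 0 only a + b E is left. The coordinate of E is one degree lower because E
    closes up to one more power of c than the cut tangle. The basis vector T - c E keeps it so:
    along E, 1, T the first coordinate would be x - c z. *)
Definition weight_at (d : nat) (a b : int) (t : triple) : Prop :=
  let: (x, y, z) := t in [/\ top_at d x b, top_at d.+1 y a & top_at d z 0].

(** The top parts multiply as (a + b E) (a' + b' E) with E^2 = 0. The product z z' comes with an
    additional factor c, but its top coefficient is 0 at v = 0. *)
Lemma weight_mul d d' a b a' b' t t' : weight_at d a b t -> weight_at d' a' b' t' ->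
  weight_at (d + d').+1 (a * a') (b * a' + a * b') (tmul t t').
Proof.
case: t t' => [[x y] z] [[x' y'] z'] [hx hy hz] [hx' hy' hz'] /=.
have hzz := top_atM hz hz'; have hv : top_at 0 vP 0.
  by have := top_atC 'X; rewrite coefX.
have h1 : top_at 0 1 1 by have := top_atC 1; rewrite coef1.
have h2 : top_at 0 2 2 by have := top_atD h1 h1.
have h1v := top_atD h1 hv.
have e1 : (d + d'.+1 = (d + d').+1)%N by lia.
have e2 : (d.+1 + d' = (d + d').+1)%N by lia.
split.
- have := top_atM hx hy'; rewrite e1 => k1.
  have := top_atM hy hx'; rewrite e2 => k2.
  have k3 := top_at_lt (top_atM hx hz') (ltnSn _).
  have k4 := top_at_lt (top_atM hz hx') (ltnSn _).
  have hc : top_at 1 ((1 + vP) * 'X - 2 - 2 * vP) 1.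
    have c1 := top_atM h1v top_atX.
    have c2 := top_at_lt h2 (ltnSn 0); have c3 := top_at_lt (top_atM h2 hv) (ltnSn 0).
    have := top_atD (top_atD c1 (top_atN c2)) (top_atN c3).
    by rewrite !oppr0 !addr0 mul1r.
  have k5 := top_atM hc hzz.
  have := top_atD (top_atD (top_atD (top_atD k1 k2) k3) k4) k5.
  by rewrite !mulr0 !addr0.
- have k1 := top_atM hy hy'; have k2 := top_atM hv hzz.
  have e3 : (d.+1 + d'.+1 = (d + d').+2)%N by lia.
  rewrite e3 in k1; have k3 : top_at (d + d').+2 (vP * (z * z')) 0.
    by apply: top_at_lt k2 _; lia.
  by have := top_atD k1 (top_atN k3); rewrite oppr0 addr0.
- have := top_atM hy hz'; rewrite e2 mulr0 => k1.
  have := top_atM hz hy'; rewrite e1 mul0r => k2.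
  have k3 : top_at (d + d').+1 ((1 + vP) * (z * z')) 0.
    by apply: top_at_lt (top_atM h1v hzz) _; lia.
  by have := top_atD (top_atD k1 k2) k3; rewrite !addr0.
Qed.

Definition TT_pos : triple := (cv_poly TT_pos_x, cv_poly TT_pos_y, cv_poly TT_pos_z).
Definition TT_neg : triple := (cv_poly TT_neg_x, cv_poly TT_neg_y, cv_poly TT_neg_z).

(** Index [n] stands for [n.+1] blocks, since [box_pow] starts from one copy. *)
Definition AS_triple (n : nat) : triple :=
  iter n (fun t => tmul t (tmul TT_pos TT_neg)) (tmul TT_pos TT_neg).

(** Both clasped bands have top part 2 + E, so a block has (2 + E)^2 = 4 + 4 E, and (4 + 4 E)^(n+1)
    = 4^(n+1) (1 + (n+1) E). *)
Lemma AS_triple_weight n : weight_at (4 * n + 3) (4 ^+ n.+1) (n.+1%:R * 4 ^+ n.+1) (AS_triple n).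
Proof.
have h : weight_at 3 4 4 (tmul TT_pos TT_neg).
  apply: (@weight_mul 1 1 2 1 2 1); split; exact: cv_poly_top.
elim: n => [|n IH]; first by rewrite muln0 expr1 mul1r.
have := weight_mul IH h.
have -> : (4 * n + 3 + 3).+1 = (4 * n.+1 + 3)%N by lia.
rewrite -mulrA -!exprSr.
set a := 4 ^+ n.+2; have -> : n.+2%:R * a = n.+1%:R * a + a by rewrite -natr1 mulrDl mul1r.
by [].
Qed.

Definition AS_poly (n : nat) : {poly {poly int}} :=
  let: (x, y, z) := AS_triple n in
  x * cv_poly closure_id + y * cv_poly closure_cut + z * cv_poly closure_clasp.

(** At v = 0 the identity closes up to c^3 and the cut tangle to c^2, plus lower terms. Their
    contributions meet in the same degree and the coefficients n + 1 and 1 add up. *)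
Lemma AS_poly_top n : top_at (4 * n + 6) (AS_poly n) (n.+2%:R * 4 ^+ n.+1).
Proof.
rewrite /AS_poly; case: (AS_triple n) (AS_triple_weight n) => [[x y] z] [hx hy hz].
have k1 : top_at 3 (cv_poly closure_id) 1 by exact: cv_poly_top.
have k2 : top_at 2 (cv_poly closure_cut) 1 by exact: cv_poly_top.
have k3 : top_at 2 (cv_poly closure_clasp) (-1) by exact: cv_poly_top.
have := top_atM hx k1; have := top_atM hy k2.
have -> : (4 * n + 3 + 3 = 4 * n + 6)%N by lia.
have -> : ((4 * n + 3).+1 + 2 = 4 * n + 6)%N by lia.
move=> h2 h1; have h3 : top_at (4 * n + 6) (z * cv_poly closure_clasp) 0.
  by apply: top_at_lt (top_atM hz k3) _; lia.
have := top_atD (top_atD h1 h2) h3; rewrite !mulr1 addr0.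
by rewrite -[n.+2]addn1 natrD mulrDl mul1r.
Qed.

(** * State sums of AS(n) *)

Section TriplesOfTangles.
Variables (F : fieldType) (q s : F).
Hypotheses (q0 : q != 0) (s0 : s != 0).
Local Notation lv := (lval q s).
Local Notation v := (q ^- 2).
Local Notation c := (s ^+ 2 + q ^- 2 * s ^- 2).
Local Notation e2 := (eval2 v c).
Local Notation comb := (tangle_comb q s).

Lemma lval_v : lv v_l = v.
Proof. by rewrite /lval /= /tval /zval /= expr0z mul1r mulr1 addr0. Qed.

Lemma lval_c : lv c_l = c.
Proof.
by rewrite /lval /= /tval /zval /= expr0z !mul1r addr0 addrC.
Qed.

Lemma lval_row r : lv (row_l r) = eval1 v (row_poly r).
Proof.
elim: r => [|a r IH]; first by rewrite rmorph0.
rewrite [row_poly _]/= rmorphD rmorphM eval1C eval1X -IH.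
rewrite lval_add lval_mul // lval_v; congr (_ + _).
case: Z.eqb_spec => [->|_] //=.
by rewrite /tval /= !expr0z !mulr1 addr0.
Qed.

Lemma lval_cv l : lv (cv_l l) = e2 (cv_poly l).
Proof.
elim: l => [|r l IH]; first by rewrite rmorph0.
rewrite [cv_poly _]/= rmorphD rmorphM eval2C eval2X -IH.
by rewrite lval_add lval_mul // lval_c lval_row.
Qed.

Definition triple_val (t : triple) (i : nat) : F :=
  let: (x, y, z) := t in nth 0 [:: e2 x - c * e2 z; e2 y; e2 z] i.

Definition represents (f : diagram) (k : F) (t : triple) : Prop :=
  comb f (fun i => k * triple_val t i).

Lemma eq_tangle_comb f a b : (forall i, (i < 3)%N -> a i = b i) ->
  comb f a -> comb f b.
Proof.
move=> ab [r h]; split=> // g w sw; rewrite h //.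
by apply: eq_bigr => i _; rewrite ab.
Qed.

Lemma lval_basis_prod i j k : lv (nth [::] (basis_prod i j) k) =
  nth 0 (match i, j with
         | 0%N, 0%N => [::]
         | 0%N, _ | _, 0%N => [:: 1]
         | 1%N, 1%N => [:: 0; 1]
         | 1%N, _ | _, 1%N => [:: 0; 0; 1]
         | _, _ => [:: 2 * c - 2 - 2 * v; - v; 1 + v]
         end) k.
Proof.
have l1 : lv lone = 1 by exact: lval1.
have z1 : zval F 1%bZ = 1 by []; have zN : zval F (-1)%bZ = -1 by [].
have z2 : zval F 2%bZ = 2 by []; have zN2 : zval F (-2)%bZ = -2 by [].
case: i j => [|[|i]] [|[|j]]; rewrite /basis_prod; case: k => [|[|[|k]]];
  rewrite [nth _ _ _]/= [RHS]/= ?nth_nil ?l1 //.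
have q2 : q ^ int_of_Z (-2)%bZ = v by []; have q1 : q ^ int_of_Z 0 = 1 by [].
have s2 : s ^ int_of_Z (-2)%bZ = s ^- 2 by []; have s1 : s ^ int_of_Z 0 = 1 by [].
have s3 : s ^ int_of_Z 2 = s ^+ 2 by [].
all: rewrite /lval /tval [foldr _ _ _]/= ?z1 ?zN ?z2 ?zN2 ?q2 ?q1 ?s1 ?s2 ?s3.
- by ring.
- by rewrite -[q ^ (-2)%Z]/v !expr0z; ring.
- by rewrite -[q ^ (-2)%Z]/v !expr0z; ring.
Qed.

Lemma represents_box f g k k' t t' : represents f k t -> represents g k' t' ->
  represents (box f g) (k * k') (tmul t t').
Proof.
move=> hf hg; apply: eq_tangle_comb (comb_box q0 s0 hf hg) => i hi.
rewrite !big_ord_recl !big_ord0 !lval_basis_prod.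
case: t t' {hf hg} => [[x y] z] [[x' y'] z'].
have ev : e2 vP = v by rewrite eval2C eval1X.
have eX : e2 'X = c by rewrite eval2X.
have e1 : e2 (1 + vP) = 1 + v by rewrite rmorphD rmorph1 ev.
rewrite /tmul /triple_val !(rmorphD, rmorphN, rmorphM) ?e1 ?ev ?eX ?rmorph1 ?rmorph_nat.
by case: i hi => [|[|[|//]]] _ /=; ring.
Qed.

Lemma lval_coords x y z i : (i < 3)%N ->
  lv (nth [::] (coords_l x y z) i) = nth 0 [:: lv x - c * lv z; lv y; lv z] i.
Proof.
have n1 : lv lneg1 = -1 by rewrite /lval /= /tval /zval /= !expr0z !mulr1 addr0.
case: i => [|[|[|//]]] _ //.
by rewrite -[nth _ _ _]/(ladd x (lmul lneg1 (lmul c_l z))) lval_add !lval_mul // n1 lval_c mulN1r.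
Qed.

Lemma represents_TT_pos : represents (TT true) 1 TT_pos.
Proof.
apply: eq_tangle_comb (tangle_checkP q0 s0 _ TT_pos_check) => // i hi.
by rewrite lval_coords // !lval_cv mul1r.
Qed.

Lemma represents_TT_neg : represents (TT false) (q ^+ 2) TT_neg.
Proof.
apply: eq_tangle_comb (tangle_checkP q0 s0 _ TT_neg_check) => // i hi.
have n2 : lv q2_l = q ^+ 2 by rewrite /lval /= /tval /zval /= expr0z mul1r mulr1 addr0.
rewrite lval_coords // !lval_mul // !lval_cv n2 /triple_val /TT_neg.
by case: i hi => [|[|[|//]]] _ /=; ring.
Qed.

Lemma represents_AS n : (0 < n)%N ->
  represents (box_pow (box (TT true) (TT false)) n) (q ^+ (2 * n)) (AS_triple n.-1).
Proof.
case: n => // n _; have h := represents_box represents_TT_pos represents_TT_neg.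
rewrite mul1r in h; elim: n => [|n IH]; first by rewrite muln1.
by have := represents_box IH h; rewrite -exprD -mulnSr.
Qed.

(** The events of [AS n] around its tangle, without the first minimum, at which the link is cut. *)
Definition AS_below : diagram :=
  [:: (1, Cup true); (0, Cup false); (1, Cross true); (2, Cross true);
      (2, Cross true); (1, Cross true); (0, Cap)]%N.
Definition AS_above : diagram := [:: (0, Cross true); (1, Cap); (0, Cap)]%N.

(** Values for the basis E, 1, T; the last one uses T = (T - c E) + c E. *)
Definition closure_coef (i : nat) : lpoly :=
  match i with
  | 0%N => cv_l closure_id
  | 1%N => cv_l closure_cut
  | _ => ladd (cv_l closure_clasp) (lmul c_l (cv_l closure_id))
  end.

Lemma closure_check i : (i < 3)%N ->
  teqb (tev [:: true; false] (AS_below ++ shift 1 (basis_tangle i) ++ AS_above)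
         (tword [:: c0; c0]))
       (tscale (lmul (mu_l c0) (closure_coef i)) tnil).
Proof. by case: i => [|[|[|//]]] _; vm_compute. Qed.

Lemma Phi_AS n : (0 < n)%N -> Phi q s (AS n) = q ^+ (2 * n) * e2 (AS_poly n.-1).
Proof.
move=> n0; have hr := represents_AS n0.
have -> : AS n = (0%N, Cup true) :: AS_below ++
  shift 1 (box_pow (box (TT true) (TT false)) n) ++ AS_above by [].
rewrite /Phi /cut_ev.
rewrite (comb_context q0 s0 (st1 := [:: true]) (st2 := [:: false]) _ _ hr) //.
have e i : (i < 3)%N -> ev q s [:: true; false]
    (AS_below ++ shift 1 (basis_tangle i) ++ AS_above) (unitf F) [:: c0; c0]
    = lv (mu_l c0) * lv (closure_coef i).
  move=> hi; rewrite -(teval_word q s [:: c0; c0]) -teval_tev //.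
  by rewrite (teval_eqb q0 s0 _ (closure_check hi)) teval_scale // lval_mul //
    (teval_word q s [::]) mulr1.
under eq_bigr => i _ do rewrite e //.
(* The normalising factor of [cut_ev] cancels the [mu_l c0] of [closure_check]. *)
have m1 : lv (muV_l c0) * lv (mu_l c0) = 1.
  by rewrite -lval_mul // -(lval1 q s); apply: lval_eqb.
rewrite mulr_sumr; under eq_bigr => i _.
  rewrite (_ : _ * _ = triple_val (AS_triple n.-1) i * lv (closure_coef i) * q ^+ (2 * n));
    last by rewrite -[RHS]mul1r -m1; ring.
  over.
rewrite -mulr_suml mulrC; congr (_ * _).
have k0 : lv (closure_coef 0) = e2 (cv_poly closure_id) by exact: lval_cv.
have k1 : lv (closure_coef 1) = e2 (cv_poly closure_cut) by exact: lval_cv.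
have k2 : lv (closure_coef 2) = e2 (cv_poly closure_clasp) + c * e2 (cv_poly closure_id).
  by rewrite [LHS]lval_add lval_mul // !lval_cv lval_c.
move: k0 k1 k2; rewrite !big_ord_recl big_ord0 /AS_poly.
case: (AS_triple _) => [[x y] z] k0 k1 k2.
rewrite -[LHS]/((e2 x - c * e2 z) * lv (closure_coef 0) +
  (e2 y * lv (closure_coef 1) + (e2 z * lv (closure_coef 2) + 0))).
move: (cv_poly closure_id) (cv_poly closure_cut) (cv_poly closure_clasp) k0 k1 k2.
by move=> a b d -> -> ->; rewrite !rmorphD !rmorphM; ring.
Qed.

End TriplesOfTangles.

Lemma link_AS n : (0 < n)%N -> link_diagram (AS n).
Proof.
move=> n0; have [r _] := represents_AS qK0 sK0 n0.
rewrite /link_diagram /AS catA run_cat -[X in obind _ X]/(Some ([:: true] ++ [:: true; false; false])).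
by rewrite [obind _ _]/= run_cat (run_shift [:: true]) (run_catr [:: false] r).
Qed.

(** * Leading and trailing terms *)

Definition coefz (R : {poly {poly int}}) (i j : int) : int :=
  match i, j with Posz m, Posz n => R`_m`_n | _, _ => 0 end.

(** Division by s^a q^b: questions about extreme exponents of [P] become questions about
    coefficients of [R]. *)
Lemma laurent_of_poly (R : {poly {poly int}}) (a b : int) :
  exists P : laurent, (forall i j, P (i, j) = coefz R (i + a) (j + b)) /\
    laurent_val P = sK ^ (- a) * qK ^ (- b) * eval2 qK sK R.
Proof.
pose m := size R; pose l := (\max_(i < m) size (R`_i)%R)%N.
have Rl i : (size (R`_i)%R <= l)%N.
  have [hi|hi] := ltnP i m; last by rewrite nth_default // size_poly0.
  exact: (leq_bigmax (F := fun i : 'I_m => size (R`_i)%R) (Ordinal hi)).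
pose h (i j : nat) : int * int := (i%:Z - a, j%:Z - b).
pose S := [seq h i j | i <- index_iota 0 m, j <- index_iota 0 l].
have uS : uniq S.
  apply: allpairs_uniq; rewrite ?iota_uniq // => -[i j] [i' j'] _ _ /= [].
  by move=> /addIr/eqP; rewrite eqz_nat => /eqP -> /addIr/eqP; rewrite eqz_nat => /eqP ->.
pose P : laurent := [fsfun k in seq_fset tt S => coefz R (k.1 + a) (k.2 + b) | 0].
have PE i j : P (i, j) = coefz R (i + a) (j + b).
  rewrite /P fsfun_fun seq_fsetE /=; case: ifPn => // hS.
  case ei: (i + a) => [i'|//]; case ej: (j + b) => [j'|//] /=.
  have [hi|hi] := ltnP i' m; last by rewrite [R`_i']nth_default ?coef0.
  have [hj|hj] := ltnP j' l; last by rewrite nth_default // (leq_trans (Rl _)).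
  case/negP: hS; apply/allpairsP; exists (i', j'); rewrite !mem_index_iota /=; split=> //.
  by rewrite /h -ei -ej !addrK.
exists P; split=> //; rewrite /laurent_val.
have sub : (finsupp P `<=` seq_fset tt S)%fset.
  apply/fsubsetP => k; rewrite mem_finsupp /P fsfun_fun.
  by case: ifP => //; rewrite eqxx.
rewrite (big_fset_incl _ sub) => [|k _]; last first.
  by rewrite memNfinsupp => /eqP ->; rewrite !mul0r.
rewrite (perm_big _ (seq_fset_perm tt S)) undup_id // big_allpairs_dep.
rewrite (@eval2E _ _ _ m) // mulr_sumr big_mkord; apply: eq_bigr => i _.
rewrite (@eval1E _ _ l) // mulr_suml mulr_sumr big_mkord; apply: eq_bigr => j _.
have reorder (F : fieldType) (x y z u w : F) :
  x * (y * z) * (u * w) = z * w * (x * u * y) by ring.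
rewrite -[(h i j).1]/(i%:Z - a) -[(h i j).2]/(j%:Z - b) PE !subrK.
by rewrite -[coefz _ _ _]/(R`_i`_j) (expfzDr _ _ sK0) (expfzDr _ _ qK0) reorder.
Qed.

(** This is q^(2m) p(q^-2). The order of the exponents is reversed, so the constant term in v turns
    into the highest power of q. *)
Definition rev_poly (m : nat) (p : {poly int}) : {poly int} :=
  \sum_(j < m.+1) (p`_j)%:P * 'X^(2 * (m - j)).

Lemma size_rev_poly m p : (size (rev_poly m p) <= (2 * m).+1)%N.
Proof.
apply: leq_trans (size_sum _ _ _) _; apply/bigmax_leqP => j _.
rewrite mul_polyC; apply: leq_trans (size_scale_leq _ _) _.
by rewrite size_polyXn ltnS leq_mul2l leq_subr orbT.
Qed.

Lemma rev_poly_top m p : (rev_poly m p)`_(2 * m) = p`_0.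
Proof.
rewrite coef_sum big_ord_recl big1 => [|j _].
  by rewrite subn0 coefCM coefXn eqxx mulr1 addr0.
rewrite coefCM coefXn; case: eqP => [|_]; last by rewrite mulr0.
by rewrite /= /bump leq0n; have := ltn_ord j; lia.
Qed.

Lemma eval_rev_poly (F : fieldType) (q : F) m (p : {poly int}) : q != 0 -> (size p <= m.+1)%N ->
  eval1 q (rev_poly m p) = q ^+ (2 * m) * eval1 (q ^- 2) p.
Proof.
move=> q0 sp; rewrite (eval1E _ sp) rmorph_sum mulr_sumr; apply: eq_bigr => j _.
rewrite rmorphM rmorphXn eval1C eval1X mulrCA; congr (_ * _).
have hj : (j <= m)%N by rewrite -ltnS.
have -> : (2 * m = 2 * (m - j) + 2 * j)%N by rewrite -mulnDr subnK.
by rewrite exprVn -exprM exprD mulfK // expf_neq0.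
Qed.

Section Substitution.
Variables (N M : nat) (Q : {poly {poly int}}).
Hypotheses (sQ : (size Q <= N.+1)%N) (sQk : forall k, (size (Q`_k)%R <= M.+1)%N).

(* s^2 + q^-2 s^-2 is the quotient of these two. *)
Let U : {poly {poly int}} := ('X^2)%:P * 'X^4 + 1.
Let W : {poly {poly int}} := ('X^2)%:P * 'X^2.

Definition substituted : {poly {poly int}} :=
  \sum_(k < N.+1) (rev_poly M Q`_k)%:P * (U ^+ k * W ^+ (N - k)).

Lemma eval_substituted (F : fieldType) (q s : F) : q != 0 -> s != 0 ->
  eval2 q s substituted = q ^+ (2 * M) * (q ^+ 2 * s ^+ 2) ^+ N *
    eval2 (q ^- 2) (s ^+ 2 + q ^- 2 * s ^- 2) Q.
Proof.
move=> q0 s0; rewrite (eval2E _ _ sQ) rmorph_sum mulr_sumr; apply: eq_bigr => k _.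
rewrite !rmorphM !rmorphXn eval2C eval_rev_poly //.
have eW : eval2 q s W = q ^+ 2 * s ^+ 2.
  by rewrite rmorphM eval2C !rmorphXn eval2X eval1X.
have eU : eval2 q s U = (q ^+ 2 * s ^+ 2) * (s ^+ 2 + q ^- 2 * s ^- 2).
  rewrite rmorphD rmorph1 rmorphM eval2C !rmorphXn eval2X eval1X.
  by field; rewrite q0 s0.
have hk : (k <= N)%N by rewrite -ltnS.
rewrite eW eU exprMn; set x := q ^+ 2 * s ^+ 2.
have -> : x ^+ N = x ^+ (N - k) * x ^+ k by rewrite -exprD subnK.
ring.
Qed.

Let sU : (size U <= 5)%N.
Proof.
rewrite (leq_trans (size_polyD _ _)) // geq_max size_poly1 andbT.
by rewrite mul_polyC (leq_trans (size_scale_leq _ _)) // size_polyXn.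
Qed.

Let sW : (size W <= 3)%N.
Proof. by rewrite /W mul_polyC (leq_trans (size_scale_leq _ _)) // size_polyXn. Qed.

(** [U] has s-degrees 0 and 4 and [W] is a multiple of s^2, so the summand of index [k] lives in
    s-degrees from 2 (N - k) to 2 (N + k). Only k = N reaches the ends 0 and 4 N. *)
Let term_size k : (k <= N)%N ->
  (size ((rev_poly M Q`_k)%:P * (U ^+ k * W ^+ (N - k)))%R <= (2 * N + 2 * k).+1)%N.
Proof.
move=> hk; rewrite mul_polyC (leq_trans (size_scale_leq _ _)) //.
apply: leq_trans (top_sizeM (top_sizeX k sU) (top_sizeX (N - k) sW)) _; lia.
Qed.

Lemma size_substituted : (size substituted <= (4 * N).+1)%N.
Proof.
apply: leq_trans (size_sum _ _ _) _; apply/bigmax_leqP => k _.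
have hk : (k <= N)%N by rewrite -ltnS.
apply: leq_trans (term_size hk) _; lia.
Qed.

(** The top coefficient of [U] is q^2 and its constant term is 1. This is why the two extreme terms
    have q-exponents 2 N apart. *)
Lemma substituted_top : substituted`_(4 * N) = rev_poly M Q`_N * 'X^(2 * N).
Proof.
rewrite coef_sum big_ord_recr /= big1 => [|k _].
  rewrite add0r subnn expr0 mulr1 coefCM top_coefX // exprM.
  by rewrite coefD coefCM coefXn coef1 mulr1 addr0.
rewrite nth_default //; have hk := ltn_ord k.
by apply: leq_trans (term_size (ltnW hk)) _; move: hk; rewrite /=; lia.
Qed.

Lemma substituted_bot : substituted`_0 = rev_poly M Q`_N.
Proof.
have U0 : U`_0 = 1 by rewrite /U coefD coefCM coefXn mulr0 add0r coef1.
have W0 : W`_0 = 0 by rewrite /W coefCM coefXn mulr0.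
have X0 (p : {poly {poly int}}) k : (p ^+ k)`_0 = p`_0 ^+ k.
  by elim: k => [|k IH]; rewrite ?expr0 ?coef1 // !exprS coef0M IH.
rewrite coef_sum big_ord_recr /= big1 => [|k _].
  by rewrite add0r subnn expr0 mulr1 coefCM X0 U0 expr1n mulr1.
rewrite coefCM coef0M !X0 U0 W0 expr0n subn_eq0 leqNgt ltn_ord /= !mulr0 //.
Qed.

End Substitution.

Lemma monomial_shift (F : fieldType) (q s w : F) (N M : nat) (b : int) :
  q != 0 -> s != 0 ->
  s ^ (- (2 * N)%N%:Z) * q ^ (- ((2 * N + 2 * M)%N%:Z - b)) *
    (q ^+ (2 * M) * (q ^+ 2 * s ^+ 2) ^+ N * w) = q ^ b * w.
Proof.
move=> q0 s0; rewrite opprB expfzDr // -!exprnN exprD exprMn -!exprM.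
have := expf_neq0 (2 * N) q0; have := expf_neq0 (2 * M) q0; have := expf_neq0 (2 * N) s0.
move: (_ ^+ _) (_ ^+ _) (_ ^+ _) (q ^ b) => x y z u x0 y0 z0.
by field; rewrite x0 y0 z0.
Qed.

Lemma extreme_terms (N M : nat) (Q : {poly {poly int}}) (a b : int) :
  (size Q <= N.+1)%N -> (forall k, (size (Q`_k)%R <= M.+1)%N) -> Q`_N`_0 = a -> a != 0 ->
  exists P : laurent,
    [/\ laurent_val P = qK ^ b * eval2 (qK ^- 2) (sK ^+ 2 + qK ^- 2 * sK ^- 2) Q,
        leading_term P (2 * N)%N b a & trailing_term P (- (2 * N)%N%:Z) (b - (2 * N)%N%:Z) a].
Proof.
(* Clearing denominators multiplies by s^(2N) q^(2N+2M); undoing this and multiplying by q^b is a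
   single shift of exponents. *)
move=> sQ sQk Qa a0; pose e : int := (2 * N + 2 * M)%N%:Z - b.
have [P [PE PV]] := laurent_of_poly (substituted N M Q) (2 * N)%N%:Z e.
have Ptop j : P ((2 * N)%N%:Z, j + b - (2 * N + 2 * M)%N%:Z)
    = coefz (rev_poly M Q`_N * 'X^(2 * N))%:P 0 j.
  rewrite PE /e (_ : _ + (_ - b) = j); last by ring.
  rewrite -PoszD (_ : (2 * N + 2 * N = 4 * N)%N); last by lia.
  by rewrite /= substituted_top // coefC.
have Pbot j : P (- (2 * N)%N%:Z, j + b - (2 * N + 2 * M)%N%:Z)
    = coefz (rev_poly M Q`_N)%:P 0 j.
  rewrite PE /e (_ : _ + (_ - b) = j); last by ring.
  by rewrite addNr /= substituted_bot // coefC.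
have range i j : P (i, j) != 0 -> - (2 * N)%N%:Z <= i <= (2 * N)%N.
  rewrite PE; case ei: (i + _) => [k|] //; case: (j + e) => [l|] //= h.
  have hk : (k <= 4 * N)%N.
    rewrite leqNgt; apply: contra h => hk; rewrite [_`_k]nth_default ?coef0 //.
    exact: leq_trans (size_substituted M sQ) hk.
  by have -> : i = k%:Z - (2 * N)%N%:Z by [rewrite -ei addrK]; lia.
have topE : P ((2 * N)%N%:Z, b) = a.
  have eb : b = (2 * N + 2 * M)%N%:Z + b - (2 * N + 2 * M)%N%:Z by ring.
  rewrite [in P _]eb Ptop /=.
  by rewrite coefC /= coefMXn ltnNge leq_addr addKn rev_poly_top.
have botE : P (- (2 * N)%N%:Z, b - (2 * N)%N%:Z) = a.
  rewrite (_ : b - _ = (2 * M)%N%:Z + b - (2 * N + 2 * M)%N%:Z).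
    by rewrite Pbot /= coefC rev_poly_top.
  by rewrite PoszD; ring.
have inv j : j = j - b + (2 * N + 2 * M)%N%:Z + b - (2 * N + 2 * M)%N%:Z by ring.
have sr := size_rev_poly M Q`_N.
exists P; split.
- rewrite PV (eval_substituted sQ sQk qK0 sK0).
  exact: monomial_shift qK0 sK0.
- split; split=> //; first by exists b; rewrite topE.
    by move=> i j /range /andP[].
  move=> j; rewrite [in P _](inv j) Ptop; case ej: (_ + _) => [k|] //=.
  rewrite coefC /= coefMXn; case: ifP => [|hk]; first by rewrite eqxx.
  move=> h; have hk2 : (k - 2 * N < (2 * M).+1)%N.
    by rewrite ltnNge; apply: contra h => hk2; rewrite nth_default // (leq_trans sr).
  lia.
- split; split=> //; first by exists (b - (2 * N)%N%:Z); rewrite botE.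
    by move=> i j /range /andP[].
  move=> j; rewrite [in P _](inv j) Pbot; case ej: (_ + _) => [k|] //=.
  rewrite coefC /= => h; have hk2 : (k < (2 * M).+1)%N.
    by rewrite ltnNge; apply: contra h => hk2; rewrite nth_default // (leq_trans sr).
  lia.
Qed.

Lemma Posz_mul_exp (n : nat) :
  n.+1%:R * 4 ^+ n = (n.+1 * 4 ^ n)%N%:Z.
Proof. by rewrite PoszM -natz -[(4 ^ n)%N%:Z]natz natrX. Qed.

Theorem corollary2p4 (n : nat) (hn : (1 <= n)%N) :
  exists P : laurent,
    [/\ LG (AS n) = laurent_val P,
        leading_term P (4 + 8 * n%:Z) (2 * n%:Z) ((n.+1 * 4 ^ n)%N%:Z),
        trailing_term P (- 4 - 8 * n%:Z) (- 4 - 6 * n%:Z) ((n.+1 * 4 ^ n)%N%:Z)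
      & span_s P (4 * (4 * n%:Z + 2))].
Proof.
pose Q := AS_poly n.-1; pose N := (4 * n + 2)%N.
(* Any bound on the v-degrees serves: it cancels in the conclusion of [extreme_terms]. *)
pose M := (\max_(k < size Q) size (Q`_k)%R)%N.
have [sQ Qa] := AS_poly_top n.-1.
have eN : (4 * n.-1 + 6 = N)%N by rewrite /N; lia.
rewrite eN prednK // Posz_mul_exp in sQ Qa.
have sQk k : (size (Q`_k)%R <= M.+1)%N.
  have [hk|hk] := ltnP k (size Q); last by rewrite nth_default // size_poly0.
  exact: leqW (leq_bigmax (F := fun i : 'I_(size Q) => size (Q`_i)%R) (Ordinal hk)).
have a0 : (n.+1 * 4 ^ n)%N%:Z != 0 by rewrite eqz_nat muln_eq0 expn_eq0.
(* The exponent 2 n comes from the factor q^2 of each of the n negatively clasped bands; the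
   trailing one is 2 n - 2 N = - 4 - 6 n. *)
have [P [PV lead trail]] := extreme_terms (2 * n)%N%:Z sQ sQk Qa a0.
have e1 : (2 * N)%N%:Z = 4 + 8 * n%:Z by rewrite /N; lia.
have e2 : - (2 * N)%N%:Z = - 4 - 8 * n%:Z by rewrite /N; lia.
have e3 : (2 * n)%N%:Z - (2 * N)%N%:Z = - 4 - 6 * n%:Z by rewrite /N; lia.
rewrite e1 PoszM in lead; rewrite e3 e2 in trail.
exists P; split=> //.
- have ne : AS n <> [::] by [].
  by rewrite (LG_Phi (link_AS hn) ne) (Phi_AS qK0 sK0 hn) PV.
- exists (4 + 8 * n%:Z), (- 4 - 8 * n%:Z).
  by split; [case: lead | case: trail | ring].
Qed.
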